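(* Consider the Poisson balloon process on the hyperbolic plane $\mathbb{H}$ (of any constant negative curvature, with $\rho$ the corresponding hyperbolic metric and $\mu$ the corresponding hyperbolic area measure). Then the process is transient: almost surely, for every $x\in\mathbb{H}$, the set of times $\{t\ge 0: x\in S_t\}$ is bounded. Moreover, for a fixed origin $o\in\mathbb{H}$, $$\liminf_{t\to\infty}\frac{R_t}{t}\ \ge\ \frac{\log 2}{\log\frac{1+\sqrt5}{2}}\quad\text{almost surely.}$$
   Context: Balloon process. Let $(\Omega,\rho)$ be a metric space and let $\Pi$ be a point process on $\Omega$, with $[\Pi]$ its set of points. Around each $x\in[\Pi]$ a ball (balloon) grows at rate 1, so that at time $t$ it has radius $t$; whenever two balloons touch, both immediately pop and are removed. Formally, each $x\in[\Pi]$ has a popping time $T_x\in(0,\infty]$ and is active at time $t$ iff $t<T_x$, where (i) any two distinct points $x,y$ active at time $t$ satisfy $\rho(x,y)>2t$; (ii) if $T_x<\infty$, then there is $y\in[\Pi]$, $y\ne x$, with $T_y=T_x$ and $\rho(x,y)=2T_x$. For the Poisson process considered here, almost surely there is exactly one such family of popping times, so the process is well defined. The Poisson balloon process on a metric measure space $(\Omega,\rho,\mu)$ is the balloon process started from a Poisson point process $\Pi$ with intensity measure $\mu$. Notation: $\Pi_t$ is the point process of centers of balloons active at time $t$, with $[\Pi_t]$ its set of points; $S_t=\{x\in\Omega:\rho(x,[\Pi_t])\le t\}$ is the set covered by balloons at time $t$; $R_t=\rho(o,[\Pi_t])$ is the distance from the origin $o$ to the nearest active center at time $t$ (where $\rho(x,S)=\inf_{y\in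 S}\rho(x,y)$). *)

(* Defs.v *)
From mathcomp Require Import all_boot all_order all_algebra.
From mathcomp Require Import all_classical all_reals all_analysis.
From mathcomp Require Import measurable_realfun.

Set Implicit Arguments.
Unset Strict Implicit.
Unset Printing Implicit Defensive.

Import Order.TTheory GRing.Theory Num.Theory.
Import numFieldNormedType.Exports.

Local Open Scope classical_set_scope.
Local Open Scope ring_scope.

(** The hyperbolic plane: upper half-plane model, scaled to curvature [k < 0].
    The metric tensor is [(dx^2 + dy^2) / (- k * y^2)]. *)

Definition upper_half_plane (R : realType) : set (R * R) :=
  [set z | 0 < z.2].

(* Inverse of the restriction of cosh to [0, +oo[, for 1 <= u. *)
Definition arcosh (R : realType) (u : R) : R :=
  ln (u + Num.sqrt (u ^+ 2 - 1)).

Definition hyp_dist (R : realType) (k : R) (z w : R * R) : R :=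
  arcosh (1 + ((z.1 - w.1) ^+ 2 + (z.2 - w.2) ^+ 2) / (2 * z.2 * w.2))
  / Num.sqrt (- k).

Definition hyp_area (R : realType) (k : R) (A : set (R * R)) : \bar R :=
  (\int[lebesgue_measure \x lebesgue_measure]_(z in A `&` @upper_half_plane R)
     ((- k * z.2 ^+ 2)^-1)%:E)%E.

(* Taking [E i := setT] for the other indices gives the product rule for
   subfamilies. *)
Definition mutually_independent (R : realType) (d : measure_display)
    (W : measurableType d) (P : probability W R) (n : nat)
    (X : 'I_n -> W -> \bar R) : Prop :=
  forall E : 'I_n -> set (\bar R), (forall i, measurable (E i)) ->
    (P [set w | forall i, E i (X i w)] = \prod_(i < n) P (X i @^-1` E i))%E.

(* A (simple) point process is represented by its random set of points. *)
Definition point_count (R : realType) (W U : choiceType)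
    (Pi : W -> set U) (A : set U) (w : W) : \bar R :=
  counting (Pi w `&` A).

(* The Poisson mass function is written out because the library's
   [poisson_pmf 0] is constantly 1; here [0 ^+ 0 = 1] makes a null set
   almost surely empty.  A set of infinite intensity almost surely
   contains infinitely many points. *)
Definition poisson_point_process (R : realType) (d : measure_display)
    (W : measurableType d) (P : probability W R) (dU : measure_display)
    (U : measurableType dU) (mu : set U -> \bar R) (Pi : W -> set U) : Prop :=
  [/\ forall A : set U, measurable A ->
        measurable_fun setT (point_count R Pi A),
      forall (A : set U) (m : R), measurable A -> mu A = m%:E ->
        forall j : nat,
          P [set w | point_count R Pi A w = (j%:R)%:E]
            = (m ^+ j / (j`!)%:R * expR (- m))%:E,
      forall A : set U, measurable A -> mu A = +oo%E ->
        P [set w | point_count R Pi A w = +oo%E] = 1%:E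
    & forall (n : nat) (A : 'I_n -> set U), (forall i, measurable (A i)) ->
        (forall i j, i != j -> A i `&` A j = set0) ->
        mutually_independent P (fun i => point_count R Pi (A i))].

(* [T x] is the popping time of the balloon centred at [x], [+oo] if it never
   pops; its values outside [X] are irrelevant. *)
Definition active (R : realType) (U : Type) (X : set U) (T : U -> \bar R)
    (t : R) : set U :=
  [set x | X x /\ (t%:E < T x)%E].

Definition popping_times (R : realType) (U : Type) (rho : U -> U -> R)
    (X : set U) (T : U -> \bar R) : Prop :=
  [/\ forall x, X x -> (0 < T x)%E,
      forall (t : R) (x y : U), 0 <= t -> active X T t x -> active X T t y ->
        x <> y -> 2 * t < rho x y
    & forall x, X x -> (T x < +oo)%E ->
        exists y, [/\ X y, y <> x, T y = T x & (rho x y)%:E = (2%:E * T x)%E]].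

(* The state space is the subset [D] of [U].  Almost surely [Pi w] has exactly
   one family of popping times; [T w] is that family, up to a null event. *)
Definition poisson_balloon_process (R : realType) (d : measure_display)
    (W : measurableType d) (P : probability W R) (dU : measure_display)
    (U : measurableType dU) (D : set U) (rho : U -> U -> R)
    (mu : set U -> \bar R) (Pi : W -> set U) (T : W -> U -> \bar R) : Prop :=
  [/\ forall w, Pi w `<=` D,
      poisson_point_process P mu Pi
    & {ae P, forall w, popping_times rho (Pi w) (T w)}].

(* [+oo] when [X] is empty. *)
Definition dist_to_set (R : realType) (U : Type) (rho : U -> U -> R)
    (x : U) (X : set U) : \bar R :=
  ereal_inf [set (rho x y)%:E | y in X].

Definition covered (R : realType) (U : Type) (rho : U -> U -> R)
    (X : set U) (T : U -> \bar R) (t : R) : set U :=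
  [set x | (dist_to_set rho x (active X T t) <= t%:E)%E].

(* Main.v *)
(** Rescale to curvature -1, and let G be the group generated by the
    reflections in the sides of an ideal triangle; its Cayley graph is the
    3-regular tree, and with phi the golden ratio the displacement of a word g
    is at most 2 |g| ln phi + O(1).  Cut the tiles into small cells and record
    for each cell whether it contains zero, one or more points: the labels of
    the tiles are then i.i.d.  "Some balloon centred in K is active at time t",
    for a fixed box K inside the triangle, is, outside an event of small
    probability, a local G-equivariant function of the labels: popping at
    time t is decided along a chain of points with decreasing consecutive
    distances, long chains are unlikely, and without near ties a bounded window
    of labels determines the outcome up to a shift of 1 in time.
    Two points active at time t - 1 are more than 2 (t - 1) apart, so such
    marks exclude each other on a ball of radius about t / (2 ln phi) in the
    tree.  For a function of i.i.d. labels the entropies satisfy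
    (1/2) sum_s h(S u sS) - 2 h(S) >= 0 on balls S of the tree, because this
    quantity can only decrease when a neighbour of a member of S is adjoined to S and is
    known for large balls of labels.  Exclusive marks of density p turn
    this into p <= 4^-n (1 + 2 n) on radius n, so the probability that
    K contains an active centre at time t decays like exp (- c t) up to a linear
    factor, with c = ln 2 / ln phi.  A ball of radius r is covered by
    O(r exp r) copies of K, and Borel-Cantelli gives
    R_t >= (c - o(1)) t; finally c > 1. *)

From HB Require Import structures.
Require Import Defs.
From mathcomp Require Import all_boot all_order all_algebra.
From mathcomp Require Import all_classical all_reals all_analysis.
From mathcomp Require Import measurable_realfun.
From mathcomp Require Import ring lra zify.

Set Implicit Arguments.
Unset Strict Implicit.
Unset Printing Implicit Defensive.

Import Order.TTheory GRing.Theory Num.Theory.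
Import numFieldNormedType.Exports.

Local Open Scope ring_scope.

(** * Relative entropy of finite partitions *)

(** The entropy argument needs marks that are exactly functions of finitely many labels, whereas
    activity depends on the whole configuration and [T] is not assumed measurable. The mark is
    therefore existential: the labels are good and some configuration with these labels has an
    active centre in [kset] at time t. Stability carries this centre, at time t - 1, into any other
    configuration with the same labels, the actual one included, so that marks exclude each other;
    activity itself is only ever shown to be contained in measurable events. The factor 4^-n,
    instead of the 2^-n given by counting, comes from a cancellation. A ball of radius n has 3 * 2^n
    - 2 vertices and the union of two adjacent balls 4 * 2^n - 2. The leading terms of 3/2 times the
    second and 2 times the first agree, so for marks of density q the term - q ln q survives with
    coefficient 1, against a quadratic loss of order (2^n q)^2. The golden ratio is a Fibonacci
    growth: a reflection changes one of three integer vectors into a signed sum of the two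
    others. *)

Section relation_entropy.
Variables (R : realType) (Om : finType) (p : Om -> R).
Hypothesis p_ge0 : forall w, 0 <= p w.
Hypothesis p_sum1 : \sum_w p w = 1.

Definition class_mass (e : rel Om) (w : Om) : R := \sum_(v | e v w) p v.

(** Shannon entropy of the partition into [e]-classes, written pointwise. Encoding a random variable
    by the relation of having equal values makes a joint variable a conjunction, with no type of
    joint values. *)
Definition rel_entropy (e : rel Om) : R := \sum_w p w * - ln (class_mass e w).

Lemma class_mass_ge (e : rel Om) w : e w w -> p w <= class_mass e w.
Proof.
move=> ew; rewrite /class_mass (bigD1 w) //= lerDl.
by apply: sumr_ge0.
Qed.

Lemma eq_rel_entropy (e e' : rel Om) : e =2 e' -> rel_entropy e = rel_entropy e'.
Proof.
move=> ee; apply: eq_bigr => w _; congr (_ * - ln _).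
by apply: eq_bigl => v; rewrite ee.
Qed.

Lemma rel_entropy_mono (e e' : rel Om) : reflexive e ->
  (forall v w, e v w -> e' v w) -> rel_entropy e' <= rel_entropy e.
Proof.
move=> er ee'; apply: ler_sum => w _.
have [->|pw] := eqVneq (p w) 0; first by rewrite !mul0r.
have pw0 : 0 < p w by rewrite lt_neqAle eq_sym pw p_ge0.
rewrite ler_pM2l// lerN2 ler_ln ?posrE//.
- rewrite /class_mass [leRHS](bigID (fun v => e v w)) /=.
  rewrite [X in _ <= X + _](eq_bigl (fun v => e v w)); last first.
    move=> v; case evw: (e v w); last by rewrite andbF.
    by rewrite (ee' _ _ evw).
  by rewrite lerDl; apply: sumr_ge0.
- by apply: lt_le_trans pw0 _; apply: class_mass_ge.
- by apply: lt_le_trans pw0 _; apply: class_mass_ge; apply: ee'.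
Qed.

(** Non-negativity of the conditional mutual information of [e1] and [e2] given [e3]: by ln x <= x -
    1 it suffices that the ratio of class masses has mean at most 1. *)
Lemma rel_entropy_submod (e1 e2 e3 : rel Om) :
  equivalence_rel e1 -> equivalence_rel e2 -> equivalence_rel e3 ->
  rel_entropy (fun v w => [&& e1 v w, e2 v w & e3 v w]) + rel_entropy e3
  <= rel_entropy (fun v w => e1 v w && e3 v w)
     + rel_entropy (fun v w => e2 v w && e3 v w).
Proof.
move=> /equivalence_relP[r1 l1] /equivalence_relP[r2 l2] /equivalence_relP[r3 l3].
have s1 : forall v w, e1 v w = e1 w v.
  by move=> v w; apply/idP/idP => /l1 <-.
have s2 : forall v w, e2 v w = e2 w v.
  by move=> v w; apply/idP/idP => /l2 <-.
have s3 : forall v w, e3 v w = e3 w v.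
  by move=> v w; apply/idP/idP => /l3 <-.
set e123 := fun v w => _; set e13 := fun v w : Om => e1 v w && _.
set e23 := fun v w : Om => e2 v w && _.
pose Q e w := class_mass e w.
have Qge0 e w : 0 <= Q e w by apply: sumr_ge0.
suff key : \sum_w p w * (Q e13 w * Q e23 w / (Q e123 w * Q e3 w)) <= 1.
  rewrite /rel_entropy -!big_split /= -subr_le0 -sumrB.
  apply: (@le_trans _ _ (\sum_w p w * (Q e13 w * Q e23 w / (Q e123 w * Q e3 w) - 1))).
    apply: ler_sum => w _.
    have [->|pw] := eqVneq (p w) 0; first by rewrite !mul0r !addr0 subrr.
    have pw0 : 0 < p w by rewrite lt_neqAle eq_sym pw p_ge0.
    have pos (e : rel Om) : e w w -> 0 < Q e w.
      by move=> ew; apply: lt_le_trans pw0 _; apply: class_mass_ge.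
    have P1 : 0 < Q e123 w by apply: pos; rewrite /e123 r1 r2 r3.
    have P2 : 0 < Q e13 w by apply: pos; rewrite /e13 r1 r3.
    have P3 : 0 < Q e23 w by apply: pos; rewrite /e23 r2 r3.
    have P4 : 0 < Q e3 w by apply: pos; rewrite r3.
    rewrite -!mulrDr -mulrBr ler_pM2l//.
    have := @le_ln1Dx R (Q e13 w * Q e23 w / (Q e123 w * Q e3 w) - 1).
    rewrite (addrC 1) subrK ln_div ?lnM ?posrE ?mulr_gt0// => H.
    have /H : -1 < Q e13 w * Q e23 w / (Q e123 w * Q e3 w) - 1.
      by rewrite ltrBrDr addNr divr_gt0// mulr_gt0.
    apply: le_trans; rewrite /Q; lra.
  under eq_bigr do rewrite mulrBr mulr1.
  by rewrite sumrB p_sum1 subr_le0.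
have -> : \sum_w p w * (Q e13 w * Q e23 w / (Q e123 w * Q e3 w)) =
   \sum_a \sum_b p a * p b *
     \sum_(w | e13 a w && e23 b w) p w / (Q e123 w * Q e3 w).
  transitivity (\sum_w \sum_a \sum_b if e13 a w && e23 b w then
       p a * p b * (p w / (Q e123 w * Q e3 w)) else 0).
    apply: eq_bigr => w _.
    rewrite [in LHS]/Q {1 2}/class_mass big_distrlr /= mulrCA mulr_suml big_mkcond /=.
    apply: eq_bigr => a _; case: ifP => eaw; last by rewrite big1.
    rewrite mulr_suml big_mkcond /=; apply: eq_bigr => b _; case: ifP => // _.
  rewrite exchange_big /=; apply: eq_bigr => a _.
  rewrite exchange_big /=; apply: eq_bigr => b _.
  rewrite -big_mkcond /= mulr_sumr //.
(* For fixed [a] and [b] the points [w] of the inner sum all lie in one class of [e123], and there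
   are none unless [a] and [b] are equivalent under [e3]; the sum is thus at most the inverse mass
   of their [e3]-class. *)
apply: (@le_trans _ _ (\sum_a \sum_b p a * p b * (if e3 b a then (Q e3 a)^-1 else 0))).
  apply: ler_sum => a _; apply: ler_sum => b _.
  apply: ler_wpM2l; first by rewrite mulr_ge0.
  have [w0|] := pickP (fun w => e13 a w && e23 b w); last first.
    by move=> e0; rewrite big_pred0 //; case: ifP => //; rewrite invr_ge0.
  move=> /andP[/andP[h1 h2] /andP[h3 h4]].
  have eba : e3 b a by rewrite (l3 _ _ h4) s3.
  rewrite eba.
  apply: (@le_trans _ _ (\sum_(w | e123 w w0) p w / (Q e123 w0 * Q e3 a))).
    rewrite big_mkcond [leRHS]big_mkcond /=; apply: ler_sum => w _.
    case: ifP => [/andP[/andP[g1 g2] /andP[g3 g4]]|_]; last first.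
      by case: ifP => // _; rewrite divr_ge0// mulr_ge0.
    have E : e123 w w0.
      by rewrite /e123 s1 -(l1 _ _ h1) g1 s2 -(l2 _ _ h3) g3 s3 -(l3 _ _ h2) g2.
    rewrite E; case/and3P: E => f1 f2 f3.
    have -> : Q e3 w = Q e3 a.
      by apply: eq_bigl => v; rewrite s3 (s3 v); rewrite (l3 _ _ g2).
    have -> // : Q e123 w = Q e123 w0.
      apply: eq_bigl => v; rewrite /e123 !(s1 v) !(s2 v) !(s3 v).
      by rewrite (l1 _ _ f1) (l2 _ _ f2) (l3 _ _ f3).
  rewrite -mulr_suml -/(class_mass _ _) -/(Q _ _).
  have [->|nz] := eqVneq (Q e123 w0) 0; first by rewrite mul0r invr_ge0.
  by rewrite invfM mulrA mulfV// mul1r.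
rewrite -p_sum1; apply: ler_sum => a _.
have -> : \sum_b p a * p b * (if e3 b a then (Q e3 a)^-1 else 0)
   = p a * (Q e3 a / Q e3 a).
  rewrite [in RHS]/Q {1}/class_mass mulr_suml mulr_sumr [RHS]big_mkcond /=.
  apply: eq_bigr => b _; case: ifP => _; first by rewrite mulrA.
  by rewrite mulr0.
have [->|nz] := eqVneq (Q e3 a) 0; first by rewrite mul0r mulr0.
by rewrite mulfV// mulr1.
Qed.

End relation_entropy.

(** * Words in the three generators *)

Notation word := (seq 'I_3).

Fixpoint reduced (g : word) : bool :=
  if g is s :: g' then (ohead g' != Some s) && reduced g' else true.

(** Left multiplication by a generator in the free product of three groups of order two, with
    reduced words as normal forms. *)
Definition lmul1 (s : 'I_3) (g : word) : word :=
  if g is s' :: g' then if s' == s then g' else s :: g else [:: s].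

Definition lmul (g h : word) : word := foldr lmul1 h g.

Lemma reduced_lmul1 s g : reduced g -> reduced (lmul1 s g).
Proof.
case: g => [|s' g] //= /andP[h1 h2]; case: eqVneq => //= ne.
by rewrite h1 h2 !andbT; apply/eqP => -[E]; rewrite E eqxx in ne.
Qed.

Lemma lmul1K s g : reduced g -> lmul1 s (lmul1 s g) = g.
Proof.
case: g => [|s' g] /=; first by rewrite eqxx.
case/andP => h1 h2; case: eqVneq => [E|ne] /=; last by rewrite eqxx.
subst s'; case: g h1 {h2} => [|t g] //= h1; case: eqVneq => // E.
by rewrite E eqxx in h1.
Qed.

Lemma size_lmul1 s g : (size (lmul1 s g) <= (size g).+1)%N.
Proof. by case: g => [|s' g] //=; case: ifP => //= _; lia. Qed.

Lemma reduced_lmul g h : reduced h -> reduced (lmul g h).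
Proof. by elim: g => //= s g IH rh; apply: reduced_lmul1; apply: IH. Qed.

Lemma size_lmul g h : (size (lmul g h) <= size g + size h)%N.
Proof.
elim: g => //= s g IH; apply: leq_trans (size_lmul1 _ _) _.
by rewrite addSn ltnS.
Qed.

Lemma lmul_lmul1 s g h : reduced h -> lmul (lmul1 s g) h = lmul1 s (lmul g h).
Proof.
move=> rh; case: g => [|s' g] //=; case: eqVneq => [->|//].
by rewrite lmul1K// reduced_lmul.
Qed.

(** The option is a forbidden first letter: [wball n (Some s)] is the part of the ball that lies on
    the identity's side of the edge to [s]. *)
Fixpoint wball (n : nat) (o : option 'I_3) : seq word :=
  [::] :: (if n is n'.+1 then
    flatten [seq [seq s :: g | g <- wball n' (Some s)]
            | s <- [seq s <- enum 'I_3 | Some s != o]] else [::]).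

Lemma mem_wball n o g :
  (g \in wball n o) = [&& reduced g, (size g <= n)%N & (g == [::]) || (ohead g != o)].
Proof.
elim: n o g => [|n IH] o g /=.
  by rewrite inE; case: g => [|s g] //=; rewrite andbF.
rewrite inE; case: g => [|s g] //=.
rewrite ltnS; apply/flattenP/idP => [[x /mapP[t]]|].
  rewrite mem_filter => /andP[to _] -> /mapP[g' +] [-> ->].
  rewrite IH => /and3P[h1 h2 h3]; rewrite h1 h2 to !andbT.
  by case/orP: h3 => [/eqP->|].
move=> /and3P[/andP[h1 h2] h3 h4].
exists [seq s :: g' | g' <- wball n (Some s)].
  by apply: map_f; rewrite mem_filter h4 mem_enum.
by apply: map_f; rewrite IH h2 h3 h1 orbT.
Qed.

Lemma wball_uniq n o : uniq (wball n o).
Proof.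
elim: n o => //= n IH o; apply/andP; split.
  by apply/negP => /flattenP[x /mapP[t _ ->]] /mapP[].
have : uniq [seq s <- enum 'I_3 | Some s != o] by rewrite filter_uniq ?enum_uniq.
elim: [seq s <- enum 'I_3 | Some s != o] => //= t l IHl /andP[tl ul].
rewrite cat_uniq map_inj_uniq ?IH ?IHl//= ?andbT; last by move=> ? ? [].
apply/hasPn => x /flattenP[y /mapP[s sl ->]] /mapP[g _ ->].
by apply/negP => /mapP[g' _ [st _]]; rewrite -st sl in tl.
Qed.

Lemma sumn_map_const (T : Type) (c : nat) (l : seq T) :
  sumn [seq c | _ <- l] = (size l * c)%N.
Proof. by elim: l => //= _ l ->; rewrite mulSn. Qed.

Lemma size_wball_Some n s : (size (wball n (Some s))).+1 = (2 ^ n.+1)%N.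
Proof.
elim: n s => //= n IH s; rewrite size_flatten /shape -map_comp.
rewrite (@eq_map _ _ _ (fun=> (2 ^ n.+1).-1)); last first.
  by move=> t /=; rewrite size_map -(IH t).
rewrite sumn_map_const.
have -> : size [seq s0 <- enum 'I_3 | Some s0 != Some s] = 2.
  rewrite size_filter (eq_count (a2 := predC (pred1 s))) //.
  have := count_predC (pred1 s) (enum 'I_3).
  rewrite count_uniq_mem ?enum_uniq// mem_enum size_enum_ord /=; lia.
have : (0 < 2 ^ n.+1)%N by rewrite expn_gt0.
rewrite (expnS 2 n.+1); lia.
Qed.

Lemma size_wball_None n : (size (wball n.+1 None)).+2 = (3 * 2 ^ n.+1)%N.
Proof.
rewrite /= size_flatten /shape -map_comp.
rewrite (@eq_map _ _ _ (fun=> (2 ^ n.+1).-1)); last first.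
  by move=> t /=; rewrite size_map -(size_wball_Some n t).
rewrite sumn_map_const filter_predT size_enum_ord.
have : (0 < 2 ^ n.+1)%N by rewrite expn_gt0.
lia.
Qed.

Notation ball3 n := (wball n None).

(** The union of the balls about the two ends of an edge. It is split along the edge to be listed
    without repetition: each half has radius [n] about its own end. *)
Definition edge_ball n (s : 'I_3) : seq word :=
  wball n (Some s) ++ [seq s :: g | g <- wball n (Some s)].

Lemma mem_ball3 n g : (g \in ball3 n) = reduced g && (size g <= n)%N.
Proof. by rewrite mem_wball; case: g => [|s g] /=; rewrite ?andbT. Qed.

Lemma mem_edge_ball n s :
  ball3 n ++ [seq lmul1 s g | g <- ball3 n] =i edge_ball n s.
Proof.
move=> g; rewrite !mem_cat mem_ball3 mem_wball.
apply/idP/idP.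
  case/orP => [/andP[rg sg]|/mapP[h + ->]].
    rewrite rg sg /=; have [->//|_] := eqVneq g [::] => /=.
    case: eqVneq => //=; case: g rg sg => //= t g /andP[tg rg] sg [E].
    by subst t; apply: map_f; rewrite mem_wball rg (ltnW sg) tg orbT.
  rewrite mem_ball3 => /andP[rh sh].
  case: h rh sh => [|t h] /= rh sh.
    by apply/orP; right; apply: map_f; rewrite mem_wball.
  case: eqVneq => [ts|ts].
    by subst t; move/andP: rh => [th rh]; rewrite rh (ltnW sh) th orbT.
  apply/orP; right; apply: map_f; rewrite mem_wball /= rh sh /=.
  by apply/eqP => -[E]; rewrite E eqxx in ts.
case/orP => [/and3P[-> -> _]//|/mapP[h + ->]].
rewrite mem_wball => /and3P[rh sh hh]; apply/orP; right.
apply/mapP; exists h; first by rewrite mem_ball3 rh.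
case: h hh {rh sh} => //= t h /eqP; case: eqVneq => // -> //.
Qed.

Lemma edge_ball_uniq n s : uniq (edge_ball n s).
Proof.
rewrite cat_uniq wball_uniq map_inj_uniq ?wball_uniq ?andbT /=; last by move=> ? ? [].
apply/hasPn => x /mapP[g _ ->]; rewrite mem_wball /= eqxx !andbF //.
Qed.

Lemma size_edge_ball n s : (size (edge_ball n s)).+2 = (2 ^ n.+2)%N.
Proof.
rewrite size_cat size_map -addSn -addnS size_wball_Some addnn -muln2 (expnS _ n.+1).
by rewrite mulnC.
Qed.

(** * The edge-vertex functional of a submodular function *)

Section splitting.
Variables (R : realType) (V : eqType) (h : seq V -> R) (act : 'I_3 -> V -> V).
Hypothesis h_sub : forall A B, {subset A <= B} -> h A <= h B.
Hypothesis h_submod : forall A B C,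
  h (A ++ B ++ C) + h C <= h (A ++ C) + h (B ++ C).

Lemma eq_h A B : A =i B -> h A = h B.
Proof.
by move=> AB; apply/eqP; rewrite eq_le !h_sub// => x; rewrite AB.
Qed.

Lemma h_submod_cons x A B : {subset A <= B} ->
  h (x :: B) - h B <= h (x :: A) - h A.
Proof.
move=> AB; have := h_submod [:: x] B A.
have -> : h ([:: x] ++ B ++ A) = h (x :: B).
  apply: eq_h => y; rewrite !(inE, mem_cat) /=.
  by case: (y == x) => //=; case: (boolP (y \in A)) => [/AB->|]; rewrite ?orbF.
have -> : h (B ++ A) = h B.
  apply: eq_h => y; rewrite mem_cat.
  by case: (boolP (y \in A)) => [/AB->|]; rewrite ?orbF.
rewrite /=; lra.
Qed.

(* The factors 1/2 and 2 are those of the edge-vertex entropy inequality of the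
   3-regular tree, which has 3/2 edges per vertex. *)
Definition edge_vertex (S : seq V) : R :=
  2^-1 * \sum_(s < 3) h (S ++ map (act s) S) - 2 * h S.

(** With x = [act s v], the [s]-term does not change, since x already lies in the image of [S] and
    its own image is [v]. Each of the two other terms gains x and an image of x, hence at most 2 D,
    where D is the gain of [h] on [S]; half of 4 D is exactly what - 2 [h] takes away. *)
Lemma edge_vertex_split (S : seq V) (s : 'I_3) (v : V) :
  v \in S -> act s (act s v) = v ->
  (forall s', h (map (act s') (act s v :: S)) = h (act s v :: S)) ->
  (forall s', h (map (act s') S) = h S) ->
  edge_vertex (act s v :: S) <= edge_vertex S.
Proof.
move=> vS ssv inv' inv; set x := act s v.
rewrite /edge_vertex (bigD1 s) //= [X in _ <= 2^-1 * X - _](bigD1 s) //=.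
have -> : h (x :: S ++ act s x :: map (act s) S) = h (S ++ map (act s) S).
  apply: eq_h => y; rewrite !(inE, mem_cat).
  have xm : x \in map (act s) S by apply: map_f.
  by case: eqVneq => [->|_] /=; [rewrite xm orbT|case: eqVneq => [->|]//=; rewrite /x ssv vS].
pose D := h (x :: S) - h S.
have D0 : 0 <= D by rewrite subr_ge0; apply: h_sub => y yS; rewrite inE yS orbT.
suff key : \sum_(i < 3 | i != s) h (x :: S ++ act i x :: map (act i) S)
    <= \sum_(i < 3 | i != s) (h (S ++ map (act i) S) + 2 * D).
  have E : \sum_(i < 3 | i != s) (2 * D) = 4 * D.
    rewrite sumr_const -cardsE cardsCs.
    have -> : ~: [set i | i != s] = [set s].
      by apply/setP => y; rewrite !inE negbK.
    by rewrite cards1 card_ord (_ : (3 - 1)%N = 2%N)// mulr2n; lra.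
  move: key; rewrite big_split /= E /D; lra.
apply: ler_sum => i _.
set A := S ++ map (act i) S.
have h1 : h (x :: A) - h A <= D.
  by apply: h_submod_cons => y; rewrite mem_cat => ->.
have h2 : h (act i x :: x :: A) - h (x :: A) <= D.
  apply: (@le_trans _ _ (h (act i x :: map (act i) S) - h (map (act i) S))).
    by apply: h_submod_cons => y yS; rewrite inE mem_cat yS !orbT.
  by rewrite -map_cons inv' inv.
have -> : h (x :: S ++ act i x :: map (act i) S) = h (act i x :: x :: A).
  apply: eq_h => y; rewrite !(inE, mem_cat).
  by do !case: (_ == _) => //=; do ?case: (_ \in _) => //=.
lra.
Qed.

Hypothesis h_nil : h [::] = 0.

(** For an arbitrary new element all three terms may grow by 2 D, so that 3 D is gained and 2 D
    lost; the excess D is at most [h] of the element alone. *)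
Lemma edge_vertex_cons (S : seq V) (x : V) :
  (forall s, h (map (act s) (x :: S)) = h (x :: S)) ->
  (forall s, h (map (act s) S) = h S) ->
  edge_vertex (x :: S) <= edge_vertex S + h [:: x].
Proof.
move=> inv' inv; pose D := h (x :: S) - h S.
have D1 : D <= h [:: x].
  by have := @h_submod_cons x [::] S; rewrite h_nil subr0; apply.
suff key : \sum_(i < 3) h ((x :: S) ++ map (act i) (x :: S))
    <= \sum_(i < 3) (h (S ++ map (act i) S) + 2 * D).
  rewrite /edge_vertex; move: key D1; rewrite big_split /= sumr_const card_ord.
  rewrite -[_ *+ 3]mulr_natr /D; lra.
apply: ler_sum => i _.
set A := S ++ map (act i) S.
have h1 : h (x :: A) - h A <= D.
  by apply: h_submod_cons => y; rewrite mem_cat => ->.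
have h2 : h (act i x :: x :: A) - h (x :: A) <= D.
  apply: (@le_trans _ _ (h (act i x :: map (act i) S) - h (map (act i) S))).
    by apply: h_submod_cons => y yS; rewrite inE mem_cat yS !orbT.
  by rewrite -map_cons inv' inv.
have -> : h ((x :: S) ++ map (act i) (x :: S)) = h (act i x :: x :: A).
  apply: eq_h => y; rewrite /= !(inE, mem_cat).
  by do !case: (_ == _) => //=; do ?case: (_ \in _) => //=.
lra.
Qed.

End splitting.

(** * Numerical packing bound *)

Section log_bounds.
Variable R : realType.
Implicit Types x : R.

Lemma le0_of_derive (f g : R -> R) (b : R) :
  (forall x, x \in `]-1, 1[ -> is_derive x 1 f (g x)) -> 0 <= b < 1 ->
  (forall x, 0 < x < b -> 0 <= g x) -> f 0 <= f b.
Proof.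
move=> df /andP[b0 b1] g0.
have sub x : 0 <= x <= b -> x \in `]-1, 1[.
  by rewrite in_itv /= => /andP[? ?]; apply/andP; split; lra.
apply: (@ger0_derive1_ndecr R f 0 b) => //.
- move=> x; rewrite in_itv /= => /andP[? ?].
  have h : x \in `]-1, 1[ by apply: sub; lra.
  by have := df _ h; case.
- move=> x; rewrite in_itv /= => /andP[? ?].
  have h : x \in `]-1, 1[ by apply: sub; lra.
  have := df _ h => -[_]; rewrite derive1E => ->; apply: g0; lra.
- apply: derivable_within_continuous => x; rewrite in_itv /= => xb.
  by have := df _ (sub _ xb); case.
Qed.

Lemma is_derive_ln1B (y : R) : y < 1 ->
  is_derive y 1 (fun z : R => ln (1 - z)) (- (1 - y)^-1).
Proof.
move=> y1; have py : 0 < 1 - y by lra.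
have := @is_derive1_comp R (@ln R) (fun z => 1 - z) y (1 - y)^-1 (-1) (is_derive1_ln py).
rewrite mulrN1; apply; apply: is_derive_eq; by rewrite add0r mul1r.
Qed.

Lemma neg_entropy_le x : 0 <= x < 1 -> - (1 - x) * ln (1 - x) <= x - x ^+ 2 / 2.
Proof.
move=> xb.
pose f y : R := y - y ^+ 2 / 2 + (1 - y) * ln (1 - y).
suff : f 0 <= f x by rewrite /f subr0 ln1; lra.
have := @le0_of_derive f (fun y => - y - ln (1 - y)) x; apply; [|exact: xb|] => y.
  rewrite in_itv /= => /andP[y1 y2].
  have d2 := is_derive_ln1B y2.
  apply: is_derive_eq.
  rewrite /GRing.scale /=; field; lra.
move=> /andP[y0 yx].
have := @le_ln1Dx R (- y); lra.
Qed.

Lemma neg_entropy_ge x : 0 <= x <= 3^-1 ->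
  x - x ^+ 2 / 2 - x ^+ 3 / 2 <= - (1 - x) * ln (1 - x).
Proof.
move=> xb.
pose f y : R := y ^+ 2 / 2 + y ^+ 3 / 2 - y - (1 - y) * ln (1 - y).
suff : f 0 <= f x by rewrite /f !subr0 ln1; lra.
have := @le0_of_derive f (fun y => y + 3 / 2 * y ^+ 2 + ln (1 - y)) x; apply; last 2 first.
- lra.
- move=> y /andP[y0 yx].
  have py : 0 < 1 - y by lra.
  have : ln (1 - y)^-1 <= y + 3 / 2 * y ^+ 2.
    have -> : (1 - y)^-1 = 1 + y / (1 - y) by field; lra.
    apply: le_trans (le_ln1Dx _) _.
      by apply: (@lt_le_trans _ _ 0); [lra|rewrite divr_ge0//; lra].
    rewrite ler_pdivrMr//; nra.
  rewrite lnV ?posrE//; lra.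
- move=> y; rewrite in_itv /= => /andP[y1 y2].
  have d2 := is_derive_ln1B y2.
  apply: is_derive_eq.
  rewrite /GRing.scale /=; field; lra.
Qed.

(** [V] and [E] are the sizes of a ball and of an edge ball of radius [k.+1]. As 3/2 E - 2 V = 1,
    the terms linear in r = 2^(k+1) q cancel and the quadratic ones leave - 3 r^2. The a priori
    bound on r keeps the remaining errors below 2 r^2, whence r^2 <= q (1 - ln q). *)
Lemma packing_numeric (k : nat) (q V E : R) :
  V = 3 * 2 ^+ k.+1 - 2 -> E = 4 * 2 ^+ k.+1 - 2 ->
  0 <= q -> 2 ^+ k.+1 * q <= 20^-1 ->
  2 * (V * (q * - ln q) - (1 - V * q) * ln (1 - V * q)) <=
  3 / 2 * (E * (q * - ln q) - (1 - E * q) * ln (1 - E * q)) ->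
  q <= (4 ^+ k.+1)^-1 * (1 + 2 * k.+1%:R).
Proof.
move DE : (2 ^+ k.+1) => D VE EE q0 Dq H.
have D2 : 2 <= D by rewrite -DE exprS ler_peMr// exprn_ege1// ler1n.
have E4 : 4 = 2 ^+ 2 :> R by ring.
have -> : 4 ^+ k.+1 = D ^+ 2 :> R by rewrite E4 -DE -!exprM mulnC.
have rhs0 : 0 < (D ^+ 2)^-1 :> R by rewrite invr_gt0 exprn_gt0//; lra.
have [->|qn0] := eqVneq q 0.
  by rewrite mulr_ge0// ?ltW// addr_ge0// mulr_ge0.
have {q0} q0 : 0 < q by rewrite lt_neqAle eq_sym qn0.
move rE : (D * q) Dq => r Dq.
have qr : q <= r / 2 by nra.
have Er : E * q = 4 * r - 2 * q by rewrite EE -rE; ring.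
have Vr : V * q = 3 * r - 2 * q by rewrite VE -rE; ring.
have r0 : 0 < r by lra.
have h1 : - (1 - E * q) * ln (1 - E * q) <= E * q - (E * q) ^+ 2 / 2.
  by apply: neg_entropy_le; rewrite Er; lra.
have h2 : V * q - (V * q) ^+ 2 / 2 - (V * q) ^+ 3 / 2 <= - (1 - V * q) * ln (1 - V * q).
  by apply: neg_entropy_ge; rewrite Vr; lra.
have key : r ^+ 2 <= q * (1 - ln q).
  have : 2 * (V * q) * - ln q + 2 * (V * q - (V * q) ^+ 2 / 2 - (V * q) ^+ 3 / 2) <=
     3 / 2 * (E * q) * - ln q + 3 / 2 * (E * q - (E * q) ^+ 2 / 2) by lra.
  rewrite Er Vr.
  have : (3 * r - 2 * q) ^+ 3 <= 27 * r ^+ 3.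
    have -> : 27 * r ^+ 3 = (3 * r) ^+ 3 by ring.
    by rewrite lerXn2r// ?nnegrE; lra.
  have : r ^+ 3 <= r ^+ 2 / 20 by rewrite exprSr ler_wpM2l ?exprn_ge0// ltW.
  have : q ^+ 2 <= r ^+ 2 / 4.
    have -> : r ^+ 2 / 4 = (r / 2) ^+ 2 by field.
    by rewrite lerXn2r// ?nnegrE; lra.
  have := sqr_ge0 r; lra.
have {key} key : q <= (D ^+ 2)^-1 * (1 - ln q).
  rewrite mulrC ler_pdivlMr; last by rewrite -invr_gt0.
  rewrite -(ler_pM2l q0).
  by have -> : q * (q * D ^+ 2) = r ^+ 2 by rewrite -rE; ring.
(* Either q is already below D^-2, or - ln q is at most 2 ln D, hence at most 2 (k + 1) because ln 2
   <= 1. *)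
have [ql|ql] := leP q (D ^+ 2)^-1.
  apply: le_trans ql _; apply: ler_peMr; first exact: ltW.
  by rewrite lerDl mulr_ge0.
apply: le_trans key _; rewrite ler_pM2l// lerD2l.
have : ln (D ^+ 2)^-1 <= ln q by rewrite ler_ln ?posrE// ltW.
have D0 : 0 < D by lra.
rewrite lnV ?posrE ?exprn_gt0// lnXn// -DE lnXn//.
have : ln 2 <= 1 :> R by have := @le_ln1Dx R 1; rewrite (_ : 1 + 1 = 2) //; apply; lra.
rewrite -[ln 2 *+ _]mulr_natr -[_ *+ 2]mulr_natr => l2 H2.
have : 0 <= k.+1%:R :> R by [].
nra.
Qed.
End log_bounds.

(** * Exclusive marks of a factor of i.i.d. labels on the 3-regular tree *)

Section product_mass.
Variables (R : realType) (Al : finType) (pi : Al -> R) (W : finType).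
Hypothesis pi_ge0 : forall a, 0 <= pi a.
Hypothesis pi_sum1 : \sum_a pi a = 1.

Definition product_mass (x : {ffun W -> Al}) : R := \prod_g pi (x g).

Lemma product_mass_ge0 x : 0 <= product_mass x.
Proof. by apply: prodr_ge0. Qed.

Lemma product_mass_cylinder (L : {set W}) (y : W -> Al) :
  \sum_(x : {ffun W -> Al} | [forall g in L, x g == y g]) product_mass x
  = \prod_(g in L) pi (y g).
Proof.
transitivity (\sum_(x : {ffun W -> Al})
   \prod_g (if (g \in L) ==> (x g == y g) then pi (x g) else 0)).
  rewrite big_mkcond; apply: eq_bigr => x _; case: ifP => [/forallP h|/negbT].
    by apply: eq_bigr => g _; rewrite h.
  rewrite negb_forall => /existsP[g /negbTE h].
  by rewrite (bigD1 g) //= h mul0r.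
rewrite -(bigA_distr_bigA (fun g a => if (g \in L) ==> (a == y g) then pi a else 0)).
rewrite [RHS]big_mkcond; apply: eq_bigr => g _; case: ifP => /= gL.
  by rewrite -big_mkcond /= big_pred1_eq.
by rewrite pi_sum1.
Qed.

Lemma product_mass_sum1 : \sum_(x : {ffun W -> Al}) product_mass x = 1.
Proof.
rewrite -(bigA_distr_bigA (fun (_ : W) a => pi a)).
by apply: big1 => g _; exact: pi_sum1.
Qed.

End product_mass.

Section factor_of_iid.
Variables (R : realType) (Al : finType) (pi : Al -> R) (a0 : Al) (N M : nat).
Hypothesis pi_ge0 : forall a, 0 <= pi a.
Hypothesis pi_sum1 : \sum_a pi a = 1.
Variable A : (word -> Al) -> bool.
Hypothesis A_local : forall x y : word -> Al,
  (forall g, reduced g -> (size g <= M)%N -> x g = y g) -> A x = A y.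

Local Notation W := (seq_sub (ball3 N)).
Local Notation Om := {ffun W -> Al}.
Local Notation mass := (@product_mass R Al pi W).

Definition ext (x : Om) (g : word) : Al := if insub g is Some g' then x g' else a0.

(** The boolean distinguishes the label at a word ([true]) from the mark at that word ([false]), so
    that one entropy function on lists treats labels and marks jointly. *)
Definition label := (word * bool)%type.

Definition value (x : Om) (v : label) : Al + bool :=
  if v.2 then inl (ext x v.1) else inr (A (fun h => ext x (lmul v.1 h))).

Definition agree (S : seq label) : rel Om :=
  fun x y => all (fun v => value x v == value y v) S.

Definition entropy (S : seq label) : R := rel_entropy mass (agree S).

Definition act (s : 'I_3) (v : label) : label := (lmul1 s v.1, v.2).

Let mass_ge0 := product_mass_ge0 (W := W) pi_ge0.
Let mass_sum1 := product_mass_sum1 W pi_sum1.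

Lemma agree_equiv S : equivalence_rel (agree S).
Proof.
apply/equivalence_relP; split => [x|x y /allP xy z].
  by apply/allP.
apply/allP/allP => h v vS; first by rewrite -(eqP (xy _ vS)) h.
by rewrite (eqP (xy _ vS)) h.
Qed.

Lemma entropy_sub S S' : {subset S <= S'} -> entropy S <= entropy S'.
Proof.
move=> SS'; apply: (rel_entropy_mono mass_ge0); first by move=> x; apply/allP.
by move=> x y /allP h; apply/allP => v /SS'; apply: h.
Qed.

Lemma entropy_submod S1 S2 S3 :
  entropy (S1 ++ S2 ++ S3) + entropy S3 <= entropy (S1 ++ S3) + entropy (S2 ++ S3).
Proof.
have := rel_entropy_submod mass_ge0 mass_sum1
  (agree_equiv S1) (agree_equiv S2) (agree_equiv S3).
rewrite /entropy; congr (_ + _ <= _ + _); apply: eq_rel_entropy => x y;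
  by rewrite /agree !all_cat.
Qed.

Lemma entropy_nil : entropy [::] = 0.
Proof.
rewrite /entropy /rel_entropy big1 // => x _.
rewrite /class_mass /= (eq_bigl xpredT)//.
by rewrite mass_sum1 ln1 oppr0 mulr0.
Qed.

Lemma ext_mem (x : Om) (g : word) (gN : g \in ball3 N) : ext x g = x (SeqSub gN).
Proof. by rewrite /ext insubT. Qed.

(** The strict inequality leaves room for one more generator: the variable and its images under
    [act] are all read inside the ball of radius [N]. *)
Definition in_window (v : label) : bool :=
  reduced v.1 && (size v.1 + (if v.2 then 0 else M) < N)%N.

(** Words pushed out of the ball are kept fixed, which makes translation by a generator an
    involution of the finite window. It preserves the product mass and agrees with the true
    translation away from the boundary, which is what the invariance of entropies requires. *)
Definition shift_word (s : 'I_3) (g : W) : W := insubd g (lmul1 s (val g)).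

Lemma shift_wordK s : involutive (shift_word s).
Proof.
move=> g; apply: val_inj; rewrite /shift_word !val_insubd.
have := valP g; rewrite !mem_ball3 => /andP[rg sg].
have [sg'|sg'] := boolP (reduced (lmul1 s (val g)) && (size (lmul1 s (val g)) <= N)%N).
  by rewrite lmul1K// rg sg.
by rewrite (negbTE sg').
Qed.

Definition shift (s : 'I_3) (x : Om) : Om := [ffun g => x (shift_word s g)].

Lemma shiftK s : involutive (shift s).
Proof. by move=> x; apply/ffunP => g; rewrite !ffunE shift_wordK. Qed.

Lemma mass_shift s x : mass (shift s x) = mass x.
Proof.
rewrite /product_mass [RHS](reindex_inj (inv_inj (shift_wordK s))) /=.
by apply: eq_bigr => g _; rewrite ffunE.
Qed.

Lemma ext_shift s x g : reduced g -> (size g < N)%N ->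
  ext (shift s x) g = ext x (lmul1 s g).
Proof.
move=> rg sg.
have gN : g \in ball3 N by rewrite mem_ball3 rg ltnW.
have gN' : lmul1 s g \in ball3 N.
  by rewrite mem_ball3 reduced_lmul1// (leq_trans (size_lmul1 _ _)).
rewrite (ext_mem _ gN) (ext_mem _ gN') ffunE; congr (x _).
by apply: val_inj; rewrite /shift_word val_insubd /= gN'.
Qed.

Lemma value_shift s x v : in_window v -> value (shift s x) v = value x (act s v).
Proof.
case: v => g [] /andP[/= rg sg]; rewrite /value /=.
  by rewrite ext_shift// -(addn0 (size g)).
congr inr; apply: A_local => h rh sh.
rewrite ext_shift ?reduced_lmul// ?lmul_lmul1//.
apply: leq_ltn_trans (size_lmul _ _) _; lia.
Qed.

Lemma entropy_act s S : {in S, forall v, in_window v} ->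
  entropy (map (act s) S) = entropy S.
Proof.
move=> Sw.
rewrite /entropy /rel_entropy (reindex_inj (inv_inj (shiftK s))) /=.
apply: eq_bigr => x _; rewrite mass_shift; congr (_ * - ln _).
rewrite /class_mass (reindex_inj (inv_inj (shiftK s))) /=.
apply: eq_big => [y|y _]; last by rewrite mass_shift.
rewrite /agree all_map; apply: eq_in_all => v vS /=.
by rewrite -!value_shift ?Sw// !shiftK.
Qed.

Lemma entropy_eq S S' : S =i S' -> entropy S = entropy S'.
Proof. exact: eq_h entropy_sub _ _. Qed.

Definition label_entropy : R := \sum_a pi a * - ln (pi a).

Lemma pi_ext_mass g : g \in ball3 N -> forall a,
  \sum_(x : Om | ext x g == a) mass x = pi a.
Proof.
move=> gN a; rewrite (eq_bigl (fun x : Om => [forall g' in [set SeqSub gN], x g' == a])).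
  by rewrite (product_mass_cylinder pi_sum1 _ (fun=> a)) big_set1.
move=> x; rewrite (ext_mem _ gN); apply/eqP/forall_inP => [h g' /set1P ->|h].
  by rewrite h.
by apply/eqP/h; rewrite inE.
Qed.

Lemma entropy_labels (L : seq word) : uniq L -> {subset L <= ball3 N} ->
  entropy [seq (g, true) | g <- L] = (size L)%:R * label_entropy.
Proof.
move=> uL LN.
pose L' : seq W := pmap insub L.
have mL' (g : W) : (g \in L') = (val g \in L) by rewrite mem_pmap_sub.
have valL' : map val L' = L.
  rewrite /L'; elim: L LN {uL L' mL'} => //= g L IH LN.
  have gN : g \in ball3 N by apply: LN; rewrite inE eqxx.
  rewrite insubT /= IH // => h hL; apply: LN; rewrite inE hL orbT //.
have uL' : uniq L' by rewrite -(map_inj_uniq val_inj) valL'.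
have Ecls (x : Om) : class_mass mass (agree [seq (g, true) | g <- L]) x
    = \prod_(g <- L') pi (x g).
  rewrite /class_mass (eq_bigl (fun y : Om => [forall g in [set g | g \in L'], y g == x g])).
    rewrite (product_mass_cylinder pi_sum1) (eq_bigl (fun g => g \in L')).
      by rewrite -big_uniq.
    by move=> g; rewrite inE.
  move=> y; rewrite /agree all_map; apply/allP/forall_inP => [h g|h g gL].
    rewrite inE mL' => /h /=; rewrite /value /= !(ext_mem _ (valP g)).
    have -> : SeqSub (valP g) = g by apply: val_inj.
    by move=> /eqP[->].
  have gN := LN _ gL.
  have := h (SeqSub gN); rewrite inE mL' => /(_ gL) /eqP E /=.
  by rewrite /value /= !(ext_mem _ gN) E.
rewrite /entropy /rel_entropy.
transitivity (\sum_(x : Om) \sum_(g <- L') mass x * - ln (pi (x g))).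
  apply: eq_bigr => x _; rewrite Ecls.
  have [->|mx] := eqVneq (mass x) 0; first by rewrite mul0r big1// => g _; rewrite mul0r.
  have pos g : 0 < pi (x g).
    rewrite lt_neqAle pi_ge0 andbT eq_sym; apply: contraNneq mx => pg.
    by rewrite /product_mass (bigD1 g) //= pg mul0r.
  rewrite -mulr_sumr sumrN; congr (_ * - _).
  elim: L' {mL' valL' uL' Ecls} => [|g l IH]; first by rewrite !big_nil ln1.
  rewrite !big_cons lnM ?IH// posrE//.
  by elim/big_ind: _ => // y z; apply: mulr_gt0.
rewrite exchange_big /= -valL' size_map mulr_natl.
rewrite (eq_bigr (fun=> label_entropy)).
  by rewrite big_const_seq count_predT iter_addr_0.
move=> g _; rewrite /label_entropy.
rewrite (partition_big (fun x : Om => x g) xpredT) //=.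
apply: eq_bigr => a _; rewrite -(pi_ext_mass (valP g) a) big_distrl /=.
rewrite (pi_ext_mass (valP g)).
apply: eq_big => [x|x /eqP ->//].
rewrite (ext_mem _ (valP g)).
by have -> : SeqSub (valP g) = g by apply: val_inj.
Qed.

Definition labels (L : seq word) : seq label := [seq (g, true) | g <- L].
Definition marks (L : seq word) : seq label := [seq (g, false) | g <- L].

Local Notation ev := (edge_vertex entropy act).

Lemma eq_edge_vertex S S' : S =i S' -> ev S = ev S'.
Proof.
move=> SS; rewrite /edge_vertex (entropy_eq SS); congr (_ * _ - _).
apply: eq_bigr => s _; apply: entropy_eq => v; rewrite !mem_cat SS.
by congr (_ || _); apply: eq_mem_map.
Qed.

Lemma entropy_determined S S' :
  (forall x y, agree S x y -> agree S' x y) -> entropy S' <= entropy S.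
Proof.
by move=> h; apply: (rel_entropy_mono mass_ge0) => // x; apply/allP.
Qed.

Lemma value_determined L x y g : (forall h, reduced h -> (size h <= M)%N -> lmul g h \in L) ->
  agree (labels L) x y -> value x (g, false) == value y (g, false).
Proof.
move=> hL /allP xy; apply/eqP; congr inr; apply: A_local => h rh sh /=.
have /xy /eqP [] : (lmul g h, true) \in labels L by apply: map_f; apply: hL.
done.
Qed.

Lemma size_ball3 n : (size (ball3 n.+1))%:R = 3 * 2 ^+ n.+1 - 2 :> R.
Proof.
have /(congr1 (fun m => m%:R : R)) := size_wball_None n.
by rewrite natrM natrX -addn2 natrD => <-; rewrite addrK.
Qed.

Lemma size_edge_ball_R n s : (size (edge_ball n s))%:R = 4 * 2 ^+ n - 2 :> R.
Proof.
have /(congr1 (fun m => m%:R : R)) := size_edge_ball n s.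
have -> : (2 ^ n.+2)%:R = 4 * 2 ^+ n :> R by rewrite natrX !exprS; ring.
by rewrite -addn2 natrD => <-; rewrite addrK.
Qed.

Section root_ball.
Variable k : nat.
Hypothesis kMN : (k.+1 + M < N)%N.

Let S m := labels (ball3 m) ++ marks (ball3 k.+1).

Let S_window m L : (m <= k.+1 + M)%N -> {subset L <= ball3 m} ->
  {in labels L ++ marks (ball3 k.+1), forall v, in_window v}.
Proof.
move=> mk LB v; rewrite mem_cat => /orP[] /mapP[g gL ->]; rewrite /in_window /=.
  have := LB _ gL; rewrite mem_ball3 => /andP[-> /=]; lia.
by move: gL; rewrite mem_ball3 => /andP[-> /=]; lia.
Qed.

Let subset_ball m m' : (m <= m')%N -> {subset ball3 m <= ball3 m'}.
Proof. by move=> mm g; rewrite !mem_ball3 => /andP[-> /=]; lia. Qed.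

(** The words of length m + 1 are adjoined one at a time; each is a neighbour of a word of length m
    whose label is already present, so [edge_vertex_split] applies. *)
Lemma edge_vertex_step m : (m < k.+1 + M)%N -> ev (S m.+1) <= ev (S m).
Proof.
move=> mk.
have gen L : {subset L <= ball3 m.+1} -> ev (labels L ++ S m) <= ev (S m).
  elim: L => [|x L IH] LB //=.
  have LB' : {subset L <= ball3 m.+1} by move=> g gL; apply: LB; rewrite inE gL orbT.
  apply: le_trans (IH LB').
  (* A label that is already present changes nothing; this covers the words of the smaller ball. *)
  have [xS|xS] := boolP ((x, true) \in labels L ++ S m).
    rewrite [leLHS](@eq_edge_vertex _ (labels L ++ S m))// => v.
    by rewrite inE; case: eqVneq => // ->.
  have : x \in ball3 m.+1 by apply: LB; rewrite inE eqxx.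
  have : x \notin ball3 m.
    apply: contraNN xS => xm; rewrite !mem_cat (_ : _ \in labels (ball3 m)) ?orbT//.
    exact: map_f.
  rewrite !mem_ball3; case: x LB xS => [|s g] //= LB xS + /andP[/andP[sg rg] gm].
  move=> _; have lg : lmul1 s g = s :: g.
    by case: g sg {rg gm LB xS} => //= t g; case: (eqVneq t s) => // ->; rewrite eqxx.
  have -> : (s :: g, true) = act s (g, true) by rewrite /act /= lg.
  have win : {in act s (g, true) :: labels L ++ S m, forall v, in_window v}.
    rewrite /act /= lg => v vv.
    apply: (@S_window m.+1 (((s :: g) :: L) ++ ball3 m)) => //.
      move=> h; rewrite mem_cat => /orP[/LB//|]; exact: subset_ball.
    by move: vv; rewrite /S /labels map_cat /= -catA.
  apply: edge_vertex_split.
  - exact: entropy_sub.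
  - exact: entropy_submod.
  - rewrite !mem_cat (_ : _ \in labels (ball3 m)) ?orbT//.
    by apply: map_f; rewrite mem_ball3 rg.
  - by rewrite /act /= lmul1K.
  - by move=> s'; apply: entropy_act.
  - by move=> s'; apply: entropy_act => v vv; apply: win; rewrite inE vv orbT.
apply: le_trans (gen (ball3 m.+1) _) => //.
rewrite [leLHS](@eq_edge_vertex _ (labels (ball3 m.+1) ++ S m))// => v.
rewrite !mem_cat; have [|//] := boolP (v \in labels (ball3 m)).
move=> /mapP[g gm ->]; rewrite [_ \in labels (ball3 m.+1)]map_f //.
by apply: subset_ball gm.
Qed.

(** The marks on the ball of radius k + 1 depend only on the labels within k + 1 + M, so they add no
    entropy, and what remains is the count 3/2 (4 * 2^n - 2) - 2 (3 * 2^n - 2) = 1. *)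
Lemma edge_vertex_last : ev (S (k.+1 + M)) = label_entropy.
Proof.
set n := (k.+1 + M)%N.
have sub_n m : (m <= N)%N -> {subset ball3 m <= ball3 N} by exact: subset_ball.
have E1 : entropy (S n) = (3 * 2 ^+ n - 2) * label_entropy.
  rewrite /n addSn -size_ball3 -entropy_labels ?wball_uniq//; last first.
    by apply: subset_ball; lia.
  apply/eqP; rewrite eq_le; apply/andP; split; last first.
    by apply: entropy_sub => v vL; rewrite mem_cat vL.
  apply: entropy_determined => x y xy.
  apply/allP => v; rewrite mem_cat => /orP[vL|/mapP[g gL ->]].
    by move/allP: xy; apply.
  apply: value_determined xy => h rh sh.
  move: gL; rewrite !mem_ball3 reduced_lmul//= => /andP[rg sg].
  by apply: leq_trans (size_lmul _ _) _; lia.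
have E2 s : entropy (S n ++ map (act s) (S n)) = (4 * 2 ^+ n - 2) * label_entropy.
  have mE g : (g \in ball3 n) || (g \in [seq lmul1 s h | h <- ball3 n]) =
              (g \in edge_ball n s) by rewrite -mem_cat mem_edge_ball.
  rewrite -(size_edge_ball_R n s) -entropy_labels ?edge_ball_uniq//; last first.
    move=> g; rewrite -mE => /orP[|/mapP[h + ->]]; first by apply: sub_n; lia.
    rewrite !mem_ball3 => /andP[rh sh]; rewrite reduced_lmul1//=.
    by apply: leq_trans (size_lmul1 _ _) _; apply: leq_ltn_trans sh _.
  apply/eqP; rewrite eq_le; apply/andP; split; last first.
    apply: entropy_sub => v /mapP[g]; rewrite -mE => /orP[gn|/mapP[h hn ->]] ->.
      by rewrite !mem_cat (_ : _ \in labels (ball3 n))//; exact: map_f.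
    rewrite mem_cat; apply/orP; right.
    apply/mapP; exists (h, true) => //.
    by rewrite mem_cat (_ : _ \in labels (ball3 n))//; exact: map_f.
  apply: entropy_determined => x y xy.
  have xyL g : g \in edge_ball n s -> value x (g, true) == value y (g, true).
    by move=> gE; move/allP: xy => -> //; apply: map_f.
  apply/allP => v; rewrite !mem_cat -orbA => /or3P[/mapP[g gn ->]|/mapP[g gn ->]|].
  - by apply: xyL; rewrite -mE gn.
  - apply: value_determined xy => h rh sh.
    rewrite -mE mem_ball3 reduced_lmul//=; apply/orP; left.
    apply: leq_trans (size_lmul _ _) _.
    by move: gn; rewrite mem_ball3 => /andP[_ sg]; apply: leq_add.
  - rewrite map_cat mem_cat => /orP[] /mapP[_ /mapP[g gn ->] ->]; rewrite /act /=.
      by apply: xyL; rewrite -mE (map_f (lmul1 s) gn) orbT.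
    apply: value_determined xy => h rh sh.
    rewrite lmul_lmul1// -mE (map_f (lmul1 s)) ?orbT// mem_ball3 reduced_lmul//=.
    apply: leq_trans (size_lmul _ _) _.
    by move: gn; rewrite mem_ball3 => /andP[_ sg]; apply: leq_add.
rewrite /edge_vertex E1 (eq_bigr _ (fun s _ => E2 s)) sumr_const card_ord.
rewrite -[_ *+ 3]mulr_natr; lra.
Qed.

(** Adjoining the label at the identity costs at most [label_entropy]; from then on the functional
    can only decrease, and it ends at [label_entropy]. The two cancel. *)
Lemma edge_vertex_marks_ge0 : 0 <= ev (marks (ball3 k.+1)).
Proof.
have H0 : label_entropy <= ev (S 0).
  have gen m : (m <= k.+1 + M)%N -> ev (S m) <= ev (S 0).
    elim: m => [_|m IH mk]; first exact: lexx.
    by apply: le_trans (edge_vertex_step mk) (IH (ltnW mk)).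
  by rewrite -edge_vertex_last; apply: gen.
have win : {in S 0, forall v, in_window v} by exact: (@S_window 0 (ball3 0)).
have := @edge_vertex_cons R _ entropy act entropy_sub entropy_submod entropy_nil
  (marks (ball3 k.+1)) ([::], true).
rewrite -/(S 0) => /(_ _ _) /le_trans H.
have {H} : ev (S 0) <= ev (marks (ball3 k.+1)) + entropy [:: ([::], true)].
  apply: H => // s; apply: entropy_act => // v vv; apply: win.
  by rewrite mem_cat vv orbT.
have -> : entropy [:: ([::], true)] = label_entropy.
  have := @entropy_labels [:: [::]] isT; rewrite mul1r; apply.
  by move=> g; rewrite inE => /eqP ->; rewrite mem_ball3.
lra.
Qed.

End root_ball.

Definition mark (x : Om) (g : word) : bool := A (fun h => ext x (lmul g h)).

Definition mark_density : R := \sum_(x | mark x [::]) mass x.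

Lemma mark_mass g : reduced g -> (size g + M <= N)%N ->
  \sum_(x | mark x g) mass x = mark_density.
Proof.
elim: g => // s g IH rsg sgN.
have rg : reduced g by case/andP: rsg.
have win : in_window (g, false) by rewrite /in_window /= rg.
rewrite -IH//; last exact: ltnW.
rewrite [RHS](reindex_inj (inv_inj (shiftK s))) /=; apply: eq_big => x.
  have := @value_shift s x (g, false) win; rewrite /value /= -/(mark _ _) => -[->].
  congr (A _); apply/funext => h /=.
  by case: g rsg {IH sgN rg win} => //= t g /andP[ts _]; case: (eqVneq t s) ts => // ->; rewrite eqxx.
by rewrite mass_shift.
Qed.

(** Only labellings of positive mass are considered, because these are the ones known to come from
    an actual configuration. *)
Definition exclusive (L : seq word) := forall x, mass x != 0 ->
  {in L &, forall g g', mark x g -> mark x g' -> g = g'}.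

Section exclusive_marks.
Variable L : seq word.
Hypothesis L_uniq : uniq L.
Hypothesis L_window : {in L, forall g, reduced g && (size g + M <= N)%N}.
Hypothesis L_excl : exclusive L.

Lemma has_mark_mass : \sum_(x | has (mark x) L) mass x = (size L)%:R * mark_density.
Proof.
transitivity (\sum_x \sum_(g <- L) if mark x g then mass x else 0).
  rewrite big_mkcond; apply: eq_bigr => x _.
  have [->|mx] := eqVneq (mass x) 0.
    by rewrite if_same big1// => g _; rewrite if_same.
  case: ifPn => [/hasP[g gL xg]|/hasPn nx]; last first.
    by rewrite big1_seq// => g /= gL; rewrite (negbTE (nx _ gL)).
  rewrite (bigD1_seq g)//= xg big1_seq ?addr0// => g' /andP[g'g g'L].
  by case: ifPn => // xg'; rewrite (L_excl mx g'L gL xg' xg) eqxx in g'g.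
rewrite exchange_big /= mulr_natl -[LHS]/(\sum_(_ <- _) _).
rewrite (eq_big_seq (fun=> mark_density)).
  by rewrite big_const_seq count_predT iter_addr_0.
by move=> g /L_window/andP[rg sg]; rewrite -big_mkcond mark_mass.
Qed.

Lemma density_bound : (size L)%:R * mark_density <= 1.
Proof.
rewrite -has_mark_mass -mass_sum1 [leRHS](bigID (fun x => has (mark x) L)) /=.
by rewrite lerDl; apply: sumr_ge0.
Qed.

(** Up to null labellings, exclusive marks give one class of mass [mark_density] for each position
    and one class without any mark. *)
Lemma entropy_marks : entropy (marks L) =
  (size L)%:R * (mark_density * - ln mark_density) -
  (1 - (size L)%:R * mark_density) * ln (1 - (size L)%:R * mark_density).
Proof.
set l := (size L)%:R.
have none : \sum_(x | ~~ has (mark x) L) mass x = 1 - l * mark_density.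
  rewrite -has_mark_mass -mass_sum1 [X in _ = X - _](bigID (fun x => has (mark x) L)) /=.
  by rewrite addrAC subrr add0r.
have vE x y g : (value x (g, false) == value y (g, false)) = (mark x g == mark y g).
  by apply/eqP/eqP => [[]//|]; rewrite /value /= -/(mark _ _) -/(mark _ _) => ->.
have cls x : mass x != 0 -> class_mass mass (agree (marks L)) x =
    if has (mark x) L then mark_density else 1 - l * mark_density.
  move=> mx; case: ifPn => [/hasP[g gL xg]|/hasPn nx].
    have /andP[rg sg] := L_window gL.
    rewrite -(mark_mass rg sg) /class_mass big_mkcond [RHS]big_mkcond.
    apply: eq_bigr => y _; have [->|my] := eqVneq (mass y) 0; first by rewrite !if_same.
    congr (if _ then _ else _); apply/allP/idP => [h|yg v /mapP[g' g'L ->]].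
      by have := h _ (map_f (fun g => (g, false)) gL); rewrite vE xg => /eqP.
    rewrite vE; have [->|g'g] := eqVneq g' g; first by rewrite yg xg.
    rewrite -[mark y g']negbK -[mark x g']negbK; apply/eqP; congr (~~ _).
    transitivity true; [apply/negP => h|symmetry; apply/negP => h].
      by rewrite (L_excl my g'L gL h yg) eqxx in g'g.
    by rewrite (L_excl mx g'L gL h xg) eqxx in g'g.
  rewrite -none /class_mass; apply: eq_bigl => y.
  apply/allP/hasPn => [h g gL|ny v /mapP[g gL ->]].
    have := h _ (map_f (fun g => (g, false)) gL); rewrite vE => /eqP ->.
    exact: nx.
  by rewrite vE (negbTE (nx _ gL)) (negbTE (ny _ gL)).
rewrite /entropy /rel_entropy (bigID (fun x => has (mark x) L)) /=; congr (_ + _).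
  rewrite mulrA -has_mark_mass mulr_suml; apply: eq_bigr => x hx.
  have [->|mx] := eqVneq (mass x) 0; first by rewrite !mul0r.
  by rewrite cls// hx.
rewrite -mulrN -none mulr_suml none; apply: eq_bigr => x hx.
have [->|mx] := eqVneq (mass x) 0; first by rewrite !mul0r.
by rewrite cls// (negbTE hx).
Qed.

End exclusive_marks.

Lemma exclusive_sub L L' : {subset L <= L'} -> exclusive L' -> exclusive L.
Proof. by move=> LL ex x mx g g' /LL gL /LL g'L; exact: ex. Qed.

(** The extra radius 5 serves the a priori bound: at most one mark on about 128 * 2^(k+1) positions
    gives 2^(k+1) q <= 3/128, below the 1/20 that the Taylor estimates require. The sixth unit is
    the generator leading to the second ball. *)
Theorem exclusive_density k : (k.+1 + 6 + M < N)%N ->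
  (forall s, exclusive (edge_ball (k.+1 + 5) s)) ->
  mark_density <= (4 ^+ k.+1)^-1 * (1 + 2 * k.+1%:R).
Proof.
move=> kN ex.
have win n s : (n <= k.+1 + 5)%N ->
    {in edge_ball n s, forall g, reduced g && (size g + M <= N)%N}.
  move=> nk g; rewrite -mem_edge_ball mem_cat => /orP[|/mapP[h + ->]];
    rewrite mem_ball3 => /andP[rg sg].
    by rewrite rg /=; apply: leq_trans (leq_add sg (leqnn _)) _; lia.
  rewrite reduced_lmul1//=.
  have sh : ((size h).+1 <= n.+1)%N by rewrite ltnS.
  by apply: leq_trans (leq_add (leq_trans (size_lmul1 _ _) sh) (leqnn _)) _; lia.
have sub_ball n s : {subset ball3 n <= edge_ball n s}.
  by move=> g gn; rewrite -mem_edge_ball mem_cat gn.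
have sub_edge n n' s : (n <= n')%N -> {subset edge_ball n s <= edge_ball n' s}.
  move=> nn' g; rewrite -!mem_edge_ball !mem_cat.
  have sb h : h \in ball3 n -> h \in ball3 n'.
    by rewrite !mem_ball3 => /andP[-> sh]; apply: leq_trans sh nn'.
  case/orP => [/sb ->//|/mapP[h hn ->]].
  by rewrite (map_f (lmul1 s) (sb _ hn)) orbT.
have d0 : 0 <= mark_density by apply: sumr_ge0.
have kk : (k.+1 <= k.+1 + 5)%N by rewrite leq_addr.
have bnd : (4 * 2 ^+ (k.+1 + 5) - 2) * mark_density <= 1.
  rewrite -(size_edge_ball_R _ ord0); apply: density_bound (ex _) => //.
    exact: edge_ball_uniq.
  exact: win.
have E s : entropy (marks (ball3 k.+1) ++ map (act s) (marks (ball3 k.+1))) =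
    (4 * 2 ^+ k.+1 - 2) * (mark_density * - ln mark_density) -
    (1 - (4 * 2 ^+ k.+1 - 2) * mark_density) * ln (1 - (4 * 2 ^+ k.+1 - 2) * mark_density).
  rewrite -(size_edge_ball_R k.+1 s) -entropy_marks; last 3 first.
  - exact: edge_ball_uniq.
  - exact: win.
  - by apply: exclusive_sub (ex s); exact: sub_edge.
  apply: entropy_eq => -[g b]; rewrite mem_cat /marks.
  have mE := mem_edge_ball k.+1 s g; rewrite mem_cat in mE.
  apply/orP/mapP => [[/mapP[h hk [-> ->]]|/mapP[_ /mapP[h hk ->] [-> ->]]]|[h + [-> ->]]].
  - by exists h => //; rewrite -mem_edge_ball mem_cat hk.
  - by exists (lmul1 s h) => //; rewrite -mem_edge_ball mem_cat map_f ?orbT.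
  - rewrite -mem_edge_ball mem_cat => /orP[hk|/mapP[h' hk ->]]; [left|right].
      exact: map_f.
    by apply/mapP; exists (h', false) => //; apply: map_f.
have V : entropy (marks (ball3 k.+1)) =
    (3 * 2 ^+ k.+1 - 2) * (mark_density * - ln mark_density) -
    (1 - (3 * 2 ^+ k.+1 - 2) * mark_density) * ln (1 - (3 * 2 ^+ k.+1 - 2) * mark_density).
  rewrite -(size_ball3 k) -entropy_marks //.
  - exact: wball_uniq.
  - by move=> g /(@sub_ball _ ord0); apply: win.
  - by apply: exclusive_sub (ex ord0) => g /(@sub_ball _ ord0); exact: sub_edge.
have kN' : (k.+1 + M < N)%N by lia.
have := edge_vertex_marks_ge0 kN'.
rewrite /edge_vertex V (eq_bigr _ (fun s _ => E s)) sumr_const card_ord.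
rewrite -[_ *+ 3]mulr_natr => ev0.
apply: (packing_numeric erefl erefl) => //; last by lra.
have d1 : mark_density <= 1.
  rewrite -mass_sum1 /mark_density [leRHS](bigID (fun x => mark x [::])) /= lerDl.
  by apply: sumr_ge0.
move: bnd; rewrite exprD (_ : 2 ^+ 5 = 32 :> R); last by rewrite !exprS; ring.
move: (2 ^+ k.+1) => D; lra.
Qed.

End factor_of_iid.

(** * The hyperbolic metric *)

Section hyperbolic_metric.
Variable R : realType.
Implicit Types (z w v : R * R) (s u a b : R).

Definition ch s : R := (expR s + expR (- s)) / 2.
Definition sh s : R := (expR s - expR (- s)) / 2.

Lemma expRNM s : expR s * expR (- s) = 1.
Proof. by rewrite -expRD subrr expR0. Qed.

Lemma ch2 s : ch s ^+ 2 = 1 + sh s ^+ 2.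
Proof.
have := expRNM s; rewrite /ch /sh; move: (expR s) (expR _) => x y xy; nra.
Qed.

Lemma chD a b : ch (a + b) = ch a * ch b + sh a * sh b.
Proof. by rewrite /ch /sh opprD !expRD; field. Qed.

Lemma ch_ge1 s : 1 <= ch s.
Proof.
have h0 : 0 <= ch s by rewrite /ch divr_ge0// addr_ge0 ?expR_ge0.
by have := ch2 s; have := sqr_ge0 (sh s); nra.
Qed.

Lemma ch_diff a b : ch b - ch a = (expR b - expR a) * (1 - expR (- a) * expR (- b)) / 2.
Proof.
have := expRNM a; have := expRNM b; rewrite /ch.
move: (expR a) (expR b) (expR (- a)) (expR (- b)) => x y z t h1 h2.
have -> : (y - x) * (1 - z * t) / 2 = (y - x - (y * t) * z + (x * z) * t) / 2 by field.
by rewrite h1 h2; lra.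
Qed.

Lemma ch_le a b : 0 <= a -> a <= b -> ch a <= ch b.
Proof.
move=> a0 ab; rewrite -subr_ge0 ch_diff divr_ge0// mulr_ge0//.
  by rewrite subr_ge0 ler_expR.
rewrite subr_ge0 -expRD -expR0 ler_expR; lra.
Qed.

Lemma ch_lt a b : 0 <= a -> a < b -> ch a < ch b.
Proof.
move=> a0 ab; rewrite -subr_gt0 ch_diff divr_gt0// mulr_gt0//.
  by rewrite subr_gt0 ltr_expR.
rewrite subr_gt0 -expRD -expR0 ltr_expR; lra.
Qed.

Lemma ch_diff_le a b : 0 <= a -> a <= b -> ch b - ch a <= (b - a) * expR b.
Proof.
move=> a0 ab; rewrite ch_diff.
have h1 : expR b - expR a <= (b - a) * expR b.
  have := expR_ge1Dx (a - b); rewrite expRB ler_pdivlMr ?expR_gt0//; lra.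
have h0 : 0 <= expR b - expR a by rewrite subr_ge0 ler_expR.
have h2 : 0 <= expR (- a) * expR (- b) by rewrite mulr_ge0 ?expR_ge0.
nra.
Qed.

Lemma sqrt_sub1_ge0 u : 1 <= u -> 0 <= u ^+ 2 - 1.
Proof. nra. Qed.

Lemma arcosh_ge0 u : 1 <= u -> 0 <= arcosh u.
Proof.
move=> u1; rewrite /arcosh ln_ge0//.
have := sqrtr_ge0 (u ^+ 2 - 1); lra.
Qed.

Lemma expR_arcosh u : 1 <= u -> expR (arcosh u) = u + Num.sqrt (u ^+ 2 - 1).
Proof. by move=> u1; rewrite /arcosh lnK// posrE; have := sqrtr_ge0 (u ^+ 2 - 1); lra. Qed.

Lemma expRN_arcosh u : 1 <= u -> expR (- arcosh u) = u - Num.sqrt (u ^+ 2 - 1).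
Proof.
move=> u1; rewrite expRN expR_arcosh//.
have h := sqr_sqrtr (sqrt_sub1_ge0 u1); have h0 := sqrtr_ge0 (u ^+ 2 - 1).
have nz : u + Num.sqrt (u ^+ 2 - 1) != 0 by rewrite gt_eqF//; lra.
apply: (mulIf nz); rewrite mulVf//; move: (Num.sqrt _) h h0 {nz} => r h h0; nra.
Qed.

Lemma ch_arcosh u : 1 <= u -> ch (arcosh u) = u.
Proof. by move=> u1; rewrite /ch expR_arcosh// expRN_arcosh//; field. Qed.

Lemma sh_arcosh u : 1 <= u -> sh (arcosh u) = Num.sqrt (u ^+ 2 - 1).
Proof. by move=> u1; rewrite /sh expR_arcosh// expRN_arcosh//; field. Qed.

Lemma arcosh_le u s : 1 <= u -> 0 <= s -> (arcosh u <= s) = (u <= ch s).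
Proof.
move=> u1 s0; apply/idP/idP => h.
  by rewrite -(ch_arcosh u1); apply: ch_le => //; apply: arcosh_ge0.
rewrite leNgt; apply/negP => h'.
by have := ch_lt s0 h'; rewrite ch_arcosh// ltNge h.
Qed.

Definition uhp z := 0 < z.2.

Definition chdist z w : R :=
  1 + ((z.1 - w.1) ^+ 2 + (z.2 - w.2) ^+ 2) / (2 * z.2 * w.2).

(** Distance at curvature -1; the general curvature is recovered at the end by rescaling lengths and
    times. *)
Definition hdist z w : R := arcosh (chdist z w).

Lemma hyp_distE k z w : hyp_dist k z w = hdist z w / Num.sqrt (- k).
Proof. by []. Qed.

Lemma chdist_ge1 z w : uhp z -> uhp w -> 1 <= chdist z w.
Proof.
move=> z0 w0; rewrite /chdist lerDl divr_ge0 ?addr_ge0 ?sqr_ge0//.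
by rewrite !mulr_ge0// ltW.
Qed.

Lemma hdist_ge0 z w : uhp z -> uhp w -> 0 <= hdist z w.
Proof. by move=> z0 w0; apply/arcosh_ge0/chdist_ge1. Qed.

Lemma chdist_sym z w : chdist z w = chdist w z.
Proof.
rewrite /chdist -[(z.1 - _) ^+ 2]sqrrN -[(z.2 - _) ^+ 2]sqrrN !opprB.
by rewrite -!mulrA [z.2 * _]mulrC.
Qed.

Lemma hdist_sym z w : hdist z w = hdist w z.
Proof. by rewrite /hdist chdist_sym. Qed.

Lemma hdist_le z w s : uhp z -> uhp w -> 0 <= s -> (hdist z w <= s) = (chdist z w <= ch s).
Proof. by move=> z0 w0 s0; rewrite arcosh_le// chdist_ge1. Qed.

Lemma ch_hdist z w : uhp z -> uhp w -> ch (hdist z w) = chdist z w.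
Proof. by move=> z0 w0; rewrite ch_arcosh// chdist_ge1. Qed.

(* Cauchy-Schwarz in the hyperboloid model, with the middle point moved to the apex *)
Lemma hdist_triangle v z w : uhp v -> uhp z -> uhp w ->
  hdist z w <= hdist z v + hdist v w.
Proof.
move=> v0 z0 w0; rewrite hdist_le ?addr_ge0 ?hdist_ge0// chD !ch_hdist//.
rewrite /hdist !sh_arcosh ?chdist_ge1// -sqrtrM ?sqrt_sub1_ge0 ?chdist_ge1//.
pose p := (z.1 - v.1) / v.2; pose q := z.2 / v.2.
pose p' := (w.1 - v.1) / v.2; pose q' := w.2 / v.2.
have q0 : 0 < q by rewrite divr_gt0.
have q'0 : 0 < q' by rewrite divr_gt0.
have nv : v.2 != 0 by rewrite gt_eqF.
have nz : z.2 != 0 by rewrite gt_eqF.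
have nw : w.2 != 0 by rewrite gt_eqF.
have nq : q != 0 by rewrite gt_eqF.
have nq' : q' != 0 by rewrite gt_eqF.
have E1 : chdist z w = 1 + ((p - p') ^+ 2 + (q - q') ^+ 2) / (2 * q * q').
  by rewrite /chdist /p /p' /q /q'; field; rewrite nv nz nw.
have E2 : chdist z v = (p ^+ 2 + q ^+ 2 + 1) / (2 * q).
  by rewrite /chdist /p /q; field; rewrite nv nz.
have E3 : chdist v w = (p' ^+ 2 + q' ^+ 2 + 1) / (2 * q').
  by rewrite /chdist /p' /q'; field; rewrite nv nw.
rewrite E1 E2 E3 {E1 E2 E3}.
pose a1 := (p ^+ 2 + q ^+ 2 - 1) / (2 * q); pose a2 := p / q.
pose b1 := (p' ^+ 2 + q' ^+ 2 - 1) / (2 * q'); pose b2 := p' / q'.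
have -> : ((p ^+ 2 + q ^+ 2 + 1) / (2 * q)) ^+ 2 - 1 = a1 ^+ 2 + a2 ^+ 2.
  by rewrite /a1 /a2; field.
have -> : ((p' ^+ 2 + q' ^+ 2 + 1) / (2 * q')) ^+ 2 - 1 = b1 ^+ 2 + b2 ^+ 2.
  by rewrite /b1 /b2; field.
have -> : 1 + ((p - p') ^+ 2 + (q - q') ^+ 2) / (2 * q * q') =
   (p ^+ 2 + q ^+ 2 + 1) / (2 * q) * ((p' ^+ 2 + q' ^+ 2 + 1) / (2 * q'))
   - (a1 * b1 + a2 * b2).
  by rewrite /a1 /a2 /b1 /b2; field; rewrite nq nq'.
rewrite lerD2l; apply: le_trans (ler_norm _) _; rewrite normrN.
rewrite -sqrtr_sqr ler_wsqrtr//.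
have := sqr_ge0 (a1 * b2 - a2 * b1); move: a1 a2 b1 b2 => x y t r; nra.
Qed.

Lemma chdist_le_expR s z w : uhp z -> uhp w -> 0 <= s -> chdist z w <= expR s / 2 -> hdist z w <= s.
Proof.
move=> z0 w0 s0 h; rewrite hdist_le//; apply: le_trans h _.
by rewrite /ch ler_pM2r ?invr_gt0// lerDl expR_ge0.
Qed.

End hyperbolic_metric.

(** * The reflection group of the ideal triangle *)

Section reflections.
Variable R : realType.
Implicit Types (z w : R * R) (g h : word).

Definition dsq z : R := (z.1 - 2^-1) ^+ 2 + z.2 ^+ 2.

(** The ideal vertices are 0, 1 and infinity. The sides are the vertical lines at 0 and 1 and the
    half-circle of centre 1/2 on which [dsq] equals 1/4. *)
Definition refl (s : 'I_3) z : R * R :=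
  match val s with
  | 0%N => (- z.1, z.2)
  | 1%N => (2 - z.1, z.2)
  | _ => (2^-1 + (z.1 - 2^-1) / (4 * dsq z), z.2 / (4 * dsq z))
  end.

Definition beyond (s : 'I_3) z : Prop :=
  match val s with
  | 0%N => z.1 < 0
  | 1%N => 1 < z.1
  | _ => dsq z < 4^-1
  end.

Definition triangle z := [/\ 0 < z.2, 0 < z.1, z.1 < 1 & 4^-1 < dsq z].
Definition closed_triangle z := [/\ 0 < z.2, 0 <= z.1, z.1 <= 1 & 4^-1 <= dsq z].

Lemma ord3P (P : 'I_3 -> Prop) :
  P (@Ordinal 3 0 isT) -> P (@Ordinal 3 1 isT) -> P (@Ordinal 3 2 isT) -> forall s, P s.
Proof.
by move=> h0 h1 h2 [[|[|[|//]]] i]; rewrite (bool_irrelevance i isT).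
Qed.

Lemma dsq_gt0 z : uhp z -> 0 < dsq z.
Proof. by move=> z0; rewrite /dsq ltr_wpDl ?sqr_ge0// exprn_gt0. Qed.

Lemma refl_uhp s z : uhp z -> uhp (refl s z).
Proof.
move=> z0; elim/ord3P: s => //; rewrite /uhp /refl /= divr_gt0// mulr_gt0//.
exact: dsq_gt0.
Qed.

Lemma dsq_refl2 z (s : 'I_3) : val s = 2%N -> uhp z -> dsq (refl s z) = (16 * dsq z)^-1.
Proof.
move=> s2 z0; have d0 := dsq_gt0 z0; rewrite /refl s2 {1}/dsq /=.
have E : (z.1 - 2^-1) ^+ 2 = dsq z - z.2 ^+ 2 by rewrite /dsq; ring.
rewrite [2^-1 + _]addrC addrK !expr_div_n E; field.
by rewrite gt_eqF.
Qed.

Lemma reflK s z : uhp z -> refl s (refl s z) = z.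
Proof.
move=> z0; elim/ord3P: s.
- by rewrite /refl /= opprK -surjective_pairing.
- by rewrite /refl /= subKr -surjective_pairing.
have d0 := dsq_gt0 z0.
rewrite {1}/refl /= dsq_refl2// /refl /= [in RHS](surjective_pairing z).
by congr (_, _); field; rewrite gt_eqF.
Qed.

Lemma chdist_refl s z w : uhp z -> uhp w -> chdist (refl s z) (refl s w) = chdist z w.
Proof.
move=> z0 w0; elim/ord3P: s; rewrite /chdist /refl /=.
- by congr (_ + (_ + _) / _); ring.
- by congr (_ + (_ + _) / _); ring.
have nz : dsq z != 0 by rewrite gt_eqF ?dsq_gt0.
have nw : dsq w != 0 by rewrite gt_eqF ?dsq_gt0.
have nz2 : z.2 != 0 by rewrite gt_eqF.
have nw2 : w.2 != 0 by rewrite gt_eqF.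
congr (_ + _).
have eqz : dsq z = (z.1 - 2^-1) ^+ 2 + z.2 ^+ 2 by [].
have eqw : dsq w = (w.1 - 2^-1) ^+ 2 + w.2 ^+ 2 by [].
move: (dsq z) (dsq w) nz nw eqz eqw => n m nz nw eqz eqw.
apply/eqP; rewrite -subr_eq0; apply/eqP.
transitivity ((((z.1 - 2^-1) * m - (w.1 - 2^-1) * n) ^+ 2 +
    (z.2 * m - w.2 * n) ^+ 2
    - m * n * ((z.1 - w.1) ^+ 2 + (z.2 - w.2) ^+ 2)) / (2 * z.2 * w.2 * n * m)).
  by field; rewrite nz nw nz2 nw2.
rewrite [X in X / _](_ : _ = 0) ?mul0r//.
by rewrite eqz eqw; ring.
Qed.

Lemma hdist_refl s z w : uhp z -> uhp w -> hdist (refl s z) (refl s w) = hdist z w.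
Proof. by move=> z0 w0; rewrite /hdist chdist_refl. Qed.

Definition gam g z : R * R := foldr refl z g.

Lemma gam_cat g h z : gam (g ++ h) z = gam g (gam h z).
Proof. by rewrite /gam foldr_cat. Qed.

Lemma gam_uhp g z : uhp z -> uhp (gam g z).
Proof. by move=> z0; elim: g => //= s g; exact: refl_uhp. Qed.

Lemma hdist_gam g z w : uhp z -> uhp w -> hdist (gam g z) (gam g w) = hdist z w.
Proof. by move=> z0 w0; elim: g => //= s g IH; rewrite hdist_refl ?gam_uhp. Qed.

Lemma gam_revK g z : uhp z -> gam (rev g) (gam g z) = z.
Proof.
move=> z0; elim: g => //= s g IH.
by rewrite rev_cons -cats1 gam_cat /= reflK ?gam_uhp.
Qed.

Lemma gamK g z : uhp z -> gam g (gam (rev g) z) = z.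
Proof. by move=> z0; rewrite -{1}(revK g) gam_revK. Qed.

Lemma gam_lmul1 s g z : uhp z -> gam (lmul1 s g) z = refl s (gam g z).
Proof.
move=> z0; case: g => [|t g] //=; case: eqVneq => [->|//].
by rewrite reflK// gam_uhp.
Qed.

Lemma gam_lmul g h z : uhp z -> gam (lmul g h) z = gam g (gam h z).
Proof. by move=> z0; elim: g => //= s g IH; rewrite gam_lmul1// IH. Qed.

(** The ping-pong step: reflection in side [s] throws the triangle, and everything beyond another
    side, into the half-plane beyond [s]. *)
Lemma refl_beyond s z : triangle z \/ (exists2 t, t != s & beyond t z /\ uhp z) ->
  beyond s (refl s z).
Proof.
elim/ord3P: s; rewrite /beyond /refl /=.
- case=> [[? ? ? ?]|[t +[]]]; first lra.
  elim/ord3P: t => //= _; rewrite ?/dsq; first lra.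
  move=> h u; have : 0 < z.2 ^+ 2 by rewrite exprn_gt0.
  nra.
- case=> [[? ? ? ?]|[t +[]]]; first lra.
  elim/ord3P: t => //= _; rewrite ?/dsq; first lra.
  move=> h u; have : 0 < z.2 ^+ 2 by rewrite exprn_gt0.
  nra.
move=> h.
have [u d] : uhp z /\ 4^-1 < dsq z.
  case: h => [[? ? ? ?]//|[t +[+ u]]].
  have : 0 < z.2 ^+ 2 by rewrite exprn_gt0.
  elim/ord3P: t => //= + _; rewrite /dsq; split => //; nra.
have := @dsq_refl2 z (@Ordinal 3 2 isT) erefl u.
rewrite /refl /= => ->.
rewrite ltf_pV2 ?posrE//; last by rewrite mulr_gt0// dsq_gt0.
by move: d; lra.
Qed.

Lemma gam_beyond s g z : reduced (s :: g) -> triangle z -> beyond s (gam (s :: g) z).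
Proof.
elim: g s => [|t g IH] s rsg tz; apply: refl_beyond; first by left.
right; exists t; first by move: rsg => /= /andP[].
split; first by apply: IH => //; case/andP: rsg.
by apply: (@gam_uhp (t :: g)); case: tz.
Qed.

Lemma beyond_disj s t z : uhp z -> beyond s z -> beyond t z -> s = t.
Proof.
move=> z0; have : 0 < z.2 ^+ 2 by rewrite exprn_gt0.
rewrite /beyond => z2; elim/ord3P: s; elim/ord3P: t => //=;
  rewrite ?/dsq => h1 h2; exfalso; nra.
Qed.

Lemma triangle_not_beyond s z : triangle z -> ~ beyond s z.
Proof. by case=> z0 h1 h2 h3; rewrite /beyond; elim/ord3P: s => /=; lra. Qed.

Lemma gam_inj g z w : uhp z -> uhp w -> gam g z = gam g w -> z = w.
Proof. by move=> z0 w0 e; rewrite -(gam_revK g z0) e gam_revK. Qed.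

(** A point of a tile reveals the first letter of the word: it is the only side beyond which the
    point lies, and points of the triangle lie beyond no side. The letter is then cancelled. *)
Lemma tiles_disjoint g h z w : reduced g -> reduced h -> triangle z -> triangle w ->
  gam g z = gam h w -> g = h.
Proof.
elim: g h => [|s g IH] [|t h] rg rh tz tw //.
- by move=> /= e; case: (@triangle_not_beyond t z) => //; rewrite [z]e; apply: gam_beyond.
- by move=> /= e; case: (@triangle_not_beyond s w) => //; rewrite -[w]e; apply: gam_beyond.
have uz : uhp z by case: tz.
have uw : uhp w by case: tw.
move=> e; have st : s = t.
  apply: (@beyond_disj _ _ (gam (s :: g) z)); first exact: gam_uhp.
    exact: gam_beyond.
  by rewrite e; apply: gam_beyond.
subst t; congr (_ :: _); apply: IH => //.
- by case/andP: rg.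
- by case/andP: rh.
by apply: (@gam_inj [:: s]) => //; apply: gam_uhp.
Qed.

End reflections.

(** * Displacements and covering *)

Local Open Scope classical_set_scope.
Local Open Scope ring_scope.

Section displacement.
Variable R : realType.
Implicit Types (z w : R * R) (g h : word).

Definition golden : R := (1 + Num.sqrt 5) / 2.

Lemma golden_sqr : golden ^+ 2 = golden + 1.
Proof.
have h : Num.sqrt 5 ^+ 2 = 5 :> R by rewrite sqr_sqrtr.
rewrite /golden; move: (Num.sqrt 5) h => r; nra.
Qed.

Lemma golden_gt1 : 1 < golden.
Proof.
have : 1 < Num.sqrt 5 :> R by rewrite -[ltLHS]sqrtr1 ltr_sqrt; lra.
rewrite /golden; lra.
Qed.

Lemma golden_lt2 : golden < 2.
Proof. have := golden_sqr; have := golden_gt1; nra. Qed.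

(* The norm of the integer vector (a, b) for the quadratic form attached to z *)
Definition vnorm (a b : R) z : R :=
  Num.sqrt (((a - b * z.1) ^+ 2 + (b * z.2) ^+ 2) / z.2).

Lemma minkowski2 (x y u v : R) :
  Num.sqrt ((x + u) ^+ 2 + (y + v) ^+ 2) <=
  Num.sqrt (x ^+ 2 + y ^+ 2) + Num.sqrt (u ^+ 2 + v ^+ 2).
Proof.
have A0 : 0 <= x ^+ 2 + y ^+ 2 by rewrite addr_ge0 ?sqr_ge0.
have B0 : 0 <= u ^+ 2 + v ^+ 2 by rewrite addr_ge0 ?sqr_ge0.
have cs : x * u + y * v <= Num.sqrt (x ^+ 2 + y ^+ 2) * Num.sqrt (u ^+ 2 + v ^+ 2).
  rewrite -sqrtrM//; apply: le_trans (ler_norm _) _.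
  rewrite -sqrtr_sqr ler_wsqrtr//; have := sqr_ge0 (x * v - y * u); nra.
have s0 : 0 <= Num.sqrt (x ^+ 2 + y ^+ 2) + Num.sqrt (u ^+ 2 + v ^+ 2).
  by rewrite addr_ge0 ?sqrtr_ge0.
rewrite -[leRHS]ger0_norm// -sqrtr_sqr ler_wsqrtr//.
by rewrite [leRHS]sqrrD !sqr_sqrtr// -[_ *+ 2]mulr_natr; lra.
Qed.

Lemma vnormD a b a' b' z : uhp z ->
  vnorm (a + a') (b + b') z <= vnorm a b z + vnorm a' b' z.
Proof.
move=> z0; have z1 : 0 <= z.2^-1 by rewrite invr_ge0 ltW.
rewrite /vnorm !sqrtrM ?addr_ge0 ?sqr_ge0//.
rewrite -mulrDl; apply: ler_wpM2r; first exact: sqrtr_ge0.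
apply: le_trans (minkowski2 _ _ _ _); rewrite le_eqVlt; apply/orP; left; apply/eqP.
by congr (Num.sqrt (_ ^+ 2 + _ ^+ 2)); ring.
Qed.

Lemma vnormN a b z : vnorm (- a) (- b) z = vnorm a b z.
Proof. by rewrite /vnorm; congr (Num.sqrt (_ / _)); ring. Qed.

(** The three numbers in increasing order are at most c, c phi and c phi^2. This is stated without
    sorting: at least one, at least two and all three of them respect the successive bounds. *)
Definition fib_bound (c x y z : R) :=
  [/\ [\/ x <= c, y <= c | z <= c],
      [\/ x <= c * golden /\ y <= c * golden,
          x <= c * golden /\ z <= c * golden | y <= c * golden /\ z <= c * golden]
    & [/\ x <= c * golden ^+ 2, y <= c * golden ^+ 2 & z <= c * golden ^+ 2]].

Lemma fib_boundC (c x y z : R) : fib_bound c x y z -> fib_bound c y z x.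
Proof.
case=> h1 h2 [h3 h4 h5]; split; last by split.
  by case: h1 => h; [exact: Or33|exact: Or31|exact: Or32].
by case: h2 => -[? ?]; [apply: Or32|apply: Or33|apply: Or31].
Qed.

(* Replacing any entry by the sum of the two others is worst, Fibonacci-like, for the smallest one. *)
Lemma fib_bound_step (c x y z z' : R) : 0 <= c -> fib_bound c x y z -> z' <= x + y ->
  fib_bound (c * golden) x y z'.
Proof.
move=> c0 [h1 h2 [h3 h4 h5]] zz.
have g2 := golden_sqr; have g1 := golden_gt1.
have e : c * golden * golden = c * golden ^+ 2 by ring.
have e3 : c * golden * golden ^+ 2 = c * golden ^+ 2 + c * golden.
  by rewrite {1}g2; ring.
have le1 : c * golden <= c * golden ^+ 2 by rewrite ler_wpM2l// g2; lra.
split; rewrite ?e ?e3.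
- by case: h2 => -[h h']; [exact: Or31|exact: Or31|exact: Or32].
- exact: Or31.
- have : 0 <= c * golden by rewrite mulr_ge0//; lra.
  by case: h2 => -[? ?] ?; split; lra.
Qed.

Definition vbound c z := fib_bound c (vnorm 1 0 z) (vnorm 0 1 z) (vnorm 1 1 z).

(** The vectors (1, 0), (0, 1), (1, 1) belong to the ideal vertices a/b = infinity, 0, 1. A
    reflection preserves the norms of the two vectors attached to its side and replaces the third
    vector by a signed sum of these two. *)
Lemma vbound_refl c s z : 0 <= c -> uhp z -> vbound c z -> vbound (c * golden) (refl s z).
Proof.
move=> c0 z0; rewrite /vbound; elim/ord3P: s.
- have -> : vnorm 1 0 (refl (@Ordinal 3 0 isT) z) = vnorm 1 0 z.
    by rewrite /vnorm /refl /=; congr (Num.sqrt (_ / _)); ring.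
  have -> : vnorm 0 1 (refl (@Ordinal 3 0 isT) z) = vnorm 0 1 z.
    by rewrite /vnorm /refl /=; congr (Num.sqrt (_ / _)); ring.
  move=> h; apply: fib_bound_step h _ => //.
  have -> : vnorm 1 1 (refl (@Ordinal 3 0 isT) z) = vnorm (-1 + 0) (0 + 1) z.
    by rewrite /vnorm /refl /=; congr (Num.sqrt (_ / _)); ring.
  apply: le_trans (vnormD _ _ _ _ z0) _.
  by rewrite -{1}oppr0 vnormN.
- have -> : vnorm 1 0 (refl (@Ordinal 3 1 isT) z) = vnorm 1 0 z.
    by rewrite /vnorm /refl /=; congr (Num.sqrt (_ / _)); ring.
  have -> : vnorm 1 1 (refl (@Ordinal 3 1 isT) z) = vnorm 1 1 z.
    by rewrite /vnorm /refl /=; congr (Num.sqrt (_ / _)); ring.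
  move=> h; do 1 apply: fib_boundC; do 1 apply: fib_boundC.
  do 2 apply: fib_boundC; do 2 apply: fib_boundC.
  apply: fib_boundC; apply: (@fib_bound_step c _ _ (vnorm 0 1 z)) => //.
    by do 2 apply: fib_boundC.
  have -> : vnorm 0 1 (refl (@Ordinal 3 1 isT) z) = vnorm (1 + 1) (1 + 0) z.
    by rewrite /vnorm /refl /=; congr (Num.sqrt (_ / _)); ring.
  exact: vnormD.
have d0 := dsq_gt0 z0; have nd : dsq z != 0 by rewrite gt_eqF.
have nz : z.2 != 0 by rewrite gt_eqF.
have E : dsq z = (z.1 - 2^-1) ^+ 2 + z.2 ^+ 2 by [].
have -> : vnorm 0 1 (refl (@Ordinal 3 2 isT) z) = vnorm 0 1 z.
  rewrite /vnorm /refl /=; congr Num.sqrt; move: (dsq z) nd E {d0} => n nd E.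
  rewrite -[RHS](_ : ((4^-1 + (z.1 - 2^-1) + ((z.1 - 2^-1) ^+ 2 + z.2 ^+ 2)) / z.2) = _); last by field.
  rewrite -E.
  transitivity ((n ^+ 2 * 4 + n * (z.1 - 2^-1) * 4 + ((z.1 - 2^-1) ^+ 2 + z.2 ^+ 2)) / (4 * n * z.2)).
    by field; rewrite nd nz.
  by rewrite -E; field; rewrite nd nz.
have -> : vnorm 1 1 (refl (@Ordinal 3 2 isT) z) = vnorm 1 1 z.
  rewrite /vnorm /refl /=; congr Num.sqrt; move: (dsq z) nd E {d0} => n nd E.
  rewrite -[RHS](_ : ((4^-1 - (z.1 - 2^-1) + ((z.1 - 2^-1) ^+ 2 + z.2 ^+ 2)) / z.2) = _); last by field.
  rewrite -E.
  transitivity ((n ^+ 2 * 4 - n * (z.1 - 2^-1) * 4 + ((z.1 - 2^-1) ^+ 2 + z.2 ^+ 2)) / (4 * n * z.2)).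
    by field; rewrite nd nz.
  by rewrite -E; field; rewrite nd nz.
have -> : vnorm 1 0 (refl (@Ordinal 3 2 isT) z) = vnorm (0 + 1) (1 + 1) z.
  rewrite /vnorm /refl /=; congr Num.sqrt; move: (dsq z) nd E {d0} => n nd E.
  rewrite -[RHS](_ : 4 * ((z.1 - 2^-1) ^+ 2 + z.2 ^+ 2) / z.2 = _); last by field.
  by rewrite -E; field; rewrite nd nz.
move=> h; apply: fib_boundC; apply: fib_boundC.
apply: (@fib_bound_step c _ _ (vnorm 1 0 z)) => //; first exact: fib_boundC.
exact: vnormD.
Qed.

Lemma vbound_gam c g z : 0 <= c -> uhp z -> vbound c z ->
  vbound (c * golden ^+ size g) (gam g z).
Proof.
move=> c0 z0 h; elim: g => [|s g IH] /=; first by rewrite mulr1.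
rewrite exprSr mulrA; apply: vbound_refl => //; last exact: gam_uhp.
by rewrite mulr_ge0// exprn_ge0//; have := golden_gt1; lra.
Qed.

Lemma chdist_vnorm z : uhp z ->
  chdist (0, 1) z = (vnorm 0 1 z ^+ 2 + vnorm 1 0 z ^+ 2) / 2.
Proof.
move=> z0; rewrite /vnorm !sqr_sqrtr; last 2 first.
- by rewrite divr_ge0 ?addr_ge0 ?sqr_ge0// ltW.
- by rewrite divr_ge0 ?addr_ge0 ?sqr_ge0// ltW.
rewrite /chdist /=; field; by rewrite gt_eqF.
Qed.

(** A box inside the triangle, half-open, of width 1/2 and with heights from 1 to 2, so that scaled
    copies tile strips of dyadic height. *)
Definition kset z : Prop := [/\ 4^-1 <= z.1, z.1 < 3 / 4, 1 <= z.2 & z.2 < 2].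

Lemma kset_uhp z : kset z -> uhp z.
Proof. by case=> _ _ h _; rewrite /uhp; lra. Qed.

Lemma kset_triangle z : kset z -> triangle z.
Proof.
case=> h1 h2 h3 h4; split; [lra|lra|lra|].
rewrite /dsq; have := sqr_ge0 (z.1 - 2^-1); nra.
Qed.

Lemma vbound_kset z : kset z -> vbound 2 z.
Proof.
case=> h1 h2 h3 h4.
have z0 : 0 < z.2 by lra.
have b a b' : ((a - b' * z.1) ^+ 2 + (b' * z.2) ^+ 2) <= 4 * z.2 -> vnorm a b' z <= 2.
  move=> h; rewrite /vnorm -[leRHS]ger0_norm// -sqrtr_sqr ler_wsqrtr//.
  by rewrite ler_pdivrMr//; lra.
have g1 := golden_gt1; have g2 := golden_sqr.
have b1 : vnorm 1 0 z <= 2 by apply: b; nra.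
have b2 : vnorm 0 1 z <= 2 by apply: b; nra.
have b3 : vnorm 1 1 z <= 2 by apply: b; nra.
split; first exact: Or31.
  by apply: Or31; split; nra.
by rewrite g2; split; nra.
Qed.

Definition disp_const : R := 2 * ln 8 + 8 * ln golden.

(** All three norms of [gam g z] are at most 2 phi^(|g| + 2), so cosh of the distance is at most 4
    phi^(2 |g| + 4). This is half of e^s for the stated bound s, whence the ln 8. *)
Lemma hdist_base_gam g z : kset z ->
  hdist (0, 1) (gam g z) <= ln 8 + (2 * (size g)%:R + 4) * ln golden.
Proof.
move=> kz; have g1 := golden_gt1.
have uz := kset_uhp kz.
have lg : 0 <= ln golden by apply: ln_ge0; lra.
have l8 : 0 <= ln 8 :> R by apply: ln_ge0; lra.
have s0 : 0 <= ln 8 + (2 * (size g)%:R + 4) * ln golden.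
  by rewrite addr_ge0// mulr_ge0// addr_ge0// mulr_ge0.
have u1 : uhp (0 : R, 1) by rewrite /uhp /=.
have ug := gam_uhp g uz.
apply: chdist_le_expR => //.
have c0 : 0 <= 2 :> R by [].
have [_ _ [h1 h2 _]] := vbound_gam g c0 uz (vbound_kset kz).
have -> : 2 * (size g)%:R + 4 = (2 * size g + 4)%:R :> R by rewrite natrD natrM.
rewrite expRD expRM_natl !lnK ?posrE//; last lra.
rewrite chdist_vnorm; last exact: gam_uhp.
have -> : golden ^+ (2 * size g + 4) = (golden ^+ size g * golden ^+ 2) ^+ 2.
  by rewrite -exprD -exprM; congr (_ ^+ _); lia.
rewrite -[X in _ <= X]mulrA in h1; rewrite -[X in _ <= X]mulrA in h2.
move: h1 h2; move: (golden ^+ size g * _) => G h1 h2.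
have v1 : 0 <= vnorm 1 0 (gam g z) by exact: sqrtr_ge0.
have v2 : 0 <= vnorm 0 1 (gam g z) by exact: sqrtr_ge0.
move: (vnorm 1 0 _) (vnorm 0 1 _) v1 v2 h1 h2 => a b a0 b0 h1 h2.
have : a ^+ 2 <= 4 * G ^+ 2 by nra.
have : b ^+ 2 <= 4 * G ^+ 2 by nra.
lra.
Qed.

Lemma hdist_gam_kset g h z w : kset z -> kset w ->
  hdist (gam g z) (gam h w) <= disp_const + 2 * (size g + size h)%:R * ln golden.
Proof.
move=> kz kw; have uz := kset_uhp kz; have uw := kset_uhp kw.
have -> : hdist (gam g z) (gam h w) = hdist z (gam (rev g ++ h) w).
  by rewrite -(hdist_gam (rev g)) ?gam_uhp// gam_revK// gam_cat.
have u1 : uhp (0 : R, 1) by rewrite /uhp /=.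
apply: le_trans (hdist_triangle u1 uz (gam_uhp _ uw)) _.
rewrite hdist_sym.
have := hdist_base_gam [::] kz; have := hdist_base_gam (rev g ++ h) kw.
rewrite /= size_cat size_rev /disp_const; lra.
Qed.

End displacement.

(** * Words of bounded length that bring a point into the triangle *)

Section covering.
Variable R : realType.
Implicit Types (z w : R * R) (g h : word).

Lemma cover_strip (n : nat) z : - n%:R <= z.1 -> z.1 <= n%:R + 1 ->
  exists g, [/\ (size g <= n)%N, 0 <= (gam g z).1, (gam g z).1 <= 1 & (gam g z).2 = z.2].
Proof.
elim: n z => [|n IH] z h1 h2.
  by exists [::]; split => //=; lra.
have [zneg|zpos] := ltP z.1 0.
  have [||g [g1 g2 g3 g4]] := IH (refl (@Ordinal 3 0 isT) z).
  - by rewrite /refl /=; move: h1; rewrite -addn1 natrD; have := ler0n R n; lra.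
  - by rewrite /refl /=; move: h1; rewrite -addn1 natrD; lra.
  by exists (rcons g (@Ordinal 3 0 isT)); rewrite size_rcons /gam foldr_rcons; split.
have [z1|z1] := leP z.1 1.
  by exists [::]; split.
have [||g [g1 g2 g3 g4]] := IH (refl (@Ordinal 3 1 isT) z).
- by rewrite /refl /=; move: h2; rewrite -addn1 natrD; lra.
- by rewrite /refl /=; have := ler0n R n; lra.
by exists (rcons g (@Ordinal 3 1 isT)); rewrite size_rcons /gam foldr_rcons; split.
Qed.

(* Inverting in the third side multiplies the height by at least a fixed factor unless it lands in the triangle. *)
Lemma cover_triangle_step (y0 : R) z : 0 < y0 -> y0 <= 4^-1 ->
  0 <= z.1 -> z.1 <= 1 -> y0 <= z.2 -> dsq z < 4^-1 ->
  let z' := refl (@Ordinal 3 2 isT) z in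
  closed_triangle z' \/
  [/\ y0 <= z'.2, z.2 <= (1 - 4 * y0 ^+ 2) * z'.2 & `|z'.1| <= 2^-1 + (8 * y0 ^+ 2)^-1].
Proof.
move=> y00 y04 x0 x1 yz dz z'.
have uz : uhp z by rewrite /uhp; lra.
have d0 := dsq_gt0 uz.
have d1 : y0 ^+ 2 <= dsq z.
  by rewrite /dsq; have := sqr_ge0 (z.1 - 2^-1); nra.
have E1 : z'.1 = 2^-1 + (z.1 - 2^-1) / (4 * dsq z) by [].
have E2 : z'.2 = z.2 / (4 * dsq z) by [].
have dz' : dsq z' = (16 * dsq z)^-1 by apply: dsq_refl2.
have far : dsq z <= 4^-1 - y0 ^+ 2 ->
    [/\ y0 <= z'.2, z.2 <= (1 - 4 * y0 ^+ 2) * z'.2 & `|z'.1| <= 2^-1 + (8 * y0 ^+ 2)^-1].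
  move=> dd; have d4 : 0 < 4 * dsq z by lra.
  split.
  - rewrite E2 ler_pdivlMr//; nra.
  - rewrite E2 mulrA ler_pdivlMr//; nra.
  rewrite E1; apply: le_trans (ler_normD _ _) _.
  rewrite ger0_norm// lerD2l normrM normfV (ger0_norm (ltW d4)) ler_pdivrMr//.
  have h : `|z.1 - 2^-1| <= 2^-1 by rewrite ler_norml; apply/andP; split; lra.
  apply: le_trans h _; rewrite mulrC ler_pdivlMr; last by rewrite mulr_gt0// exprn_gt0.
  lra.
have dE : dsq z = (z.1 - 2^-1) ^+ 2 + z.2 ^+ 2 by [].
have y2 : y0 ^+ 2 <= z.2 ^+ 2 by nra.
have d4 : 0 < 4 * dsq z by lra.
have [c0|c0] := ltP z'.1 0; last have [c1|c1] := leP z'.1 1.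
- right; apply: far.
  have : (z.1 - 2^-1) / (4 * dsq z) < - 2^-1 by lra.
  rewrite ltr_pdivrMr//; nra.
- left; split => //.
    by rewrite E2 divr_gt0//; lra.
  rewrite dz' lef_pV2 ?posrE//; last by rewrite mulr_gt0.
  lra.
- right; apply: far.
  have : 2^-1 < (z.1 - 2^-1) / (4 * dsq z) by lra.
  rewrite ltr_pdivlMr//; nra.
Qed.

(** [m] bounds the number of inversions: each one that does not land in the triangle divides the
    height by at most 1 - 4 y0^2, and at height 1/2 no point of the strip is inside the half-circle.
    [n] bounds the moves that return to the strip after each inversion. *)
Lemma cover_aux (y0 : R) (n m : nat) : 0 < y0 -> y0 <= 4^-1 ->
  2^-1 + (8 * y0 ^+ 2)^-1 <= n%:R ->
  forall z, 0 <= z.1 -> z.1 <= 1 -> y0 <= z.2 ->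
    2^-1 * (1 - 4 * y0 ^+ 2) ^+ m <= z.2 ->
  exists2 g, (size g <= m * n.+1)%N & closed_triangle (gam g z).
Proof.
move=> y00 y04 hn; elim: m => [|m IH] z x0 x1 yz ym.
  exists [::] => //; split => //; first by lra.
  by rewrite /dsq; have := sqr_ge0 (z.1 - 2^-1); nra.
have [dz|dz] := leP 4^-1 (dsq z).
  by exists [::] => //; split => //; lra.
have [ct|[h1 h2 h3]] := cover_triangle_step y00 y04 x0 x1 yz dz.
  by exists [:: @Ordinal 3 2 isT]; rewrite // mulSn.
set z' := refl _ z in h1 h2 h3.
have [||g [g1 g2 g3 g4]] := @cover_strip n z'.
- by move: h3; rewrite ler_norml => /andP[]; lra.
- by move: h3; rewrite ler_norml => /andP[]; lra.
have r0 : 0 < 1 - 4 * y0 ^+ 2 by nra.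
have [||||g' g'1 g'2] := IH (gam g z') => //.
- by rewrite g4.
- rewrite g4 -(ler_pM2l r0); apply: le_trans h2; apply: le_trans ym.
  by rewrite (exprS _ m) le_eqVlt; apply/orP; left; apply/eqP; ring.
exists (g' ++ rcons g (@Ordinal 3 2 isT)).
  by rewrite size_cat size_rcons mulSn addnC leq_add.
by rewrite gam_cat {2}/gam foldr_rcons.
Qed.

Lemma expr_lt1_small (r e : R) : 0 <= r -> r < 1 -> 0 < e -> exists m, r ^+ m <= e.
Proof.
move=> r0 r1 e0.
have : (fun n => r ^+ n) @ \oo --> (0 : R).
  by apply: cvg_expr; rewrite ger0_norm.
move=> /cvgrPdist_le /(_ _ e0) [m _ /(_ m (leqnn m))] /=.
by rewrite sub0r normrN ger0_norm ?exprn_ge0// => h; exists m.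
Qed.

Lemma cover_box (y0 X : R) : 0 < y0 -> exists N, forall z, y0 <= z.2 -> `|z.1| <= X ->
  exists2 g, (size g <= N)%N & closed_triangle (gam g z).
Proof.
move=> y00.
pose y1 := Num.min y0 4^-1.
have y10 : 0 < y1 by rewrite /y1 lt_min y00 /=; lra.
have y14 : y1 <= 4^-1 by rewrite /y1 ge_min lexx orbT.
have y1y : y1 <= y0 by rewrite /y1 ge_min lexx.
have [m hm] : exists m, (1 - 4 * y1 ^+ 2) ^+ m <= 2 * y1.
  by apply: expr_lt1_small; nra.
pose n := (Num.truncn (2^-1 + (8 * y1 ^+ 2)^-1)).+1.
have hn : 2^-1 + (8 * y1 ^+ 2)^-1 <= n%:R by apply/ltW/truncnS_gt.
pose n' := (Num.truncn X).+1.
have hn' : X <= n'%:R by apply/ltW/truncnS_gt.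
exists (m * n.+1 + n')%N => z yz xz.
have [||g [g1 g2 g3 g4]] := @cover_strip n' z.
- by move: xz; rewrite ler_norml => /andP[]; lra.
- by move: xz; rewrite ler_norml => /andP[]; lra.
have [||g' g'1 g'2] := cover_aux y10 y14 hn g2 g3 (m := m).
- by rewrite g4; lra.
- by rewrite g4; lra.
by exists (g' ++ g); rewrite ?gam_cat// size_cat leq_add.
Qed.

End covering.

(** * Stability of popping under small perturbations *)

Fixpoint dec_chain (R : realType) (C : Type) (d : C -> C -> R) (c : C) (s : R) (p : seq C) : bool :=
  if p is c' :: p' then (d c c' < s) && dec_chain d c' (d c c') p' else true.

(** Abstract comparison of two configurations, indexed by a boolean, that occupy the same cells. [d]
    measures distances of cell representatives, [q b] those of the actual points, and [lev] the
    distance to the origin; beyond level [L] a popping partner could leave the window. *)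
Section discrepancy.
Variables (R : realType) (C : eqType) (occ : pred C) (d : C -> C -> R) (lev : C -> R).
Variables (tau : bool -> C -> \bar R) (q : bool -> C -> C -> R).
Variables (e t L : R) (n : nat).
Hypothesis q_ge0 : forall b c c', occ c -> occ c' -> 0 <= q b c c'.
Hypothesis q_sym : forall b c c', q b c c' = q b c' c.
Hypothesis q_near : forall b c c', occ c -> occ c' -> `|q b c c' - d c c'| <= e.
Hypothesis e1 : e <= 1.
Hypothesis repel : forall b c c', occ c -> occ c' -> c != c' ->
  (tau b c <= (q b c c' / 2)%:E)%E \/ (tau b c' <= (q b c c' / 2)%:E)%E.
Hypothesis partner : forall b c, occ c -> lev c <= L -> (tau b c <= t%:E)%E ->
  exists c', [/\ occ c', c' != c, tau b c' = tau b c & tau b c = (q b c c' / 2)%:E].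
Hypothesis lev_step : forall c c', occ c -> occ c' -> lev c' <= lev c + d c c'.
Hypothesis no_tie : forall c c' c'', occ c -> occ c' -> occ c'' ->
  c != c' -> c' != c'' -> c != c'' -> 2 * e < `|d c c' - d c' c''|.

(* [u] and [v] pop together in configuration [b] but [v] pops earlier, hence with somebody else, in the other one. *)
Definition discrepant b u v (F : seq C) :=
  [/\ [/\ occ u, occ v, u != v & d u v <= 2 * t - 2 + e],
      tau b u = (q b u v / 2)%:E, tau b v = (q b u v / 2)%:E,
      (tau (~~ b) v <= (q (~~ b) u v / 2)%:E)%E
    & u \in F /\ {in F, forall y, (tau (~~ b) v < tau (~~ b) y)%E /\ (tau b v <= tau b y)%E}].

(** In configuration [~~ b] the point [v] pops with some [w] that is closer to it than [u].
    Repulsion then forces [w] to pop before [v] in configuration [b], so the discrepancy passes to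
    [v] and [w] with the configurations exchanged. The absence of ties makes the decrease of [d]
    strict, and the members of [F] cannot be [w] because they pop later than [v] in [~~ b]. *)
Lemma discrepant_step b u v F : discrepant b u v F -> lev v <= L ->
  exists w, [/\ occ w, w \notin v :: F, d v w < d u v & discrepant (~~ b) v w (v :: F)].
Proof.
have ee := e1; case=> -[ou ov uv duv] tu tv tv' [uF HF] lv.
have /ler_normlP [n1 n2] := q_near (~~ b) ou ov.
have [w [ow wv tw tvw]] : exists c', [/\ occ c', c' != v, tau (~~ b) c' = tau (~~ b) v
     & tau (~~ b) v = (q (~~ b) v c' / 2)%:E].
  apply: partner => //; apply: le_trans tv' _; rewrite lee_fin. lra.
have wF : w \notin F.
  by apply/negP => /HF [+ _]; rewrite tw ltxx.
have wu : w != u by apply: contraNneq wF => ->.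
have qle : q (~~ b) v w <= q (~~ b) u v.
  by move: tv'; rewrite tvw lee_fin; lra.
have /ler_normlP [m1 m2] := q_near (~~ b) ov ow.
have := no_tie ou ov ow uv; rewrite eq_sym wv eq_sym wu => /(_ isT isT) tie.
have dvw : d v w < d u v - 2 * e.
  move: tie; rewrite ltNge ler_norml negb_and -!ltNge => /orP[|]; lra.
have e0 : 0 <= e by apply: le_trans (normr_ge0 _) (q_near b ou ov).
exists w; split => //; first by rewrite inE negb_or wv.
  by apply: lt_le_trans dvw _; lra.
have /ler_normlP [k1 k2] := q_near b ov ow.
have /ler_normlP [l1 l2] := q_near b ou ov.
have qb : q b v w < q b u v by lra.
have vw : v != w by rewrite eq_sym.
have tbw : (tau b w <= (q b v w / 2)%:E)%E.
  by case: (repel b ov ow vw) => //; rewrite tv lee_fin => ?; exfalso; lra.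
have tbwv : (tau b w < tau b v)%E.
  by apply: le_lt_trans tbw _; rewrite tv lte_fin; lra.
rewrite /discrepant negbK; split => //.
- by split=> //; lra.
- by rewrite tw.
split; first by rewrite inE eqxx.
move=> y; rewrite inE => /predU1P[->|yF]; first by rewrite tw.
have [h1 h2] := HF _ yF; rewrite tw; split; last exact: ltW.
exact: lt_le_trans tbwv h2.
Qed.

Lemma discrepant_chain m b u v F : discrepant b u v F -> 0 <= t ->
  lev v + m%:R * (2 * t + 1) <= L ->
  exists p, [/\ size p = m, all occ p, dec_chain d v (d u v) p
    & uniq p /\ {in p, forall y, y \notin v :: F}].
Proof.
elim: m b u v F => [|m IH] b u v F disc t0 lv.
  by exists [::]; split.
have lv' : lev v <= L.
  apply: le_trans lv; rewrite lerDl mulr_ge0//; lra.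
have [w [ow wF dvw disc']] := discrepant_step disc lv'.
have [|p [sp op dp [up pF]]] := IH _ _ _ _ disc' t0.
  have [[ou ov uv duv] _ _ _ _] := disc.
  have ee := e1; have := lev_step ov ow; move: lv; rewrite -natr1 mulrDl mul1r; lra.
exists (w :: p); split=> //=; first by rewrite sp.
- by rewrite ow.
- by rewrite dvw.
split.
  by rewrite up andbT; apply/negP => /pF; rewrite inE eqxx.
move=> y; rewrite inE => /predU1P[->//|/pF].
by rewrite inE negb_or => /andP[].
Qed.

Theorem status_stable c0 : occ c0 -> 0 <= t -> lev c0 + n.+1%:R * (2 * t + 1) <= L ->
  (forall p, size p = n.+1 -> all occ (c0 :: p) -> uniq (c0 :: p) ->
     dec_chain d c0 (2 * t + 1) p -> False) ->
  (t%:E < tau true c0)%E -> ((t - 1)%:E < tau false c0)%E.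
Proof.
have ee := e1; move=> hc0 t0 l0 nochain tt; rewrite ltNge; apply/negP => tf.
have lc0 : lev c0 <= L.
  by apply: le_trans l0; rewrite lerDl mulr_ge0//; lra.
have [c1 [hc1 c10 t1 tq]] : exists c', [/\ occ c', c' != c0, tau false c' = tau false c0
     & tau false c0 = (q false c0 c' / 2)%:E].
  by apply: partner => //; apply: le_trans tf _; rewrite lee_fin; lra.
have c01 : c0 != c1 by rewrite eq_sym.
have qf : q false c0 c1 <= 2 * t - 2 by move: tf; rewrite tq lee_fin; lra.
have /ler_normlP [k1 k2] := q_near false hc0 hc1.
have /ler_normlP [l1 l2] := q_near true hc0 hc1.
have e0 : 0 <= e by apply: le_trans (normr_ge0 _) (q_near true hc0 hc1).
have tt1 : (tau true c1 <= (q true c0 c1 / 2)%:E)%E.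
  case: (repel true hc0 hc1 c01) => // h; exfalso.
  have : (t%:E < (q true c0 c1 / 2)%:E)%E by apply: lt_le_trans tt h.
  by rewrite lte_fin; lra.
have tlt : (tau true c1 < tau true c0)%E.
  apply: le_lt_trans tt1 _; apply: le_lt_trans tt; rewrite lee_fin; lra.
have disc : discrepant false c0 c1 [:: c0].
  split=> //; first by split => //; lra.
    by rewrite t1.
  split; first by rewrite inE.
  by move=> y; rewrite inE => /eqP ->; rewrite t1.
have [|p [sp op dp [up pF]]] := @discrepant_chain n _ _ _ _ disc t0.
  have := lev_step hc0 hc1; move: l0; rewrite -natr1 mulrDl mul1r; lra.
apply: (nochain (c1 :: p)) => /=.
- by rewrite sp.
- by rewrite hc0 hc1 op.
- rewrite up andbT inE negb_or c01 /=; apply/andP; split.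
    by apply/negP => /pF; rewrite !inE eqxx orbT.
  by apply/negP => /pF; rewrite !inE eqxx.
- by rewrite dp andbT; lra.
Qed.

End discrepancy.

(** * Invariance of the hyperbolic area *)

Section density_measure.
Local Open Scope ereal_scope.
Context d (T : measurableType d) (R : realType) (mu : {measure set T -> \bar R}).
Variables (D : set T) (f : T -> \bar R).
Hypotheses (mD : measurable D) (mf : measurable_fun D f) (f0 : forall x, D x -> 0 <= f x).

Definition weighted (A : set T) : \bar R := \int[mu]_(x in A `&` D) f x.

Let weighted_set0 : weighted set0 = 0.
Proof. by rewrite /weighted set0I integral_set0. Qed.

Let weighted_ge0 A : 0 <= weighted A.
Proof. by apply: integral_ge0 => x [_ Dx]; exact: f0. Qed.

Let weighted_sigma_additive : semi_sigma_additive weighted.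
Proof.
move=> /= F mF tF mUF; rewrite /weighted; apply: cvg_toP.
  apply: ereal_nondecreasing_is_cvgn => m n mn.
  by apply: lee_sum_nneg_natr => // k _ _; exact: weighted_ge0.
rewrite setI_bigcupl ge0_integral_bigcup//=.
- by move=> k; apply: measurableI.
- by apply: measurable_funS mf => // x [k _ [_ ?]].
- by move=> x [k _ [_ Dx]]; exact: f0.
- exact: trivIset_setIr.
Qed.

Definition density_measure : {measure set T -> \bar R} :=
  HB.pack weighted (isMeasure.Build _ _ _ weighted weighted_set0 weighted_ge0 weighted_sigma_additive).

End density_measure.

Section pushforward_pack.
Context d d' (T : measurableType d) (T' : measurableType d') (R : realType).
Variables (mu : {measure set T -> \bar R}) (f : T -> T').
Hypothesis mf : measurable_fun setT f.

Definition image_fun (A : set T') : \bar R := mu (f @^-1` A).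

Let image0 : image_fun set0 = 0%E.
Proof. by rewrite /image_fun preimage_set0 measure0. Qed.

Let image_ge0 A : (0 <= image_fun A)%E.
Proof. exact: measure_ge0. Qed.

Let image_sigma_additive : semi_sigma_additive image_fun.
Proof.
move=> F mF tF mUF; rewrite /image_fun preimage_bigcup.
apply: measure_semi_sigma_additive.
- by move=> n; rewrite -[X in measurable X]setTI; exact: mf.
- apply/trivIsetP => /= i j _ _ ij; rewrite -preimage_setI.
  by move/trivIsetP : tF => /(_ _ _ _ _ ij) ->//; rewrite preimage_set0.
- by rewrite -preimage_bigcup -[X in measurable X]setTI; exact: mf.
Qed.

Definition image_measure : {measure set T' -> \bar R} :=
  HB.pack image_fun (isMeasure.Build _ _ _ image_fun image0 image_ge0 image_sigma_additive).

End pushforward_pack.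

Section one_dimensional.
Variable R : realType.
Local Notation leb := (@lebesgue_measure R).

Lemma measurable_inv : measurable_fun setT (fun x : R => x^-1).
Proof.
have -> : setT = [set 0 : R] `|` ~` [set 0] by rewrite setUv.
apply/measurable_funU => //; first exact: measurableC.
split; first exact: measurable_fun_set1.
apply: open_continuous_measurable_fun.
  by rewrite openC; exact: closed_eq.
move=> x; rewrite inE /= => /eqP x0.
exact: inv_continuous.
Qed.

Lemma lebesgue_measure_shift (A : set R) (c : R) : measurable A ->
  leb ((fun x => x + c) @^-1` A) = leb A.
Proof.
move=> mA.
have mf : measurable_fun setT (fun x : R => x + c) by apply: measurable_funD.
have := @lebesgue_measure_unique R
  (@image_measure _ _ (measurableTypeR R) (measurableTypeR R) R leb _ mf).
move=> H; symmetry; apply: (H _ A mA) => {H mA A} /= _ [[a b] _ <-].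
rewrite /image_fun.
have -> : (fun x => x + c) @^-1` `]a, b]%classic = `]a - c, b - c]%classic.
  by apply/seteqP; split => x /=; rewrite !in_itv /= => /andP[? ?]; apply/andP; split; lra.
rewrite !lebesgue_measure_itv /= !lte_fin ltrD2r; case: ifP => // _.
by rewrite -!EFinB; congr (_%:E); ring.
Qed.

Lemma lebesgue_measure_opp (A : set R) : measurable A ->
  leb (-%R @^-1` A) = leb A.
Proof. exact: lebesgue_measureN. Qed.

Lemma lebesgue_measure_scale (A : set R) (c : R) : 0 < c -> measurable A ->
  leb ((fun x => c * x) @^-1` A) = (c^-1%:E * leb A)%E.
Proof.
move=> c0 mA.
have mf : measurable_fun setT (fun x : R => c * x) by apply: measurable_funM.
have E : (c%:E * leb ((fun x => (c * x)%R) @^-1` A) = leb A)%E.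
  have k0 : 0 <= c by exact: ltW.
  have := @lebesgue_measure_unique _ (mscale (NngNum k0)
    (@image_measure _ _ (measurableTypeR R) (measurableTypeR R) R leb _ mf)).
  move=> H; symmetry; apply: (H _ A mA) => {H mA A} /= _ [[a b] _ <-].
  rewrite /mscale /= /image_fun.
  have -> : (fun x => c * x) @^-1` `]a, b]%classic = `]a / c, b / c]%classic.
    by apply/seteqP; split => x /=;
      rewrite !in_itv /= ltr_pdivrMr// ler_pdivlMr// ![_ * c]mulrC.
  rewrite !lebesgue_measure_itv /= !lte_fin ltr_pM2r ?invr_gt0//.
  case: ifP => _; last by rewrite mule0.
  by rewrite -!EFinB -EFinM; congr (_%:E); field; rewrite gt_eqF.
by rewrite -E muleA -EFinM mulVf ?mul1e// gt_eqF.
Qed.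

Lemma measurable_inv_pos (D : set R) : measurable_fun D (fun y : R => (y^-1)%:E).
Proof. by apply/measurable_EFinP; apply: measurable_funTS; exact: measurable_inv. Qed.

Lemma measurable_pos : measurable [set y : R | 0 < y].
Proof. by rewrite -set_itvoy. Qed.

(** The measure dy / y is Lebesgue measure in the variable ln y; on intervals this is the
    fundamental theorem of calculus. *)
Lemma lebesgue_measure_ln (B : set R) : measurable B ->
  (\int[leb]_(y in (@ln R @^-1` B) `&` [set y : R | 0 < y]%R) (y^-1)%:E)%E = leb B.
Proof.
move=> mB.
have mf : measurable_fun setT (@ln R) by exact: measurable_ln.
have f0 (y : R) : [set y : R | 0 < y] y -> (0 <= (y^-1)%:E)%E.
  by move=> /= y0; rewrite lee_fin invr_ge0 ltW.
have mD := measurable_pos.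
pose m := @image_measure _ _ (measurableTypeR R) (measurableTypeR R) R
  (density_measure leb mD (@measurable_inv_pos _) f0) _ mf.
have := @lebesgue_measure_unique R m.
move=> H; symmetry; apply: (H _ B mB) => {H mB B} /= _ [[a b] _ <-].
rewrite /m /= /image_fun /= /weighted.
have -> : @ln R @^-1` `]a, b]%classic `&` [set y : R | 0 < y] = `]expR a, expR b]%classic.
  apply/seteqP; split => [y [] /=|y /=]; rewrite !in_itv /=.
    move=> /andP[h1 h2] y0; rewrite -{1}[y]lnK ?posrE// ltr_expR h1 /=.
    by rewrite -[y]lnK ?posrE// ler_expR.
  move=> /andP[h1 h2]; have y0 : 0 < y by apply: lt_trans h1; exact: expR_gt0.
  split => //; rewrite -ltr_expR -[ln y <= b]ler_expR lnK ?posrE//.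
  by rewrite h1 h2.
have [ab|ba] := ltP a b; last first.
  rewrite !set_itv_ge ?integral_set0 ?measure0//.
    by rewrite bnd_simp -leNgt ler_expR.
  by rewrite bnd_simp -leNgt.
rewrite integral_itv_obnd_cbnd; last exact: measurable_inv_pos.
have pos x : x \in `[expR a, expR b]%R -> 0 < x.
  by rewrite in_itv /= => /andP[h _]; apply: lt_le_trans h; exact: expR_gt0.
rewrite (@continuous_FTC2 _ _ (@ln R)) ?ltr_expR ?expRK//.
- by rewrite lebesgue_measure_itv /= lte_fin ab.
- apply: continuous_in_subspaceT => x; rewrite inE /= => xI.
  by apply: inv_continuous; rewrite gt_eqF ?pos.
- split.
  + move=> x xI; have x0 : 0 < x by apply: pos; apply: subset_itv_oo_cc xI.
    by apply: ex_derive; exact: is_derive1_ln.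
  + by apply: cvg_at_right_filter; apply: continuous_ln; exact: expR_gt0.
  + by apply: cvg_at_left_filter; apply: continuous_ln; exact: expR_gt0.
- move=> x xI; have x0 : 0 < x by apply: pos; apply: subset_itv_oo_cc xI.
  by have [_ +] := is_derive1_ln x0; rewrite derive1E.
Qed.

End one_dimensional.

Section area.
Variable R : realType.
Local Notation leb := (@lebesgue_measure R).
Local Notation leb2 := (@lebesgue_measure R \x @lebesgue_measure R)%E.

Lemma measurable_uhp : measurable (@upper_half_plane R).
Proof.
have -> : @upper_half_plane R = setT `&` snd @^-1` [set y : R | 0 < y].
  by rewrite setTI.
by apply: measurable_snd => //; exact: measurable_pos.
Qed.

Lemma measurable_area_density (D : set (R * R)) :
  measurable_fun D (fun z : R * R => ((z.2 ^+ 2)^-1)%:E).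
Proof.
apply/measurable_EFinP; apply: measurable_funTS.
apply: (measurableT_comp (@measurable_inv R)).
by apply: measurable_funX; exact: measurable_snd.
Qed.

Lemma area_density_ge0 (z : R * R) : @upper_half_plane R z -> (0 <= ((z.2 ^+ 2)^-1)%:E)%E.
Proof. by move=> _; rewrite lee_fin invr_ge0 sqr_ge0. Qed.

Definition area : {measure set (measurableTypeR R * measurableTypeR R) -> \bar R} :=
  density_measure leb2 measurable_uhp (@measurable_area_density _) area_density_ge0.

Lemma hyp_areaE (k : R) (A : set (R * R)) : k < 0 -> measurable A ->
  hyp_area k A = ((- k)^-1%:E * area A)%E.
Proof.
move=> k0 mA; rewrite /hyp_area /= /weighted -ge0_integralZl//.
- by apply: eq_integral => z _; rewrite -EFinM invfM.
- by apply: measurableI => //; exact: measurable_uhp.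
- exact: measurable_area_density.
- by move=> z [_ /area_density_ge0].
- by rewrite lee_fin invr_ge0; lra.
Qed.

(** Coordinates x = p e^u, y = e^u, in which dx dy / y^2 becomes dp du. The invariance of the area
    then reduces to shears, translations and sign changes of Lebesgue measure. *)
Definition to_log (z : R * R) : R * R := (z.1 * expR (- ln z.2), ln z.2).
Definition of_log (q : R * R) : R * R := (q.1 * expR q.2, expR q.2).

Lemma of_logK z : uhp z -> of_log (to_log z) = z.
Proof.
move=> z0; rewrite /of_log /to_log /= expRN lnK ?posrE//.
by rewrite divfK ?gt_eqF// -surjective_pairing.
Qed.

Lemma measurable_to_log : measurable_fun setT to_log.
Proof.
have ml : measurable_fun setT (fun z : R * R => ln z.2).
  by apply: measurableT_comp; [exact: measurable_ln|exact: measurable_snd].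
apply: measurable_fun_pair => //.
apply: measurable_funM; first exact: measurable_fst.
by apply: measurableT_comp; [exact: measurable_expR|apply: measurableT_comp].
Qed.

Lemma measurable_of_log : measurable_fun setT of_log.
Proof.
have ml : measurable_fun setT (fun z : R * R => expR z.2).
  by apply: measurableT_comp; [exact: measurable_expR|exact: measurable_snd].
apply: measurable_fun_pair => //.
by apply: measurable_funM; first exact: measurable_fst.
Qed.

Lemma area_to_log_rect (A B : set R) : measurable A -> measurable B ->
  area (to_log @^-1` (A `*` B)) = (leb A * leb B)%E.
Proof.
move=> mA mB; rewrite /= /weighted integral_mkcond.
set D := _ `&` _.
have mAB : measurable (A `*` B) by exact: measurableX.
have mD : measurable D.
  apply: measurableI; last exact: measurable_uhp.
  by rewrite -[X in measurable X]setTI; apply: measurable_to_log.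
set f := _ \_ D.
have mf : measurable_fun setT f.
  by apply/(measurable_restrictT _ mD); exact: measurable_area_density.
have f0 z : (0 <= f z)%E.
  by rewrite /f /patch; case: ifP => // _; rewrite lee_fin invr_ge0 sqr_ge0.
rewrite fubini_tonelli1//= fubini_tonelli//=.
set E := (@ln R @^-1` B) `&` [set y : R | 0 < y].
have mE : measurable E.
  apply: measurableI; last exact: measurable_pos.
  by rewrite -[X in measurable X]setTI; apply: measurable_ln.
transitivity (\int[leb]_y (leb A * ((fun y => (y^-1)%:E) \_ E) y)%E)%E; last first.
  rewrite ge0_integralZl//; last first.
  - by move=> y _; rewrite /patch; case: ifP => // /set_mem [_ /= y0];
      rewrite lee_fin invr_ge0 ltW.
  - by apply/(measurable_restrictT _ mE); exact: measurable_inv_pos.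
  by rewrite -integral_mkcond lebesgue_measure_ln.
apply: eq_integral => y _; rewrite /fubini_G /patch.
have [yE|yE] := boolP (y \in E); last first.
  rewrite mule0 integral0_eq// => x _; rewrite /f /patch ifF//.
  apply/negP => /set_mem [[_ /= yB] /= y0]; move/negP: yE; apply.
  by apply/mem_set; split.
have [yB /= y0] := set_mem yE.
have -> : (fun x => f (x, y)) = (fun x => ((y ^+ 2)^-1)%:E * (\1_((fun x => y^-1 * x) @^-1` A) x)%:E)%E.
  apply/funext => x; rewrite /f /patch indicE.
  have -> : ((x, y) \in D) = (x \in (fun x => y^-1 * x) @^-1` A).
    apply/idP/idP => /set_mem.
      by move=> [[/= h _] _]; apply/mem_set; move: h; rewrite /= expRN lnK ?posrE// mulrC.
    move=> /= h; apply/mem_set; split => //; split => //=.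
    by rewrite expRN lnK ?posrE// mulrC.
  by case: ifP => _ /=; rewrite ?mule1 ?mule0.
have mA' : measurable ((fun x => y^-1 * x) @^-1` A).
  have mg : measurable_fun setT (fun x : R => y^-1 * x) by apply: measurable_funM.
  by rewrite -[X in measurable X]setTI; apply: mg.
rewrite ge0_integralZl//.
- rewrite integral_indic// setIT.
  have y'0 : 0 < y^-1 by rewrite invr_gt0.
  have := lebesgue_measure_scale y'0 mA; rewrite invrK => H.
  rewrite [X in (_ * X)%E = _]H muleA.
  rewrite -EFinM muleC; congr (_ * _%:E)%E; field; by rewrite gt_eqF.
- by apply/measurable_EFinP; exact: measurable_indic.
- by rewrite lee_fin invr_ge0 sqr_ge0.
Qed.

Lemma area_of_log (A : set (R * R)) : measurable A ->
  area A = leb2 (of_log @^-1` A).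
Proof.
move=> mA.
have mA' : measurable (of_log @^-1` A).
  by rewrite -[X in measurable X]setTI; apply: measurable_of_log.
have := @product_measure_unique _ _ _ _ _ leb leb 
  (@image_measure _ _ (measurableTypeR R * measurableTypeR R)%type
     (measurableTypeR R * measurableTypeR R)%type R area _ measurable_to_log).
move=> /(_ area_to_log_rect _ mA') ->.
rewrite /= /image_fun /= /weighted; congr integral.
apply/seteqP; split => z /= [] h z0; split => //; move: h; rewrite /= of_logK//.
Qed.

End area.

Lemma measurable_preimage d d' (T : measurableType d) (T' : measurableType d')
    (f : T -> T') (A : set T') :
  measurable_fun setT f -> measurable A -> measurable (f @^-1` A).
Proof. by move=> mf mA; rewrite -[X in measurable X]setTI; exact: mf. Qed.

Section area_invariance.
Variable R : realType.
Local Notation leb := (@lebesgue_measure R).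
Local Notation leb2 := (@lebesgue_measure R \x @lebesgue_measure R)%E.
Local Notation area := (@area R).

Lemma leb2_ysection (B : set (R * R)) : measurable B ->
  leb2 B = (\int[leb]_y leb (ysection B y))%E.
Proof.
move=> mB.
have := @product_measure_unique _ _ _ _ _ leb leb
  (product_measure2 leb leb : {measure set (measurableTypeR R * measurableTypeR R) -> \bar R}).
by move=> -> // A1 A2 mA1 mA2; exact: (@product_measure2E _ _ _ _ _ leb leb).
Qed.

Lemma leb2_shift1 (f : R -> R) (B : set (R * R)) : measurable_fun setT f -> measurable B ->
  leb2 [set q | B (q.1 + f q.2, q.2)] = leb2 B.
Proof.
move=> mf mB.
have mg : measurable_fun setT (fun q : R * R => (q.1 + f q.2, q.2)).
  apply: measurable_fun_pair; last exact: measurable_snd.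
  apply: measurable_funD; first exact: measurable_fst.
  by apply: measurableT_comp => //; exact: measurable_snd.
rewrite !leb2_ysection//; last exact: (measurable_preimage mg).
apply: eq_integral => y _.
rewrite -(@lebesgue_measure_shift _ (ysection B y) (f y)); last exact: measurable_ysection.
by congr (leb _); apply/seteqP; split => x; rewrite /ysection /= !inE.
Qed.

Lemma leb2_opp1 (B : set (R * R)) : measurable B ->
  leb2 [set q | B (- q.1, q.2)] = leb2 B.
Proof.
move=> mB.
have mg : measurable_fun setT (fun q : R * R => (- q.1, q.2)).
  apply: measurable_fun_pair; last exact: measurable_snd.
  by apply: measurableT_comp => //; exact: measurable_fst.
rewrite !leb2_ysection//; last exact: (measurable_preimage mg).
apply: eq_integral => y _.
rewrite -(@lebesgue_measure_opp _ (ysection B y)); last exact: measurable_ysection.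
by congr (leb _); apply/seteqP; split => x; rewrite /ysection /= !inE.
Qed.

Lemma leb2_shift2 (f : R -> R) (B : set (R * R)) : measurable_fun setT f -> measurable B ->
  leb2 [set q | B (q.1, q.2 + f q.1)] = leb2 B.
Proof.
move=> mf mB; rewrite /= /product_measure1; apply: eq_integral => x _ /=.
rewrite -(@lebesgue_measure_shift _ (xsection B x) (f x)); last exact: measurable_xsection.
by congr (leb _); apply/seteqP; split => y; rewrite /xsection /= !inE.
Qed.

Lemma leb2_opp2 (B : set (R * R)) : measurable B ->
  leb2 [set q | B (q.1, - q.2)] = leb2 B.
Proof.
move=> mB; rewrite /= /product_measure1; apply: eq_integral => x _ /=.
rewrite -(@lebesgue_measure_opp _ (xsection B x)); last exact: measurable_xsection.
by congr (leb _); apply/seteqP; split => y; rewrite /xsection /= !inE.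
Qed.

Lemma measurable_log_preimage (A : set (R * R)) : measurable A -> measurable (@of_log R @^-1` A).
Proof. by apply: measurable_preimage; exact: measurable_of_log. Qed.

Definition affine (a b : R) (z : R * R) : R * R := (a * z.1 + b, a * z.2).

Lemma measurable_affine a b : measurable_fun setT (affine a b).
Proof.
apply: measurable_fun_pair.
  by apply: measurable_funD => //; apply: measurable_funM => //; exact: measurable_fst.
by apply: measurable_funM => //; exact: measurable_snd.
Qed.

(** In logarithmic coordinates the map is a shear followed by a translation, (p, u) -> (p + (b / a)
    e^-u, u + ln a). *)
Lemma area_affine a b (A : set (R * R)) : 0 < a -> measurable A ->
  area (affine a b @^-1` A) = area A.
Proof.
move=> a0 mA.
have mAa := measurable_preimage (measurable_affine a b) mA.
apply: etrans (area_of_log mAa) _; apply: etrans _ (esym (area_of_log mA)).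
have mB := measurable_log_preimage mA.
apply: etrans _ (@leb2_shift2 (fun=> ln a) _ _ mB) => //.
have mg : measurable_fun setT (fun q : R * R => (q.1, q.2 + ln a)).
  apply: measurable_fun_pair; first exact: measurable_fst.
  by apply: measurable_funD => //; exact: measurable_snd.
have mB' := measurable_preimage mg mB.
have mexp : measurable_fun setT (fun u : R => b / a * expR (- u)).
  apply: measurable_funM => //; apply: measurableT_comp; first exact: measurable_expR.
  exact: oppr_measurable.
apply: etrans _ (leb2_shift1 mexp mB'); congr leb2.
have E (q : R * R) : affine a b (of_log q) =
     of_log (q.1 + b / a * expR (- q.2), q.2 + ln a).
  rewrite /affine /of_log /= expRD lnK ?posrE//; congr (_, _); last by rewrite mulrC.
  by rewrite expRN; field; rewrite !gt_eqF ?expR_gt0.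
by rewrite /preimage; apply/seteqP; split => q /=; rewrite E.
Qed.

Definition mirror (z : R * R) : R * R := (- z.1, z.2).

Lemma measurable_mirror : measurable_fun setT mirror.
Proof.
apply: measurable_fun_pair; last exact: measurable_snd.
by apply: measurableT_comp => //; exact: measurable_fst.
Qed.

Lemma area_mirror (A : set (R * R)) : measurable A ->
  area (mirror @^-1` A) = area A.
Proof.
move=> mA; have mAa := measurable_preimage measurable_mirror mA.
apply: etrans (area_of_log mAa) _; apply: etrans _ (esym (area_of_log mA)).
apply: etrans _ (leb2_opp1 (measurable_log_preimage mA)).
congr leb2; rewrite /preimage; apply/seteqP; split => q /=;
  by rewrite /mirror /of_log /= mulNr.
Qed.

Definition inversion (z : R * R) : R * R :=
  (z.1 / (z.1 ^+ 2 + z.2 ^+ 2), z.2 / (z.1 ^+ 2 + z.2 ^+ 2)).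

Lemma measurable_inversion : measurable_fun setT inversion.
Proof.
have mn : measurable_fun setT (fun z : R * R => (z.1 ^+ 2 + z.2 ^+ 2)^-1).
  apply: (measurableT_comp (@measurable_inv R)).
  by apply: measurable_funD; apply: measurable_funX;
    [exact: measurable_fst|exact: measurable_snd].
by apply: measurable_fun_pair; apply: measurable_funM.
Qed.

(** The squared norm of (p e^u, e^u) is e^(2u) (1 + p^2), so in logarithmic coordinates inversion is
    (p, u) -> (p, - u - ln (1 + p^2)). *)
Lemma area_inversion (A : set (R * R)) : measurable A ->
  area (inversion @^-1` A) = area A.
Proof.
move=> mA; have mAa := measurable_preimage measurable_inversion mA.
have mB := measurable_log_preimage mA.
apply: etrans (area_of_log mAa) _; apply: etrans _ (esym (area_of_log mA)).
apply: etrans _ (leb2_opp2 mB).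
have mg : measurable_fun setT (fun q : R * R => (q.1, - q.2)).
  apply: measurable_fun_pair; first exact: measurable_fst.
  by apply: measurableT_comp => //; exact: measurable_snd.
have mB' := measurable_preimage mg mB.
have mf : measurable_fun setT (fun p : R => ln (1 + p ^+ 2)).
  apply: measurableT_comp; first exact: measurable_ln.
  by apply: measurable_funD => //; exact: measurable_funX.
apply: etrans _ (leb2_shift2 mf mB'); congr leb2.
have E (q : R * R) : inversion (of_log q) = of_log (q.1, - (q.2 + ln (1 + q.1 ^+ 2))).
  have p1 : 0 < 1 + q.1 ^+ 2 by have := sqr_ge0 q.1; lra.
  have e0 : expR q.2 != 0 by rewrite gt_eqF ?expR_gt0.
  rewrite /inversion /of_log /= expRN expRD lnK ?posrE//.
  have -> : (q.1 * expR q.2) ^+ 2 + expR q.2 ^+ 2 = expR q.2 ^+ 2 * (1 + q.1 ^+ 2) by ring.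
  by congr (_, _); field; rewrite e0 gt_eqF.
by rewrite /preimage; apply/seteqP; split => q /=; rewrite E.
Qed.

Lemma refl1E : refl (@Ordinal 3 1 isT) =1 affine 1 2 \o mirror.
Proof. by move=> z; rewrite /refl /affine /mirror /= !mul1r addrC. Qed.

Lemma refl2E : refl (@Ordinal 3 2 isT) =1 affine 2^-1 2^-1 \o inversion \o affine 2 (-1).
Proof.
move=> z; rewrite /refl /affine /inversion /=.
have -> : (2 * z.1 + -1) ^+ 2 + (2 * z.2) ^+ 2 = 4 * dsq z by rewrite /dsq; field.
have -> : 2 * z.1 + -1 = 2 * (z.1 - 2^-1) by field.
congr (_, _); last by rewrite !mulrA mulVf ?mul1r.
by rewrite !mulrA mulVf ?mul1r// addrC.
Qed.

Lemma measurable_refl s : measurable_fun setT (@refl R s).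
Proof.
elim/ord3P: s.
- exact: measurable_mirror.
- rewrite (funext refl1E); apply: measurableT_comp; first exact: measurable_affine.
  exact: measurable_mirror.
rewrite (funext refl2E).
apply: measurableT_comp; last exact: measurable_affine.
apply: measurableT_comp; first exact: measurable_affine.
exact: measurable_inversion.
Qed.

Lemma area_refl s (A : set (R * R)) : measurable A -> area (@refl R s @^-1` A) = area A.
Proof.
move=> mA; elim/ord3P: s.
- exact: area_mirror.
- rewrite (funext refl1E) comp_preimage area_mirror ?area_affine//.
  exact: measurable_preimage (measurable_affine _ _) mA.
have m1 := measurable_preimage (measurable_affine 2^-1 2^-1) mA.
have m2 := measurable_preimage measurable_inversion m1.
by rewrite (funext refl2E) !comp_preimage area_affine// area_inversion// area_affine// invr_gt0.
Qed.

Lemma measurable_gam g : measurable_fun setT (@gam R g).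
Proof.
elim: g => [|s g IH]; first exact: measurable_id.
by apply: (measurableT_comp (measurable_refl s) IH).
Qed.

Lemma area_gam g (A : set (R * R)) : measurable A -> area (@gam R g @^-1` A) = area A.
Proof.
elim: g A => [|s g IH] A mA //.
rewrite (_ : gam (s :: g) @^-1` A = gam g @^-1` (refl s @^-1` A))//.
by rewrite IH ?area_refl//; exact: measurable_preimage (measurable_refl s) mA.
Qed.

End area_invariance.

(** * Area of thin annuli *)

Section shells.
Variable R : realType.
Local Notation leb := (@lebesgue_measure R).
Local Notation leb2 := (@lebesgue_measure R \x @lebesgue_measure R)%E.
Local Notation area := (@area R).

(** Each of the two intervals has length sqrt(a + b) - sqrt(a) <= sqrt(b), uniformly in a. *)
Lemma leb_square_shell (a b : R) (X : set R) : 0 <= b -> measurable X ->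
  X `<=` [set p | a <= p ^+ 2 <= a + b] -> (leb X <= (2 * Num.sqrt b)%:E)%E.
Proof.
move=> b0 mX sX.
pose r := Num.sqrt a; pose s := Num.sqrt (a + b).
have rs : s - r <= Num.sqrt b.
  have [a0|a0] := leP 0 a; last first.
    have -> : r = 0 by rewrite /r ltr0_sqrtr.
    by rewrite subr0 ler_wsqrtr//; lra.
  rewrite lerBlDr -[leRHS]ger0_norm ?addr_ge0 ?sqrtr_ge0// -sqrtr_sqr ler_wsqrtr//.
  rewrite sqrrD !sqr_sqrtr//.
  have : 0 <= Num.sqrt b * r *+ 2 by rewrite mulrn_wge0// mulr_ge0 ?sqrtr_ge0.
  lra.
have [r0 s0] : 0 <= r /\ 0 <= s by rewrite !sqrtr_ge0.
have sub : X `<=` `[- s, - r]%classic `|` `[r, s]%classic.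
  move=> p /sX /= /andP[h1 h2].
  have k1 : r <= `|p| by rewrite -sqrtr_sqr ler_wsqrtr.
  have k2 : `|p| <= s by rewrite -sqrtr_sqr ler_wsqrtr.
  rewrite !in_itv /=; have [p0|p0] := leP 0 p.
    by right; move: k1 k2; rewrite ger0_norm// => -> ->.
  by left; move: k1 k2; rewrite ltr0_norm// => k1 k2; apply/andP; split; lra.
have mI : measurable (`[- s, - r]%classic `|` `[r, s]%classic : set R).
  by apply: measurableU.
apply: (@le_trans _ _ (leb (`[- s, - r]%classic `|` `[r, s]%classic))).
  by apply: le_measure => //; rewrite inE.
apply: le_trans (measureU2 _ _ _) _ => //.
have E (x y c : R) : 0 <= c -> y - x <= c -> (leb `[x, y]%classic <= c%:E)%E.
  move=> c0 h; rewrite lebesgue_measure_itv /= lte_fin; case: ifP => _.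
    by rewrite -EFinB lee_fin.
  by rewrite lee_fin.
apply: le_trans (leeD (E _ _ (Num.sqrt b) _ _) (E _ _ (Num.sqrt b) _ _)) _; rewrite ?sqrtr_ge0//.
  by rewrite opprK addrC.
by rewrite -EFinD lee_fin; lra.
Qed.

Definition shell (z : R * R) (a b : R) : set (R * R) :=
  [set w | uhp w /\ a <= chdist z w <= b].

Lemma measurable_chdist (z : R * R) : measurable_fun setT (chdist z).
Proof.
apply: measurable_funD => //; apply: measurable_funM.
  apply: measurable_funD; apply: measurable_funX; exact: measurable_funB.
apply: (measurableT_comp (@measurable_inv R)).
by apply: measurable_funM => //; exact: measurable_snd.
Qed.

Lemma measurable_shell z a b : measurable (shell z a b).
Proof.
have -> : shell z a b = @upper_half_plane R `&` chdist z @^-1` `[a, b]%classic.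
  by apply/seteqP; split => w [? ?]; split => //=; rewrite ?in_itv//; move: H0; rewrite /= in_itv.
apply: measurableI; first exact: measurable_uhp.
by apply: (measurable_preimage (measurable_chdist z)).
Qed.

Lemma uhp_affine a b (w : R * R) : 0 < a -> uhp w -> uhp (affine a b w).
Proof. by move=> a0 w0; rewrite /uhp /affine /= mulr_gt0. Qed.

Lemma uhp_affineE a b (w : R * R) : 0 < a -> uhp (affine a b w) -> uhp w.
Proof. by move=> a0; rewrite /uhp /affine /= pmulr_rgt0. Qed.

Lemma chdist_affine a b (z w : R * R) : 0 < a -> chdist (affine a b z) (affine a b w) = chdist z w.
Proof.
move=> a0; rewrite /chdist /affine /=; congr (_ + _).
have -> : (a * z.1 + b - (a * w.1 + b)) ^+ 2 + (a * z.2 - a * w.2) ^+ 2 =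
   ((z.1 - w.1) ^+ 2 + (z.2 - w.2) ^+ 2) * a ^+ 2 by ring.
have -> : 2 * (a * z.2) * (a * w.2) = 2 * z.2 * w.2 * a ^+ 2 by ring.
by rewrite -mulf_div divff ?mulr1// sqrf_eq0 gt_eqF.
Qed.

Lemma hdist_affine a b (z w : R * R) : 0 < a -> hdist (affine a b z) (affine a b w) = hdist z w.
Proof. by move=> a0; rewrite /hdist chdist_affine. Qed.

Lemma area_shell_base a b z : uhp z -> area (shell z a b) = area (shell (0, 1) a b).
Proof.
move=> z0; rewrite -(@area_affine _ z.2 z.1)//; last exact: measurable_shell.
have E w : chdist z (affine z.2 z.1 w) = chdist (0, 1) w.
  have {1}-> : z = affine z.2 z.1 (0, 1).
    by rewrite /affine /= mulr0 add0r mulr1 -surjective_pairing.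
  exact: chdist_affine.
congr (area _); apply/seteqP; split => w [h1 h2]; split => /=.
- exact: uhp_affineE h1.
- by rewrite -E.
- exact: uhp_affine.
- by rewrite E.
Qed.

Lemma chdist_of_log (q : R * R) : chdist (0, 1) (of_log q) = ch q.2 + q.1 ^+ 2 * expR q.2 / 2.
Proof.
rewrite /chdist /of_log /ch /= expRN; field.
by rewrite gt_eqF ?expR_gt0.
Qed.

Lemma chN (u : R) : ch (- u) = ch u.
Proof. by rewrite /ch opprK addrC. Qed.

(** By transitivity the centre may be taken at (0, 1), where cosh of the distance to the point with
    coordinates (p, u) is cosh u + p^2 e^u / 2. Hence |u| <= U, and for fixed u the square p^2
    ranges over an interval of length 2 (b - a) e^-u. *)
Lemma area_shell (U a b : R) z : uhp z -> 0 <= U -> a <= b -> b <= ch U ->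
  (area (shell z a b) <= (4 * U * Num.sqrt (2 * expR U * (b - a)))%:E)%E.
Proof.
move=> z0 U0 ab bU; rewrite area_shell_base//.
have mS : measurable (shell (0, 1) a b) by exact: measurable_shell.
rewrite area_of_log//.
have mB := measurable_log_preimage mS.
rewrite leb2_ysection//.
pose c := 2 * Num.sqrt (2 * expR U * (b - a)).
have c0 : 0 <= c by rewrite mulr_ge0// sqrtr_ge0.
apply: (@le_trans _ _ (\int[leb]_u (c%:E * (\1_(`[- U, U]%classic : set R) u)%:E))%E).
  apply: ge0_le_integral => //.
  - exact: (measurable_fun_ysection (lebesgue_measure : {sigma_finite_measure set (measurableTypeR R) -> \bar R}) mB).
  - by apply: measurable_funeM; apply/measurable_EFinP; exact: measurable_indic.
  move=> u _; have [uU|uU] := boolP (u \in (`[- U, U]%classic : set R)); last first.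
    rewrite indicE (negbTE uU) mule0.
    have -> : ysection (@of_log R @^-1` shell (0, 1) a b) u = set0.
      rewrite -subset0 => p; rewrite /ysection /= inE /= => -[_].
      rewrite chdist_of_log /= => /andP[_ h].
      move/negP: uU; apply; rewrite inE /= in_itv /=.
      have hu : ch u <= ch U.
        apply: le_trans bU; apply: le_trans h; rewrite lerDl.
        by rewrite divr_ge0// mulr_ge0 ?sqr_ge0 ?expR_ge0.
      rewrite -ler_norml leNgt; apply/negP => uU.
      have := ch_lt U0 uU; have [u0|u0] := leP 0 u.
        by rewrite ger0_norm// ltNge hu.
      by rewrite ltr0_norm// chN ltNge hu.
    by rewrite measure0.
  rewrite indicE uU mule1.
  move: uU; rewrite inE /= in_itv /= => /andP[u1 u2].
  have e0 := expR_gt0 u.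
  apply: le_trans (@leb_square_shell (2 * (a - ch u) / expR u) (2 * (b - a) / expR u) _ _ _ _) _.
  - by rewrite divr_ge0 ?expR_ge0// mulr_ge0//; lra.
  - exact: measurable_ysection.
  - move=> p; rewrite /ysection /= inE /= => -[_]; rewrite chdist_of_log /= => /andP[h1 h2].
    rewrite ler_pdivrMr// -mulrDl ler_pdivlMr//.
    by apply/andP; split; lra.
  rewrite lee_fin /c ler_pM2l// ler_wsqrtr//.
  have -> : 2 * (b - a) / expR u = 2 * expR (- u) * (b - a) by rewrite expRN; ring.
  apply: ler_wpM2r; first lra.
  by rewrite ler_pM2l// ler_expR; lra.
rewrite ge0_integralZl//; last first.
  by apply/measurable_EFinP; exact: measurable_indic.
rewrite integral_indic// setIT.
have H : leb `[- U, U]%classic = (2 * U)%:E.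
  rewrite lebesgue_measure_itv /= lte_fin; case: ifP => h.
    by rewrite -EFinB; congr (_%:E); ring.
  by congr (_%:E); move: h => /negbT; rewrite -leNgt; lra.
rewrite [X in (_ * X)%E]H.
rewrite -EFinM lee_fin /c le_eqVlt; apply/orP; left; apply/eqP; ring.
Qed.

(** What matters later is smallness as r tends to 0, uniformly in the centre and in the radius s up
    to U; a square root of r provides it. *)
Lemma area_dshell (z : R * R) (s r U : R) (A : set (R * R)) : uhp z -> 0 <= r -> s + r <= U ->
  measurable A -> A `<=` [set w | uhp w /\ `|hdist z w - s| <= r] ->
  (area A <= (8 * `|U| * expR U * Num.sqrt r)%:E)%E.
Proof.
move=> z0 r0 sU mA sA.
have [sr|sr] := ltP (s + r) 0.
  have -> : A = set0.
    rewrite -subset0 => w /sA [w0]; rewrite ler_norml => /andP[_ h].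
    have := hdist_ge0 z0 w0; lra.
  by rewrite measure0 lee_fin !mulr_ge0// ?expR_ge0 ?sqrtr_ge0.
have U0 : 0 <= U by lra.
pose a0 := Num.max (s - r) 0; pose b0 := s + r.
have a00 : 0 <= a0 by rewrite le_max lexx orbT.
have ab : a0 <= b0 by rewrite /a0 ge_max; apply/andP; split => //; rewrite /b0; lra.
have ba : b0 - a0 <= 2 * r.
  by have : s - r <= a0 by [rewrite le_max lexx]; rewrite /b0; lra.
apply: (@le_trans _ _ (area (shell z (ch a0) (ch b0)))).
  apply: le_measure; rewrite ?inE//; first exact: measurable_shell.
  move=> w /sA [w0]; rewrite ler_norml => /andP[h1 h2]; split => //.
  have hd := hdist_ge0 z0 w0.
  rewrite -(ch_hdist z0 w0); apply/andP; split; apply: ch_le => //.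
    by rewrite ge_max hd andbT; lra.
  by rewrite /b0; lra.
apply: le_trans (area_shell z0 U0 _ _) _.
- exact: ch_le.
- by apply: ch_le.
rewrite lee_fin ger0_norm//.
have e0 := expR_gt0 U.
have : Num.sqrt (2 * expR U * (ch b0 - ch a0)) <= 2 * expR U * Num.sqrt r.
  rewrite -[leRHS]ger0_norm; last by rewrite !mulr_ge0 ?sqrtr_ge0// ltW.
  rewrite -sqrtr_sqr ler_wsqrtr// exprMn sqr_sqrtr//.
  have h1 := ch_diff_le a00 ab.
  have h2 : expR b0 <= expR U by rewrite ler_expR.
  have h3 := expR_gt0 b0.
  have h4 : ch b0 - ch a0 <= 2 * r * expR U.
    apply: le_trans h1 _; apply: ler_pM => //; lra.
  have -> : (2 * expR U) ^+ 2 * r = 2 * expR U * (2 * r * expR U) by ring.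
  by rewrite ler_pM2l// mulr_gt0.
move=> h; have -> : 8 * U * expR U * Num.sqrt r = 4 * U * (2 * expR U * Num.sqrt r) by ring.
by rewrite ler_wpM2l// mulr_ge0.
Qed.

End shells.

(** * Bits of a Poisson process *)

(* [None], [Some true] and [Some false] record zero, one and more points. *)
Definition bit_of_count (R : realType) (x : \bar R) : option bool :=
  if x == 0%E then None else if x == 1%E then Some true else Some false.

Definition bit (R : realType) (U : choiceType) (S : set U) : option bool :=
  bit_of_count (counting S : \bar R).

Definition bit_mass (R : realType) (m : R) (b : option bool) : R :=
  match b with
  | None => expR (- m)
  | Some true => m * expR (- m)
  | Some false => 1 - expR (- m) - m * expR (- m)
  end.

Section bits.
Variables (R : realType) (U : choiceType).
Implicit Types S : set U.

Lemma bit_set0 S : bit R S = None <-> S = set0.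
Proof.
rewrite /bit /bit_of_count /counting; case: asboolP => fS; last first.
  split => // S0; case: fS; rewrite S0; exact: finite_set0.
rewrite eqe pnatr_eq0 finmap.cardfs_eq0; case: eqVneq => [E|/eqP E].
  by split => // _; rewrite -[S](fset_setK fS) E set_fset0.
split; first by case: ifP.
by move=> S0; exfalso; apply: E; rewrite S0 fset_set0.
Qed.

Lemma bit_set1 S : bit R S = Some true <-> exists x, S = [set x].
Proof.
rewrite /bit /bit_of_count /counting; case: asboolP => fS; last first.
  split => // -[x Sx]; case: fS; rewrite Sx; exact: finite_set1.
rewrite !eqe pnatr_eq0 pnatr_eq1; split.
  case: ifP => // _; case: ifP => // /finmap.cardfs1P [x Ex] _.
  by exists x; rewrite -[S](fset_setK fS) Ex set_fset1.
by move=> [x ->]; rewrite fset_set1 finmap.cardfs1 eqxx.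
Qed.

End bits.

Section poisson_bits.
Context (R : realType) (d : measure_display) (W : measurableType d) (P : probability W R).
Context (dU : measure_display) (U : measurableType dU) (mu : set U -> \bar R) (Pi : W -> set U).
Hypothesis ppp : poisson_point_process P mu Pi.

Local Notation cell_bit A w := (bit R (Pi w `&` A)).

Lemma measurable_bit_pred (Q : pred (option bool)) :
  measurable [set x : \bar R | Q (bit_of_count x)].
Proof.
have -> : [set x : \bar R | Q (bit_of_count x)] =
   ([set x | Q None] `&` [set 0%E]) `|` (([set x | Q (Some true)] `&` [set 1%E]) `|`
     ([set x | Q (Some false)] `&` ~` [set 0%E; 1%E])).
  apply/seteqP; split => x /=; rewrite /bit_of_count.
    case: eqVneq => [->|/eqP x0]; first by left.
    by case: eqVneq => [->|/eqP x1]; right; [left|right; split => //; case].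
  case=> [[? ->]|]; first by rewrite eqxx.
  case=> [[? ->]|[? /not_orP [/eqP/negbTE -> /eqP/negbTE ->]]] //.
  by rewrite onee_eq0 eqxx.
have mc (b : bool) (A : set (\bar R)) : measurable A -> measurable ([set x | b] `&` A).
  move=> mA; case: b.
    by rewrite (_ : [set x | _] = setT) ?setTI//; apply/seteqP; split.
  by rewrite (_ : [set x | _] = set0) ?set0I//; apply/seteqP; split.
apply: measurableU; first exact: mc.
apply: measurableU; first exact: mc.
by apply: mc; apply: measurableC; apply: measurableU.
Qed.

Lemma measurable_cell_bit (A : set U) (Q : pred (option bool)) : measurable A ->
  measurable [set w | Q (cell_bit A w)].
Proof.
move=> mA; have [mc _ _ _] := ppp.
rewrite -[X in measurable X]setTI.
exact: (mc A mA measurableT _ (measurable_bit_pred Q)).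
Qed.

Lemma prob_cell_bit (A : set U) (m : R) (b : option bool) : measurable A -> mu A = m%:E ->
  P [set w | cell_bit A w == b] = (bit_mass m b)%:E.
Proof.
move=> mA muA; have [_ pmf _ _] := ppp.
have p0 : P [set w | cell_bit A w == None] = (expR (- m))%:E.
  have := pmf A m mA muA 0%N; rewrite expr0 fact0 div1r invr1 mul1r => <-.
  congr (P _); apply/seteqP; split => w /=; rewrite /bit /bit_of_count /point_count.
    by case: (eqVneq (counting _) 0%E) => // _; case: ifP.
  by move=> ->; rewrite eqxx.
have p1 : P [set w | cell_bit A w == Some true] = (m * expR (- m))%:E.
  have := pmf A m mA muA 1%N; rewrite expr1 divr1 => <-.
  congr (P _); apply/seteqP; split => w /=; rewrite /bit /bit_of_count /point_count.
    by case: (eqVneq (counting _) 0%E) => // _; case: (eqVneq (counting _) 1%E).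
  by move=> ->; rewrite onee_eq0 eqxx.
case: b => [[]|] //=.
have m0 : measurable [set w | cell_bit A w == None].
  exact: measurable_cell_bit (pred1 None) mA.
have m1 : measurable [set w | cell_bit A w == Some true].
  exact: measurable_cell_bit (pred1 (Some true)) mA.
have -> : [set w | cell_bit A w == Some false] =
   ~` ([set w | cell_bit A w == None] `|` [set w | cell_bit A w == Some true]).
  apply/seteqP; split => w /=; first by move=> /eqP -> [].
  by case: (bit _ _) => [[]|] // /not_orP [].
have pU : P ([set w | cell_bit A w == None] `|` [set w | cell_bit A w == Some true]) =
    (P [set w | cell_bit A w == None] + P [set w | cell_bit A w == Some true])%E.
  by apply: measureU => //; rewrite -subset0 => w /= [/eqP ->].
rewrite probability_setC; last exact: measurableU.
rewrite pU p0 p1; transitivity ((1 - (expR (- m) + m * expR (- m)))%:E); first by rewrite EFinB EFinD.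
by congr (_%:E); ring.
Qed.

Lemma prob_bits (I : finType) (A : I -> set U) (Q : I -> pred (option bool)) :
  (forall i, measurable (A i)) -> (forall i j, i != j -> A i `&` A j = set0) ->
  P [set w | forall i, Q i (cell_bit (A i) w)] =
  (\prod_(i : I) P [set w | Q i (cell_bit (A i) w)])%E.
Proof.
move=> mA dA; have [_ _ _ indep] := ppp.
have dA' (i j : 'I_#|I|) : i != j -> A (enum_val i) `&` A (enum_val j) = set0.
  by move=> ij; apply: dA; apply: contraNneq ij => /enum_val_inj ->.
have H := indep #|I| (fun k => A (enum_val k)) (fun k => mA _) dA' _
  (fun k => measurable_bit_pred (Q (enum_val k))).
transitivity (P [set w | forall i : 'I_#|I|, [set x | Q (enum_val i) (bit_of_count x)]
    (point_count R Pi (A (enum_val i)) w)]).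
  congr (P _); apply/seteqP; split => w /= h i; first exact: h.
  by have := h (enum_rank i); rewrite enum_rankK.
rewrite H [RHS](reindex_omap (@enum_val I predT) (fun i => Some (enum_rank i))) /=; last first.
  by move=> i _; rewrite enum_rankK.
by apply: eq_bigl => i; rewrite enum_valK eqxx.
Qed.

Lemma prob_bits_eq (I : finType) (A : I -> set U) (m : I -> R) (a : I -> option bool) :
  (forall i, measurable (A i)) -> (forall i j, i != j -> A i `&` A j = set0) ->
  (forall i, mu (A i) = (m i)%:E) ->
  P [set w | forall i, cell_bit (A i) w = a i] = (\prod_(i : I) bit_mass (m i) (a i))%:E.
Proof.
move=> mA dA muA; rewrite -prodEFin.
rewrite (eq_bigr (fun i => P [set w | pred1 (a i) (cell_bit (A i) w)])); last first.
  by move=> i _; symmetry; exact: (prob_cell_bit (a i) (mA i) (muA i)).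
have <- := prob_bits (fun i => pred1 (a i)) mA dA.
congr (P _); apply/seteqP; split => w h i; apply/eqP; exact: h.
Qed.

Lemma prob_occupied (A : set U) (m : R) : measurable A -> mu A = m%:E ->
  (P [set w | cell_bit A w != None] <= m%:E)%E.
Proof.
move=> mA muA.
have -> : [set w | cell_bit A w != None] = ~` [set w | cell_bit A w == None].
  by apply/seteqP; split => w /=; [move/negP|move/negP].
have m0 : measurable [set w | cell_bit A w == None].
  exact: measurable_cell_bit (pred1 None) mA.
rewrite probability_setC// (prob_cell_bit None mA muA).
rewrite -[leLHS]/((1 - expR (- m))%:E) lee_fin.
have := expR_ge1Dx (- m); lra.
Qed.

Lemma prob_crowded (A : set U) (m : R) : 0 <= m -> measurable A -> mu A = m%:E ->
  (P [set w | cell_bit A w == Some false] <= (m ^+ 2)%:E)%E.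
Proof.
move=> m0 mA muA; rewrite (prob_cell_bit _ mA muA) lee_fin /=.
have := expR_ge1Dx (- m); nra.
Qed.

Lemma prob_all_occupied (I : finType) (A : I -> set U) (m : I -> R) (s : seq I) :
  (forall i, measurable (A i)) -> (forall i j, i != j -> A i `&` A j = set0) ->
  (forall i, mu (A i) = (m i)%:E) -> uniq s ->
  (P [set w | forall i, i \in s -> cell_bit (A i) w != None] <= (\prod_(i <- s) m i)%:E)%E.
Proof.
move=> mA dA muA us.
pose Q i : pred (option bool) := fun b => (i \in s) ==> (b != None).
have -> : [set w | forall i, i \in s -> cell_bit (A i) w != None] =
   [set w | forall i, Q i (cell_bit (A i) w)].
  apply/seteqP; split => w /= h i; first by apply/implyP; exact: h.
  by move=> si; have := h i; rewrite /Q si.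
rewrite (prob_bits Q mA dA) -prodEFin.
rewrite [leRHS]big_uniq //= [leRHS]big_mkcond /=.
suff : (0 <= \prod_(i : I) P [set w | Q i (cell_bit (A i) w)] <=
    \prod_(i : I) (if i \in s then (m i)%:E else 1))%E by case/andP.
elim/big_ind2: _ => [|x1 x2 y1 y2 /andP[h1 h2] /andP[h3 h4]|i _].
- by rewrite lee01 lexx.
- by rewrite mule_ge0// lee_pmul.
rewrite measure_ge0 /= /Q; case: ifP => si /=; first exact: prob_occupied.
by apply: probability_le1; exact: measurable_cell_bit predT (mA i).
Qed.

End poisson_bits.

(** * Decreasing chains *)

Section chain_sum.
Variables (R : realType) (C : finType) (d : C -> C -> R) (m : C -> R) (delta : R).
Hypothesis m_ge0 : forall v, 0 <= m v.
Hypothesis delta_gt0 : 0 < delta.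
Hypothesis d_ge0 : forall u v, 0 <= d u v.

Fixpoint all_seqs (n : nat) : seq (seq C) :=
  if n is n'.+1 then [seq v :: p | v <- enum C, p <- all_seqs n'] else [:: [::]].

Lemma mem_all_seqs n (p : seq C) : size p = n -> p \in all_seqs n.
Proof.
elim: n p => [|n IH] [|v p] //= [sp].
by apply/allpairsP; exists (v, p); split => //=; [rewrite mem_enum|exact: IH].
Qed.

(** A product of masses bounds the probability that distinct cells are all occupied, so this sum
    dominates the probability of finding an occupied decreasing chain of distinct cells. *)
Definition chain_sum n u s : R :=
  \sum_(p <- all_seqs n | dec_chain d u s p) \prod_(v <- p) m v.

Lemma chain_sumS n u s :
  chain_sum n.+1 u s = \sum_(v | d u v < s) m v * chain_sum n v (d u v).
Proof.
rewrite /chain_sum /= big_mkcond big_allpairs_dep /= [RHS]big_mkcond big_enum /=.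
apply: eq_bigr => v _; case: ifP => duv; last first.
  by rewrite big1 // => p _; rewrite /= duv.
rewrite [in RHS]big_mkcond mulr_sumr; apply: eq_bigr => p _.
rewrite /=; case: ifP => _; rewrite ?mulr0//.
by rewrite big_cons.
Qed.

(** The power 2^k acts as a potential, k being the number of shells of width [delta] below the
    current distance. A step into shell j has mass at most 1/4 and leaves at most j + 1 shells, and
    the sum of 2^(j+1) / 4 over j < k is at most 2^k / 2: each step gains a factor 1/2. *)
Lemma chain_sum_le (N n k : nat) u s : (k <= N)%N -> s <= k%:R * delta ->
  (forall (j : nat) u, (j < N)%N ->
     \sum_(v | j%:R * delta <= d u v < j.+1%:R * delta) m v <= 4^-1) ->
  chain_sum n u s <= 2 ^+ k / 2 ^+ n.
Proof.
move=> kN + shell; elim: n k u s kN => [|n IH] k u s kN sk.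
  rewrite /chain_sum /= big_mkcond big_seq1 /= big_nil expr0 divr1.
  by rewrite -natrX ler1n expn_gt0.
rewrite chain_sumS.
have step v : d u v < s -> m v * chain_sum n v (d u v) <=
    \sum_(j < k) (if j%:R * delta <= d u v < j.+1%:R * delta then m v * (2 ^+ j.+1 / 2 ^+ n) else 0).
  move=> duv.
  pose j := Num.truncn (d u v / delta).
  have /andP[j1 j2] : j%:R <= d u v / delta < j.+1%:R.
    by rewrite truncn_itv// divr_ge0// ltW.
  rewrite ler_pdivlMr// in j1; rewrite ltr_pdivrMr// in j2.
  have jk : (j < k)%N.
    rewrite -(ltr_nat R) -(ltr_pM2r delta_gt0); lra.
  rewrite (bigD1 (Ordinal jk)) //= j1 j2 /=.
  apply: ler_wpDr.
    apply: sumr_ge0 => i _; case: ifP => // _.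
    by rewrite mulr_ge0// divr_ge0// exprn_ge0.
  by apply: ler_wpM2l => //; apply: IH; [exact: leq_trans jk kN|exact: ltW].
apply: (@le_trans _ _ (\sum_(v | d u v < s) \sum_(j < k)
   (if j%:R * delta <= d u v < j.+1%:R * delta then m v * (2 ^+ j.+1 / 2 ^+ n) else 0))).
  exact: ler_sum.
rewrite exchange_big /=.
apply: (@le_trans _ _ (\sum_(j < k) (4^-1 * (2 ^+ j.+1 / 2 ^+ n)))).
  apply: ler_sum => j _; rewrite -big_mkcondr -mulr_suml.
  apply: ler_wpM2r; first by rewrite divr_ge0// exprn_ge0.
  apply: le_trans (shell j u (leq_trans (ltn_ord j) kN)).
  rewrite [leLHS]big_mkcond [leRHS]big_mkcond; apply: ler_sum => v _.
  by case: (d u v < s) => //=; case: ifP.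
rewrite -mulr_sumr -mulr_suml.
have -> : \sum_(j < k) 2 ^+ j.+1 = 2 ^+ k.+1 - 2 :> R.
  elim: (k) => [|i E]; first by rewrite big_ord0 expr1 subrr.
  by rewrite big_ord_recr /= E [in RHS]exprS; ring.
have p0 : 0 < 2 ^+ n :> R by rewrite exprn_gt0.
have q0 : 0 < 2 ^+ k :> R by rewrite exprn_gt0.
rewrite mulrA [2 ^+ n.+1]exprS invfM mulrA; apply: ler_wpM2r; first by rewrite invr_ge0 ltW.
rewrite exprS; lra.
Qed.

End chain_sum.

(** * Cells *)

Section cells.
Variables (R : realType) (y0 h : R) (a b : nat).
Implicit Types (z w : R * R) (g : word).

Definition cell_index := ('I_a * 'I_b * bool)%type.

(* The boolean component separates the points of [kset] from the other ones. *)
Definition cell (c : cell_index) : set (R * R) :=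
  [set z | [/\ triangle z, (c.1.1)%:R * h <= z.1 < c.1.1.+1%:R * h,
     y0 + c.1.2%:R * h <= z.2 < y0 + c.1.2.+1%:R * h & kset z <-> c.2]].

Definition gcell g (c : cell_index) : set (R * R) :=
  [set x | uhp x /\ cell c (gam (rev g) x)].

Lemma measurable_ltr_set (f k : R * R -> R) : measurable_fun setT f -> measurable_fun setT k ->
  measurable [set z | f z < k z].
Proof.
move=> mf mk; have := measurable_fun_ltr mf mk.
move=> /(_ measurableT [set true] _); rewrite setTI => H.
have -> : [set z | f z < k z] = (fun z => f z < k z) @^-1` [set true] by apply/seteqP; split.
exact: H.
Qed.

Lemma measurable_ler_set (f k : R * R -> R) : measurable_fun setT f -> measurable_fun setT k ->
  measurable [set z | f z <= k z].
Proof.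
move=> mf mk; have := measurable_fun_ler mf mk.
move=> /(_ measurableT [set true] _); rewrite setTI => H.
have -> : [set z | f z <= k z] = (fun z => f z <= k z) @^-1` [set true] by apply/seteqP; split.
exact: H.
Qed.

Let m1 : measurable_fun setT (fst : R * R -> R) := measurable_fst.
Let m2 : measurable_fun setT (snd : R * R -> R) := measurable_snd.

Lemma measurable_dsq : measurable_fun setT (@dsq R).
Proof. by apply: measurable_funD; apply: measurable_funX => //; exact: measurable_funB. Qed.

Lemma measurable_triangle : measurable [set z : R * R | triangle z].
Proof.
have -> : [set z : R * R | triangle z] = [set z | 0 < z.2] `&` ([set z | 0 < z.1] `&`
    ([set z | z.1 < 1] `&` [set z | 4^-1 < dsq z])).
  by apply/seteqP; split => z; [case|move=> [? [? [? ?]]]].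
by do ?apply: measurableI; apply: measurable_ltr_set => //; exact: measurable_dsq.
Qed.

Lemma measurable_kset : measurable [set z : R * R | kset z].
Proof.
have -> : [set z : R * R | kset z] = [set z | 4^-1 <= z.1] `&` ([set z | z.1 < 3 / 4] `&`
    ([set z | 1 <= z.2] `&` [set z | z.2 < 2])).
  by apply/seteqP; split => z; [case|move=> [? [? [? ?]]]].
by do ?apply: measurableI; do ?[apply: measurable_ltr_set|apply: measurable_ler_set].
Qed.

Lemma measurable_cell c : measurable (cell c).
Proof.
have -> : cell c = [set z : R * R | triangle z] `&` (([set z | (c.1.1)%:R * h <= z.1] `&`
   [set z | z.1 < c.1.1.+1%:R * h]) `&` (([set z | y0 + c.1.2%:R * h <= z.2] `&`
   [set z | z.2 < y0 + c.1.2.+1%:R * h]) `&`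
   (if c.2 then [set z : R * R | kset z] else ~` [set z : R * R | kset z]))).
  apply/seteqP; split => z.
    move=> [h1 /andP[h2 h3] /andP[h4 h5] h6]; split => //; split; split => //.
    by case: (c.2) h6 => h6; [apply/h6|move/h6].
  move=> [h1 [[h2 h3] [[h4 h5] h6]]]; split => //; try by apply/andP; split.
  by case: (c.2) h6 => /= h6; split.
apply: measurableI; first exact: measurable_triangle.
apply: measurableI.
  by apply: measurableI; [apply: measurable_ler_set|apply: measurable_ltr_set].
apply: measurableI.
  by apply: measurableI; [apply: measurable_ler_set|apply: measurable_ltr_set].
by case: ifP => _; [|apply: measurableC]; exact: measurable_kset.
Qed.

Lemma measurable_gcell g c : measurable (gcell g c).
Proof.
apply: measurableI; first exact: measurable_uhp.
exact: (measurable_preimage (@measurable_gam R (rev g)) (measurable_cell c)).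
Qed.

Lemma area_gcell g c : area R (gcell g c) = area R (cell c).
Proof.
rewrite -(area_gam (rev g) (measurable_cell c)) /= /weighted; congr integral.
by apply/seteqP; split => z; [move=> [[? ?] ?]; split|move=> [? ?]; split].
Qed.

Lemma grid_inj (i j : nat) (x : R) : 0 < h -> i%:R * h <= x < i.+1%:R * h ->
  j%:R * h <= x < j.+1%:R * h -> i = j.
Proof.
move=> h0 /andP[a1 a2] /andP[b1 b2].
have ij : (i < j.+1)%N by rewrite -(ltr_nat R) -(ltr_pM2r h0); apply: le_lt_trans a1 b2.
have ji : (j < i.+1)%N by rewrite -(ltr_nat R) -(ltr_pM2r h0); apply: le_lt_trans b1 a2.
by apply/eqP; rewrite eqn_leq; apply/andP; split.
Qed.

Lemma cell_inj c c' z : 0 < h -> cell c z -> cell c' z -> c = c'.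
Proof.
case: c => [[i j] k]; case: c' => [[i' j'] k'] h0 [/= _ h1 h2 h3] [/= _ g1 g2 g3].
have -> : i = i' by apply: val_inj; exact: grid_inj h1 g1.
have -> : j = j'.
  apply/val_inj/(@grid_inj _ _ (z.2 - y0)) => //.
    by case/andP: h2 => ? ?; apply/andP; split; lra.
  by case/andP: g2 => ? ?; apply/andP; split; lra.
congr (_, _); have [[a1 a2] [b1 b2]] := (h3, g3).
by case: (k) a1 a2 => a1 a2; case: (k') b1 b2 => b1 b2 //; [apply/esym/b1/a2|apply/a1/b2].
Qed.

Lemma cell_diam eta c z w : 0 < y0 -> 0 < h -> 0 <= eta -> 1 + h ^+ 2 / y0 ^+ 2 <= ch eta ->
  cell c z -> cell c w -> hdist z w <= eta.
Proof.
move=> y00 h0 e0 he [tz /andP[a1 a2] /andP[b1 b2] _] [tw /andP[c1 c2] /andP[d1 d2] _].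
have uz : uhp z by case: tz.
have uw : uhp w by case: tw.
rewrite hdist_le//; apply: le_trans he; rewrite /chdist lerD2l.
have j0 : 0 <= c.1.2%:R * h by rewrite mulr_ge0// ltW.
have zy : y0 <= z.2 by lra.
have wy : y0 <= w.2 by lra.
have i1 : (c.1.1).+1%:R * h = (c.1.1)%:R * h + h by rewrite -natr1 mulrDl mul1r.
have j1 : (c.1.2).+1%:R * h = (c.1.2)%:R * h + h by rewrite -natr1 mulrDl mul1r.
rewrite i1 in a2 c2; rewrite j1 in b2 d2.
have s1 : (z.1 - w.1) ^+ 2 <= h ^+ 2.
  by rewrite -[leLHS]real_normK ?num_real// lerXn2r ?nnegrE// ?ltW// ltr_norml; apply/andP; split; lra.
have s2 : (z.2 - w.2) ^+ 2 <= h ^+ 2.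
  by rewrite -[leLHS]real_normK ?num_real// lerXn2r ?nnegrE// ?ltW// ltr_norml; apply/andP; split; lra.
have -> : h ^+ 2 / y0 ^+ 2 = (h ^+ 2 + h ^+ 2) / (2 * y0 * y0) by field; rewrite gt_eqF.
apply: ler_pM.
- by rewrite addr_ge0 ?sqr_ge0.
- by rewrite invr_ge0 !mulr_ge0// ltW.
- exact: lerD.
- rewrite lef_pV2 ?posrE; last 2 first.
  + by rewrite !mulr_gt0.
  + by rewrite !mulr_gt0.
  rewrite -!mulrA ler_pM2l//; apply: ler_pM => //; exact: ltW.
Qed.

Lemma cell_cover z : triangle z -> 0 < h -> 1 <= a%:R * h -> y0 <= z.2 ->
  z.2 < y0 + b%:R * h -> exists c, cell c z /\ (kset z <-> c.2).
Proof.
move=> tz h0 ah yz zb; have [_ x0 x1 _] := tz.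
have it (x : R) (n : nat) : 0 <= x -> x < n%:R * h ->
    exists i : 'I_n, i%:R * h <= x < i.+1%:R * h.
  move=> xx xn; pose i := Num.truncn (x / h).
  have /andP[i1 i2] : i%:R <= x / h < i.+1%:R by rewrite truncn_itv// divr_ge0// ltW.
  have lt : (i < n)%N.
    by rewrite -(ltr_nat R); apply: le_lt_trans i1 _; rewrite ltr_pdivrMr.
  by exists (Ordinal lt) => /=; rewrite -ler_pdivlMr// -ltr_pdivrMr// i1.
have [i hi] := it z.1 a (ltW x0) (lt_le_trans x1 ah).
have [||j hj] := it (z.2 - y0) b; [lra|lra|].
exists ((i, j), `[< kset z >]); split; last by split => /asboolP.
split => //=; last by split => /asboolP.
by move: hj; rewrite lerBDl ltrBlDl.
Qed.

Lemma gcell_inj g g' c c' x : 0 < h -> reduced g -> reduced g' ->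
  gcell g c x -> gcell g' c' x -> g = g' /\ c = c'.
Proof.
move=> h0 rg rg' [ux cx] [_ c'x].
have [[t1 _ _ _] [t2 _ _ _]] := (cx, c'x).
have E : gam g (gam (rev g) x) = gam g' (gam (rev g') x) by rewrite !gamK.
have gg := tiles_disjoint rg rg' t1 t2 E; subst g'; split => //.
exact: cell_inj cx c'x.
Qed.

Lemma gcell_diam eta g c x y : 0 < y0 -> 0 < h -> 0 <= eta -> 1 + h ^+ 2 / y0 ^+ 2 <= ch eta ->
  gcell g c x -> gcell g c y -> hdist x y <= eta.
Proof.
move=> y00 h0 e0 he [ux cx] [uy cy].
by rewrite -(hdist_gam (rev g))//; apply: cell_diam cx cy.
Qed.

End cells.

(** * The finitely many cells that meet a ball *)

Section window.
Variable R : realType.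
Implicit Types (z w x : R * R) (g : word).

Definition origin : R * R := (2^-1, 1).

Lemma kset_origin : kset origin.
Proof. by rewrite /kset /origin /=; split; lra. Qed.

Lemma uhp_origin : uhp origin.
Proof. exact: kset_uhp kset_origin. Qed.

(* The complement of the geodesics bounding the tiles *)
Definition inner x := exists g z, [/\ reduced g, triangle z & x = gam g z].

Lemma inner_uhp x : inner x -> uhp x.
Proof. by move=> [g [z [_ [z0 _ _ _] ->]]]; apply: gam_uhp. Qed.

Lemma closed_triangle_not_beyond s z : closed_triangle z -> ~ beyond s z.
Proof. by case=> z0 h1 h2 h3; rewrite /beyond; elim/ord3P: s => /=; lra. Qed.

(** If [x] lies in the tile of [k], a word [g] bringing [x] into the closed triangle must satisfy
    [lmul g k] = [[::]]: otherwise the image would lie beyond a side. So the length of [g] bounds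
    that of the tile containing [x]. *)
Lemma inner_cover x g : inner x -> closed_triangle (gam g x) ->
  exists g' z, [/\ reduced g', (size g' <= size g)%N, triangle z & x = gam g' z].
Proof.
move=> [k [z [rk tz xz]]] ct.
have uz : uhp z by case: tz.
have ux : uhp x by rewrite xz; apply: gam_uhp.
have E : gam (lmul g k) z = gam g x by rewrite gam_lmul// xz.
have nil : lmul g k = [::].
  have := reduced_lmul g rk; case: (lmul g k) E => // s l E rl.
  by case: (@closed_triangle_not_beyond s (gam g x)) => //; rewrite -E; apply: gam_beyond.
exists (lmul (rev g) [::]), z; split => //.
- exact: reduced_lmul.
- by apply: leq_trans (size_lmul _ _) _; rewrite size_rev addn0.
rewrite gam_lmul//= -[z in RHS]/(gam [::] z) -nil E gam_revK//.
Qed.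

Lemma ball_box (L : R) x : 0 <= L -> uhp x -> hdist (0, 1) x <= L ->
  (2 * ch L)^-1 <= x.2 /\ x.2 <= 2 * ch L /\ `|x.1| <= 2 * ch L.
Proof.
move=> L0 ux; have u1 : uhp (0 : R, 1) by rewrite /uhp /=.
rewrite hdist_le// /chdist /= => hc.
have x20 : x.2 != 0 by rewrite gt_eqF.
have c1 := ch_ge1 L.
have E : 1 + ((0 - x.1) ^+ 2 + (1 - x.2) ^+ 2) / (2 * 1 * x.2) =
   (x.1 ^+ 2 + x.2 ^+ 2 + 1) / (2 * x.2) by field.
rewrite E ler_pdivrMr in hc; last by rewrite mulr_gt0.
move: c1 hc; move: (ch L) => c c1 hc.
have x0 : 0 < x.2 := ux.
have s1 := sqr_ge0 x.1; have s2 := sqr_ge0 x.2.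
have hy : x.2 <= 2 * c by rewrite -(ler_pM2r x0); lra.
split; last split => //.
  by rewrite -[leLHS]mul1r ler_pdivrMr; [lra|lra].
have : `|x.1| ^+ 2 <= (2 * c) ^+ 2.
  rewrite real_normK ?num_real//; nra.
by rewrite (@ler_pXn2r _ 2)// ?nnegrE; lra.
Qed.

Lemma window_exists (L eta : R) : 0 < eta ->
  exists (y0 h : R) (a b M : nat), [/\ 0 < y0, 0 < h, 1 + h ^+ 2 / y0 ^+ 2 <= ch eta &
    forall x, inner x -> hdist origin x <= L ->
      exists g (c : cell_index a b), [/\ reduced g, (size g <= M)%N & gcell y0 h g c x]].
Proof.
move=> e0.
have u1 : uhp (0 : R, 1) by rewrite /uhp /=.
have uo := uhp_origin.
pose L0 := Num.max L 0; have L00 : 0 <= L0 by rewrite le_max lexx orbT.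
pose L1 := hdist (0, 1) origin + L0.
have L10 : 0 <= L1 by rewrite addr_ge0// hdist_ge0.
have box1 x : inner x -> hdist origin x <= L -> hdist (0, 1) x <= L1.
  move=> ix hx; apply: le_trans (hdist_triangle uo u1 (inner_uhp ix)) _.
  by rewrite lerD2l /L0 le_max hx.
have y10 : 0 < (2 * ch L1)^-1 by rewrite invr_gt0; have := ch_ge1 L1; lra.
have [M HM] := cover_box (2 * ch L1) y10.
have lg : 0 <= ln (golden R) by apply: ln_ge0; have := golden_gt1 R; lra.
pose D := disp_const R + 2 * M%:R * ln (golden R).
(* [L1] bounds the given points and [L2] their images in the triangle, [D] being the displacement of
   the origin by words of length at most [M]. *)
pose L2 := Num.max 0 (hdist (0, 1) origin + (D + L0)).
have L20 : 0 <= L2 by rewrite le_max lexx.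
have c2 := ch_ge1 L2.
pose y0 := (2 * ch L2)^-1.
have y00 : 0 < y0 by rewrite invr_gt0; lra.
have ce : 0 < ch eta - 1.
  by have := ch_lt (lexx 0) e0; rewrite /ch oppr0 expR0; lra.
(* This makes 1 + h^2 / y0^2 equal to cosh eta; the [a] columns below cover the width of the
   triangle and the [b] rows its heights up to [2 * ch L2]. *)
pose h := y0 * Num.sqrt (ch eta - 1).
have h0 : 0 < h by rewrite mulr_gt0// sqrtr_gt0.
pose a := (Num.truncn h^-1).+1; pose b := (Num.truncn (2 * ch L2 / h)).+1.
exists y0, h, a, b, M; split => //.
  rewrite /h exprMn sqr_sqrtr; last exact: ltW.
  by rewrite mulrAC divff ?mul1r ?expf_neq0 ?gt_eqF//; lra.
move=> x ix hx.
have ux := inner_uhp ix.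
have [b1 [b2 b3]] := ball_box L10 ux (box1 _ ix hx).
have [g gM ct] := HM _ b1 b3.
have [g' [z [rg' sg' tz xz]]] := inner_cover ix ct.
have uz : uhp z by case: tz.
have zx : z = gam (rev g') x by rewrite xz gam_revK.
have hz : hdist (0, 1) z <= L2.
  apply: le_trans (hdist_triangle uo u1 uz) _.
  rewrite le_max; apply/orP; right; rewrite lerD2l.
  apply: le_trans (hdist_triangle (gam_uhp (rev g') uo) uo uz) _.
  rewrite zx hdist_gam//; apply: lerD; last by rewrite /L0 le_max hx.
  apply: le_trans (@hdist_gam_kset _ [::] (rev g') _ _ kset_origin kset_origin) _.
  rewrite /D lerD2l size_rev add0n; apply: ler_wpM2r => //.
  by rewrite ler_pM2l// ler_nat (leq_trans sg').
have [z1 [z2 _]] := ball_box L20 uz hz.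
have [|||c [cz _]] := @cell_cover _ y0 h a b z tz h0 => //.
- by rewrite -ler_pdivrMr// div1r; apply/ltW/truncnS_gt.
- have : 2 * ch L2 / h < b%:R by apply: truncnS_gt.
  by rewrite ltr_pdivrMr//; lra.
exists g', c; split => //; first exact: leq_trans gM.
by split => //; rewrite -zx.
Qed.

Lemma gcell_kset (y0 h : R) (a b : nat) g (c : cell_index a b) x :
  reduced g -> kset x -> gcell y0 h g c x -> g = [::] /\ c.2.
Proof.
move=> rg kx [ux cx].
have [t1 _ _ k1] := cx.
have E : gam g (gam (rev g) x) = gam [::] x by rewrite gamK.
have g0 := @tiles_disjoint _ g [::] _ _ rg isT t1 (kset_triangle kx) E; split => //.
by apply/k1; rewrite g0.
Qed.

End window.

(** * Stability of the balloon process *)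

Section stability.
Variables (R : realType) (y0 h eta : R) (a b M n : nat) (t : R).
Implicit Types (x y z : R * R) (g : word) (S : set (R * R)) (T : R * R -> \bar R).

Local Notation cidx := (cell_index a b).
Local Notation gc := (gcell y0 h).

Definition cell_bits : Type := {ffun cidx -> option bool}.
Definition bits_of S : word -> cell_bits := fun g => [ffun c => bit R (S `&` gc g c)].

Definition window := (seq_sub (ball3 M) * cidx)%type.
(** Empty cells get the default [origin], so that every representative lies in the half-plane and
    the triangle inequality always applies. *)
Definition rep_cell (c : cidx) : R * R := xget (origin R) (cell y0 h c).
Definition rep (v : window) : R * R := gam (val v.1) (rep_cell v.2).
Definition rdist (u v : window) : R := hdist (rep u) (rep v).
(* A chain of [n.+1] steps of length at most [2 * t + 1] starting in [kset] stays
   within [start_radius] of the origin. *)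
Definition start_radius : R := disp_const R + 1 + n.+1%:R * (2 * t + 1).
(** A point of level at most [start_radius] that pops by time [t] has its partner within [2 * t];
    the last unit absorbs the cell errors. *)
Definition radius : R := start_radius + 2 * t + 1.
Definition near_origin (v : window) : bool := hdist (origin R) (rep v) <= radius + eta.
Definition wbit (xi : word -> cell_bits) (v : window) : option bool := xi (val v.1) v.2.
Definition occupied (xi : word -> cell_bits) (v : window) : bool :=
  near_origin v && (wbit xi v == Some true).
Definition start (v : window) : bool := (val v.1 == [::]) && v.2.2.

(** No crowded cell, no near tie and no long decreasing chain from [kset]. The threshold [4 * eta]
    is twice the error [2 * eta] made on a distance when both points are replaced by
    representatives. *)
Definition good (xi : word -> cell_bits) : Prop :=
  [/\ forall v, near_origin v -> wbit xi v <> Some false,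
      forall u v w, occupied xi u -> occupied xi v -> occupied xi w ->
        u != v -> v != w -> u != w -> 4 * eta < `|rdist u v - rdist v w|
    & forall v p, start v -> size p = n.+1 -> all (occupied xi) (v :: p) -> uniq (v :: p) ->
        dec_chain rdist v (2 * t + 1) p -> False].

Hypotheses (y0_gt0 : 0 < y0) (h_gt0 : 0 < h) (eta_ge0 : 0 <= eta) (eta_le : 2 * eta <= 1).
Hypothesis fine : 1 + h ^+ 2 / y0 ^+ 2 <= ch eta.
Hypothesis t_ge0 : 0 <= t.
Hypothesis cover : forall x, inner x -> hdist (origin R) x <= radius ->
  exists g (c : cidx), [/\ reduced g, (size g <= M)%N & gc g c x].

Lemma uhp_rep v : uhp (rep v).
Proof.
apply: gam_uhp; rewrite /rep_cell; case: xgetP => [z _ [[z0 _ _ _] _ _ _]//|_].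
exact: uhp_origin.
Qed.

Lemma rep_near v x : gc (val v.1) v.2 x -> hdist x (rep v) <= eta.
Proof.
move=> xv; have [ux cx] := xv.
have ne : cell y0 h v.2 (rep_cell v.2).
  rewrite /rep_cell; case: xgetP => [z -> //|no]; case: (no _ cx).
have [[uz _ _ _] _ _ _] := ne.
apply: (gcell_diam y0_gt0 h_gt0 eta_ge0 fine xv); split; first exact: uhp_rep.
by rewrite /rep gam_revK.
Qed.

Lemma window_reduced (v : window) : reduced (val v.1) /\ (size (val v.1) <= M)%N.
Proof. by have := valP v.1; rewrite mem_ball3 => /andP. Qed.

Lemma gcell_window g c x : reduced g -> (size g <= M)%N -> gc g c x ->
  exists v : window, gc (val v.1) v.2 x /\ (g = val v.1 /\ c = v.2).
Proof.
move=> rg sg gx; have gM : g \in ball3 M by rewrite mem_ball3 rg.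
by exists (SeqSub gM, c).
Qed.

Definition point_in S (v : window) : R * R := xget (origin R) (S `&` gc (val v.1) v.2).

Lemma occupied_point S v : occupied (bits_of S) v ->
  S `&` gc (val v.1) v.2 = [set point_in S v].
Proof.
move=> /andP[_]; rewrite /wbit ffunE => /eqP /bit_set1 [x Sx].
by rewrite /point_in Sx; congr [set _]; case: xgetP => [y _ ->//|/(_ x) []].
Qed.

Lemma good_point S x : good (bits_of S) -> S `<=` [set x | inner x] -> S x ->
  hdist (origin R) x <= radius -> exists v, occupied (bits_of S) v /\ x = point_in S v.
Proof.
move=> [nf _ _] Si Sx hx.
have [g [c [rg sg gx]]] := cover (Si _ Sx) hx.
have [v [vx _]] := gcell_window rg sg gx.
have ov : occupied (bits_of S) v.
  have nv : near_origin v.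
    have ux := inner_uhp (Si _ Sx).
    apply: le_trans (hdist_triangle ux (uhp_origin R) (uhp_rep v)) _.
    by apply: lerD => //; exact: rep_near.
  rewrite /occupied nv /=; have := nf v nv; rewrite /wbit ffunE.
  case E: (bit _ _) => [[]|] // _.
  by move/bit_set0: E => E; have : (S `&` gc (val v.1) v.2) x by []; rewrite E.
exists v; split => //.
have : (S `&` gc (val v.1) v.2) x by [].
by rewrite (occupied_point ov).
Qed.

Lemma hdist_rdist u v x y : gc (val u.1) u.2 x -> gc (val v.1) v.2 y ->
  `|hdist x y - rdist u v| <= 2 * eta.
Proof.
move=> ux vy; have [x0 _] := ux; have [yy0 _] := vy.
have r1 := rep_near ux; have r2 := rep_near vy.
have u0 := uhp_rep u; have v0 := uhp_rep v.
have h1 := hdist_triangle u0 x0 yy0.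
have h2 := hdist_triangle v0 u0 yy0.
have h3 := hdist_triangle x0 u0 v0.
have h4 := hdist_triangle yy0 x0 v0.
rewrite (hdist_sym (rep v) y) in h2; rewrite (hdist_sym (rep u) x) in h3.
rewrite /rdist ler_norml; apply/andP; split; lra.
Qed.

(** Good bits place exactly one point in each occupied cell near the origin, which matches the
    points of the two configurations and allows [status_stable] to be applied with error [2 * eta].
    The surviving centre stays in [kset] because no cell straddles its boundary. *)
Theorem stable S T S' T' x :
  S `<=` [set x | inner x] -> S' `<=` [set x | inner x] ->
  popping_times (@hdist R) S T -> popping_times (@hdist R) S' T' ->
  (forall g, reduced g -> (size g <= M)%N -> bits_of S g = bits_of S' g) ->
  good (bits_of S) -> S x -> kset x -> (t%:E < T x)%E ->
  exists x', [/\ S' x', kset x' & ((t - 1)%:E < T' x')%E].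
Proof.
move=> Si Si' pT pT' SS' gS Sx kx Tx.
pose SS (k : bool) := if k then S else S'.
pose TT (k : bool) := if k then T else T'.
have SSi k : SS k `<=` [set x | inner x] by case: k.
have pTT k : popping_times (@hdist R) (SS k) (TT k) by case: k.
have bE k g : reduced g -> (size g <= M)%N -> bits_of (SS k) g = bits_of S g.
  by case: k => // rg sg; rewrite SS'.
have occE k v : occupied (bits_of (SS k)) v = occupied (bits_of S) v.
  by rewrite /occupied /wbit; have [rg sg] := window_reduced v; rewrite bE.
have gSS k : good (bits_of (SS k)).
  have [g1 g2 g3] := gS; split.
  - by move=> v nv; rewrite /wbit; have [rg sg] := window_reduced v; rewrite bE//; exact: g1.
  - by move=> u v w; rewrite !occE; exact: g2.
  - move=> v p sv sp ap; apply: (g3 v p sv sp).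
    by apply/allP => y /(allP ap); rewrite occE.
pose occ := occupied (bits_of S).
pose pt k v := point_in (SS k) v.
have ptP k v : occ v -> SS k (pt k v) /\ gc (val v.1) v.2 (pt k v).
  move=> ov; have : [set pt k v] (pt k v) by [].
  by rewrite -occupied_point ?occE.
have pt_inj k u v : occ u -> occ v -> pt k u = pt k v -> u = v.
  move=> ou ov E; have [_ h1] := ptP k u ou; have [_ h2] := ptP k v ov.
  have [r1 _] := window_reduced u; have [r2 _] := window_reduced v.
  rewrite -E in h2; have [e1 e2] := gcell_inj h_gt0 r1 r2 h1 h2.
  by case: u v e1 e2 {ou ov E h1 h2 r1 r2} => [u1 u2] [v1 v2] /= /val_inj -> ->.
have upt k v : occ v -> uhp (pt k v) by move=> ov; have [_ []] := ptP k v ov.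
pose tau k v := TT k (pt k v).
pose q k u v := hdist (pt k u) (pt k v).
have q_near k u v : occ u -> occ v -> `|q k u v - rdist u v| <= 2 * eta.
  by move=> ou ov; apply: hdist_rdist; [have [_ ?] := ptP k u ou|have [_ ?] := ptP k v ov].
have repel k u v : occ u -> occ v -> u != v ->
    (tau k u <= (q k u v / 2)%:E)%E \/ (tau k v <= (q k u v / 2)%:E)%E.
  move=> ou ov uv; have [_ pr _] := pTT k.
  have [|h1] := leP (tau k u) (q k u v / 2)%:E; first by left.
  have [|h2] := leP (tau k v) (q k u v / 2)%:E; first by right.
  have [s1 _] := ptP k u ou; have [s2 _] := ptP k v ov.
  have q0 : 0 <= q k u v by apply: hdist_ge0; exact: upt.
  have ne : pt k u <> pt k v by move=> E; move/eqP: uv; apply; exact: pt_inj E.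
  have := @pr (q k u v / 2) (pt k u) (pt k v) _ (conj s1 h1) (conj s2 h2) ne.
  rewrite -/(q k u v) => /(_ _)H; exfalso.
  by have : 2 * (q k u v / 2) < q k u v by [apply: H; rewrite divr_ge0|]; lra.
have lev_pt k v : occ v -> hdist (origin R) (pt k v) <= hdist (origin R) (rep v) + eta.
  move=> ov; have [_ gv] := ptP k v ov; have rn := rep_near gv.
  apply: le_trans (hdist_triangle (uhp_rep v) (uhp_origin R) (upt k v ov)) _.
  by rewrite lerD2l hdist_sym.
have partner k v : occ v -> hdist (origin R) (rep v) <= start_radius -> (tau k v <= t%:E)%E ->
    exists w, [/\ occ w, w != v, tau k w = tau k v & tau k v = (q k v w / 2)%:E].
  move=> ov lv tv; have [_ _ pp] := pTT k.
  have [s1 g1] := ptP k v ov.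
  have [|y [Sy yx Ty rho]] := pp _ s1; first by apply: le_lt_trans tv _; rewrite ltry.
  have tau_fin : tau k v = (hdist (pt k v) y / 2)%:E.
    have [T0 _ _] := pTT k; move: rho (T0 _ s1); rewrite /tau.
    case: (TT k (pt k v)) (tv : (TT k (pt k v) <= t%:E)%E) => [r|//|//] _.
    by rewrite -EFinM => -[->] _; congr (_%:E); field.
  have uy := inner_uhp (SSi k _ Sy).
  have hy : hdist (origin R) y <= radius.
    apply: le_trans (hdist_triangle (upt k v ov) (uhp_origin R) uy) _.
    have := lev_pt k v ov; move: tv; rewrite tau_fin lee_fin /radius; move: lv eta_le.
    lra.
  have [w [ow yw]] := good_point (gSS k) (SSi k) Sy hy.
  rewrite occE in ow; exists w; split => //.
  - apply/eqP => wv; apply: yx; by rewrite yw wv.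
  - by rewrite /tau /pt -yw Ty.
  - by rewrite tau_fin /q /pt -yw.
have [_ ties chains] := gS.
have xr : hdist (origin R) x <= disp_const R.
  have := hdist_gam_kset [::] [::] (kset_origin R) kx.
  by rewrite /= addn0 mulr0 mul0r addr0.
have dl : disp_const R <= radius.
  have : 0 <= n.+1%:R * (2 * t + 1) by rewrite mulr_ge0// addr_ge0// mulr_ge0.
  by rewrite /radius /start_radius; move: t_ge0; lra.
have [v0 [ov0 xv0]] := good_point gS Si Sx (le_trans xr dl).
have [_ gx] := ptP true v0 ov0; rewrite /pt /= -xv0 in gx.
have [r0 _] := window_reduced v0.
have [v00 v02] := gcell_kset r0 kx gx.
have [S'x' g'x'] := ptP false v0 ov0.
exists (pt false v0); split => //.
  by have [_ [_ _ _ k1]] := g'x'; move/k1: v02; rewrite v00.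
have E : tau true v0 = T x by rewrite /tau /pt /= -xv0.
rewrite -E in Tx.
have := @status_stable R window occ rdist (fun v => hdist (origin R) (rep v)) tau q
  (2 * eta) t start_radius n.
change (T' (pt false v0)) with (tau false v0).
apply => //.
- by move=> u v _ _; exact: (hdist_triangle (uhp_rep u) (uhp_origin R) (uhp_rep v)).
- move=> u v w ou ov ow uv vw uw; have := ties u v w ou ov ow uv vw uw; lra.
- rewrite /start_radius lerD2r.
  apply: le_trans (hdist_triangle (upt true v0 ov0) (uhp_origin R) (uhp_rep v0)) _.
  have [_ gv] := ptP true v0 ov0; have := rep_near gv.
  by rewrite /pt /= -xv0; move: eta_le xr; lra.
- move=> p sp ap up dp; apply: (chains v0 p) => //.
  by rewrite /start v00 eqxx v02.
Qed.

End stability.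

(** * Probability of a bad configuration *)

Section finite_measures.
Local Open Scope ereal_scope.
Context d (T : measurableType d) (R : realType) (mu : {measure set T -> \bar R}).

Lemma measure_big_setU_le (I : eqType) (s : seq I) (F : I -> set T) :
  (forall i, measurable (F i)) ->
  mu (\big[setU/set0]_(i <- s) F i) <= \sum_(i <- s) mu (F i).
Proof.
move=> mF; elim: s => [|i s IH]; first by rewrite !big_nil measure0.
rewrite !big_cons; apply: le_trans (measureU2 _ _ _) _ => //.
  by apply: bigsetU_measurable.
by rewrite leeD2l.
Qed.

Lemma sum_measure_le (I : finType) (Q : pred I) (F : I -> set T) (B : set T) :
  (forall i, measurable (F i)) -> (forall i j, i != j -> F i `&` F j = set0) ->
  measurable B -> (forall i, Q i -> F i `<=` B) ->
  \sum_(i | Q i) mu (F i) <= mu B.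
Proof.
move=> mF dF mB QB.
have E s : uniq s -> \sum_(i <- s | Q i) mu (F i) = mu (\big[setU/set0]_(i <- s | Q i) F i).
  elim: s => [|i s IH] /=; first by rewrite !big_nil measure0.
  case/andP => si us; rewrite !big_cons; case: ifP => Qi; last exact: IH.
  have disj : F i `&` \big[setU/set0]_(j <- s | Q j) F j = set0.
    rewrite -subset0 => x [Fi]; rewrite -bigcup_seq_cond => -[j /= /andP[js _] Fj].
    have ij : i != j by apply: contraNneq si => ->.
    by have : (F i `&` F j) x by []; rewrite dF.
  rewrite IH//; apply/esym; apply: measureU => //.
  exact: bigsetU_measurable.
rewrite E ?index_enum_uniq//; apply: le_measure; rewrite ?inE//.
  exact: bigsetU_measurable.
by rewrite -bigcup_seq_cond => x [i /= /andP[_ Qi] Fi]; exact: QB Fi.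
Qed.

End finite_measures.

Section bad_event.
Context (R : realType) (d : measure_display) (W : measurableType d) (P : probability W R).
Variables (lam : R) (mu : set (R * R) -> \bar R) (Pi : W -> set (R * R)).
Hypothesis lam_ge0 : 0 <= lam.
Hypothesis muE : forall A : set (R * R), measurable A -> mu A = (lam%:E * area R A)%E.
Hypothesis ppp : poisson_point_process P mu Pi.

Definition shell_const (U : R) : R := 8 * `|U| * expR U.

Section fixed_grid.
Variables (y0 h eta : R) (a b M n : nat) (t : R).
Hypotheses (y0_gt0 : 0 < y0) (h_gt0 : 0 < h) (eta_ge0 : 0 <= eta) (eta_le : 2 * eta <= 1).
Hypothesis fine_grid : 1 + h ^+ 2 / y0 ^+ 2 <= ch eta.
Hypothesis t_ge0 : 0 <= t.

Local Notation window := (window a b M).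
Local Notation rep := (@rep R y0 h a b M).
Local Notation rdist := (@rdist R y0 h a b M).
Local Notation gv := (fun v : window => gcell y0 h (val v.1) v.2).
Local Notation near_origin := (@near_origin R y0 h eta a b M n t).
Local Notation radius := (@radius R n t).

Definition cell_mass (v : window) : R := lam * fine (area R (gv v)).

Lemma measurable_gv v : measurable (gv v).
Proof. exact: measurable_gcell. Qed.

Lemma gv_disjoint u v : u != v -> gv u `&` gv v = set0.
Proof.
move=> uv; rewrite -subset0 => x [ux vx].
have [r1 _] := window_reduced u; have [r2 _] := window_reduced v.
have [e1 e2] := gcell_inj h_gt0 r1 r2 ux vx.
by case/eqP: uv; case: u v e1 e2 {ux vx r1 r2} => [u1 u2] [v1 v2] /= /val_inj -> ->.
Qed.

Lemma area_gv_le v : (area R (gv v) <= (shell_const 1 * Num.sqrt eta)%:E)%E.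
Proof.
apply: (@area_dshell _ (rep v) 0 eta 1) => //.
- exact: uhp_rep.
- by move: eta_le eta_ge0; lra.
- exact: measurable_gv.
move=> x xv; have [ux _] := xv; split => //.
have rn := rep_near y0_gt0 h_gt0 eta_ge0 fine_grid xv.
rewrite subr0 ger0_norm; last by apply: hdist_ge0 => //; exact: uhp_rep.
by rewrite hdist_sym.
Qed.

Lemma area_gv_fin v : (area R (gv v) \is a fin_num).
Proof.
rewrite ge0_fin_numE//; apply: le_lt_trans (area_gv_le v) _; exact: ltry.
Qed.

Lemma cell_massE v : mu (gv v) = (cell_mass v)%:E.
Proof. by rewrite muE ?EFinM ?fineK ?area_gv_fin//; exact: measurable_gv. Qed.

Lemma cell_mass_ge0 v : 0 <= cell_mass v.
Proof. by rewrite mulr_ge0// fine_ge0. Qed.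

Lemma cell_mass_le v : cell_mass v <= lam * (shell_const 1 * Num.sqrt eta).
Proof.
apply: ler_wpM2l => //; rewrite -lee_fin fineK ?area_gv_fin//; exact: area_gv_le.
Qed.

(** The cells are disjoint and the selected ones lie in an annulus, whose area bounds their total
    mass. *)
Lemma sum_cell_mass (Q : pred window) (z : R * R) (s r U : R) : uhp z -> 0 <= r -> s + r <= U ->
  (forall v x, Q v -> gv v x -> `|hdist z x - s| <= r) ->
  \sum_(v | Q v) cell_mass v <= lam * (shell_const U * Num.sqrt r).
Proof.
move=> z0 r0 sU Qr.
pose B := [set w : R * R | uhp w /\ `|hdist z w - s| <= r].
have mB : measurable B.
  have -> : B = shell z (ch (Num.max (s - r) 0)) (if 0 <= s + r then ch (s + r) else 0).
    apply/seteqP; split => w [w0 hw]; split => //; have hd := hdist_ge0 z0 w0.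
      move: hw; rewrite ler_norml => /andP[h1 h2].
      rewrite -(ch_hdist z0 w0); apply/andP; split.
        by apply: ch_le; rewrite ?ge_max ?hd ?le_max ?lexx ?orbT ?andbT//; lra.
      by case: ifP => [h3|/negbT]; [apply: ch_le => //; lra|rewrite -ltNge; lra].
    move: hw => /andP[h1]; case: ifP => h3; last first.
      by have := chdist_ge1 z0 w0; lra.
    rewrite -hdist_le// => h2; rewrite ler_norml; apply/andP; split; last lra.
    rewrite leNgt; apply/negP => h4.
    have : ch (hdist z w) < ch (Num.max (s - r) 0).
      by apply: ch_lt => //; rewrite lt_max; apply/orP; left; lra.
    by rewrite ch_hdist// ltNge h1.
  exact: measurable_shell.
have sumB : (\sum_(v | Q v) area R (gv v) <= area R B)%E.
  apply: sum_measure_le => //; first exact: measurable_gv.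
    exact: gv_disjoint.
  by move=> v Qv x xv; split; [case: xv|exact: Qr xv].
have areaB := area_dshell z0 r0 sU mB (fun x Bx => Bx).
rewrite -mulr_sumr; apply: ler_wpM2l => //.
rewrite -lee_fin -sumEFin; apply: le_trans areaB; apply: le_trans sumB.
by apply: lee_sum => v _; rewrite fineK ?area_gv_fin.
Qed.

Local Notation cbit w v := (bit R (Pi w `&` gv v)).
Local Notation m := cell_mass.
Local Notation occ_event p := [set w | forall v : window, v \in p -> cbit w v != None].

Lemma measurable_occ_event (p : seq window) : measurable (occ_event p).
Proof.
have -> : occ_event p = \big[setI/setT]_(v <- p) [set w | cbit w v != None].
  rewrite -bigcap_seq; apply/seteqP; split => w /= hw v; exact: hw.
apply: bigsetI_measurable => v _.
exact: (measurable_cell_bit ppp (predC (pred1 None)) (measurable_gv v)).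
Qed.

Lemma prob_occ_event (p : seq window) : uniq p ->
  (P (occ_event p) <= (\prod_(v <- p) m v)%:E)%E.
Proof.
by move=> up; apply: (prob_all_occupied ppp) => //;
  [exact: measurable_gv|exact: gv_disjoint|exact: cell_massE].
Qed.

Definition total_const : R := lam * (shell_const (radius + 1) * Num.sqrt (radius + 1)).
Definition start_const : R := lam * (shell_const (disp_const R) * Num.sqrt (disp_const R)).

Lemma disp_const_ge0 : 0 <= disp_const R.
Proof.
have g1 := golden_gt1 R.
by rewrite /disp_const addr_ge0// mulr_ge0// ln_ge0//; lra.
Qed.

Lemma radius_ge0 : 0 <= radius.
Proof.
have d0 := disp_const_ge0.
have : 0 <= n.+1%:R * (2 * t + 1) by rewrite mulr_ge0// addr_ge0// mulr_ge0.
by rewrite /radius /start_radius; move: t_ge0; lra.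
Qed.

Lemma near_mass : \sum_(v | near_origin v) m v <= total_const.
Proof.
have r0 := radius_ge0.
apply: (@sum_cell_mass _ (origin R) 0); [exact: uhp_origin|lra|lra|].
move=> v x nv xv; have [ux _] := xv.
rewrite subr0 ger0_norm; last by apply: hdist_ge0 => //; exact: uhp_origin.
have rn := rep_near y0_gt0 h_gt0 eta_ge0 fine_grid xv.
have urep := @uhp_rep R y0 h a b M v.
apply: le_trans (hdist_triangle urep (uhp_origin R) ux) _.
rewrite (hdist_sym _ x); move: nv; rewrite /near_origin; move: eta_le; lra.
Qed.

Lemma start_mass : \sum_(v | start v) m v <= start_const.
Proof.
have r0 := disp_const_ge0.
apply: (@sum_cell_mass _ (origin R) 0); [exact: uhp_origin|lra|lra|].
move=> v x /andP[/eqP v1 v2] xv; have [ux cx] := xv.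
rewrite subr0 ger0_norm; last by apply: hdist_ge0 => //; exact: uhp_origin.
have kx : kset x by case: cx; rewrite v1 /= => _ _ _ [_]; apply.
by have := hdist_gam_kset [::] [::] (kset_origin R) kx; rewrite /= addn0 mulr0 mul0r addr0.
Qed.

Lemma rdist_near u v x : gv v x -> `|hdist (rep u) x - rdist u v| <= eta.
Proof.
move=> xv; have [ux _] := xv.
have rn := rep_near y0_gt0 h_gt0 eta_ge0 fine_grid xv.
have u0 := @uhp_rep R y0 h a b M u; have v0 := @uhp_rep R y0 h a b M v.
have h1 := hdist_triangle v0 u0 ux; have h2 := hdist_triangle ux u0 v0.
rewrite (hdist_sym (rep v) x) in h1.
rewrite /rdist ler_norml; apply/andP; split; lra.
Qed.

Lemma tie_mass u v : near_origin u -> near_origin v ->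
  \sum_(w | `|rdist u v - rdist v w| <= 4 * eta) m w <=
  lam * (shell_const (2 * radius + 4) * Num.sqrt (5 * eta)).
Proof.
move=> nu nv.
have u0 := @uhp_rep R y0 h a b M u; have v0 := @uhp_rep R y0 h a b M v.
apply: (@sum_cell_mass _ (rep v) (rdist u v)); [exact: v0|by move: eta_ge0; lra| |].
  have := hdist_triangle (uhp_origin R) u0 v0.
  rewrite (hdist_sym (rep u) (origin R)) -/(rdist u v); move: nu nv; rewrite /near_origin.
  move: eta_le radius_ge0; lra.
move=> w x; rewrite ler_norml => /andP[h1 h2] xw.
have /ler_normlP [h3 h4] := rdist_near v xw.
rewrite ler_norml; apply/andP; split; lra.
Qed.

(** Union bounds over the three defects. A crowded cell has probability at most the square of its
    mass; a near tie confines the third point to an annulus of half-width [5 * eta]; chains are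
    counted by [chain_sum_le], with shells of width [delta] enlarged by the cell diameter. *)
Lemma prob_bad (delta : R) (N : nat) : 0 < delta -> delta <= 1 -> eta <= delta ->
  2 * t + 1 <= N%:R * delta -> N%:R * delta <= 2 * t + 2 ->
  lam * (shell_const (2 * t + 4) * Num.sqrt (2 * delta)) <= 4^-1 ->
  exists B, [/\ measurable B,
    (P B <= (lam * (shell_const 1 * Num.sqrt eta) * total_const +
       total_const * total_const * (lam * (shell_const (2 * radius + 4) * Num.sqrt (5 * eta))) +
       start_const * (2 ^+ N / 2 ^+ n.+1))%:E)%E &
    forall w, ~ B w -> good y0 h eta M n t (@bits_of R y0 h a b (Pi w))].
Proof.
move=> d0 d1 ed N1 N2 shellN.
pose s1 := [seq v <- enum {: window} | near_origin v].
pose F1 (v : window) := [set w | cbit w v == Some false].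
pose tie (p : window * window * window) :=
  [&& near_origin p.1.1, near_origin p.1.2, uniq [:: p.1.1; p.1.2; p.2] &
      `|rdist p.1.1 p.1.2 - rdist p.1.2 p.2| <= 4 * eta].
pose s2 := [seq p <- enum {: window * window * window} | tie p].
pose F2 (p : window * window * window) := occ_event [:: p.1.1; p.1.2; p.2].
pose chn (q : window * seq window) :=
  [&& start q.1, uniq (q.1 :: q.2) & dec_chain rdist q.1 (2 * t + 1) q.2].
pose s3 := [seq q <- [seq (v, p) | v <- enum {: window}, p <- all_seqs window n.+1] | chn q].
pose F3 (q : window * seq window) := occ_event (q.1 :: q.2).
have mF1 v : measurable (F1 v) by exact: (measurable_cell_bit ppp (pred1 (Some false)) (measurable_gv v)).
have mF2 p : measurable (F2 p) by exact: measurable_occ_event.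
have mF3 q : measurable (F3 q) by exact: measurable_occ_event.
pose B1 := \big[setU/set0]_(v <- s1) F1 v.
pose B2 := \big[setU/set0]_(p <- s2) F2 p.
pose B3 := \big[setU/set0]_(q <- s3) F3 q.
have mB1 : measurable B1 by apply: bigsetU_measurable.
have mB2 : measurable B2 by apply: bigsetU_measurable.
have mB3 : measurable B3 by apply: bigsetU_measurable.
have m0 v := cell_mass_ge0 v.
have pB1 : (P B1 <= (lam * (shell_const 1 * Num.sqrt eta) * total_const)%:E)%E.
  apply: le_trans (measure_big_setU_le _ _ mF1) _.
  apply: (@le_trans _ _ (\sum_(v <- s1) (m v ^+ 2)%:E)%E).
    by apply: lee_sum => v _; apply: (prob_crowded ppp) => //; [exact: measurable_gv|exact: cell_massE].
  rewrite sumEFin lee_fin big_filter big_enum_cond /=.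
  apply: (@le_trans _ _ (\sum_(v | near_origin v) lam * (shell_const 1 * Num.sqrt eta) * m v)).
    by apply: ler_sum => v _; rewrite expr2; apply: ler_wpM2r => //; exact: cell_mass_le.
  rewrite -mulr_sumr; apply: ler_wpM2l; last exact: near_mass.
  by rewrite !mulr_ge0// ?sqrtr_ge0// expR_ge0.
have pB2 : (P B2 <= (total_const * total_const *
    (lam * (shell_const (2 * radius + 4) * Num.sqrt (5 * eta))))%:E)%E.
  apply: le_trans (measure_big_setU_le _ _ mF2) _.
  apply: (@le_trans _ _ (\sum_(p <- s2) (m p.1.1 * (m p.1.2 * m p.2))%:E)%E).
    rewrite big_seq_cond [leRHS]big_seq_cond; apply: lee_sum => p; rewrite andbT mem_filter.
    move=> /andP[/and4P[_ _ up _] _]; apply: le_trans (prob_occ_event up) _.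
    by rewrite !big_cons big_nil mulr1.
  rewrite sumEFin lee_fin big_filter big_enum_cond /=.
  apply: (@le_trans _ _ (\sum_(u | near_origin u) \sum_(v | near_origin v)
     m u * (m v * (lam * (shell_const (2 * radius + 4) * Num.sqrt (5 * eta)))))).
    rewrite big_mkcond /=.
    rewrite -(pair_bigA _ (fun (uv : window * window) w => if tie (uv, w) then m uv.1 * (m uv.2 * m w) else 0)) /=.
    rewrite -(pair_bigA _ (fun u v => \sum_w if tie ((u, v), w) then m u * (m v * m w) else 0)) /=.
    rewrite [leRHS]big_mkcond /=; apply: ler_sum => u _.
    case: ifP => nu; last first.
      by rewrite big1// => v _; rewrite big1// => w _; rewrite /tie /= nu.
    rewrite [leRHS]big_mkcond /=; apply: ler_sum => v _.
    case: ifP => nv; last by rewrite big1// => w _; rewrite /tie /= nv andbF.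
    rewrite -big_mkcond /= -mulr_sumr -mulr_sumr; do 2 (apply: ler_wpM2l => //).
    apply: le_trans (tie_mass nu nv).
    rewrite [leLHS]big_mkcond [leRHS]big_mkcond; apply: ler_sum => w _.
    rewrite /tie /= nu nv /=; case: (`|rdist u v - rdist v w| <= 4 * eta); rewrite ?andbF// andbT.
    by case: ifP.
  have c0 : 0 <= lam * (shell_const (2 * radius + 4) * Num.sqrt (5 * eta)).
    by rewrite !mulr_ge0// ?sqrtr_ge0// expR_ge0.
  have t0 : 0 <= total_const by rewrite !mulr_ge0// ?sqrtr_ge0// expR_ge0.
  under eq_bigr do rewrite -mulr_sumr -mulr_suml.
  rewrite -mulr_suml -mulrA; apply: ler_pM; rewrite ?sumr_ge0//.
  - by rewrite mulr_ge0// sumr_ge0.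
  - exact: near_mass.
  - by apply: ler_wpM2r => //; exact: near_mass.
have pB3 : (P B3 <= (start_const * (2 ^+ N / 2 ^+ n.+1))%:E)%E.
  apply: le_trans (measure_big_setU_le _ _ mF3) _.
  apply: (@le_trans _ _ (\sum_(q <- s3) (m q.1 * \prod_(v <- q.2) m v)%:E)%E).
    rewrite big_seq_cond [leRHS]big_seq_cond; apply: lee_sum => q; rewrite andbT mem_filter.
    move=> /andP[/and3P[_ uq _] _]; apply: le_trans (prob_occ_event uq) _.
    by rewrite big_cons.
  rewrite sumEFin lee_fin big_filter big_mkcond big_allpairs_dep big_enum /=.
  apply: (@le_trans _ _ (\sum_(v | start v) m v * (2 ^+ N / 2 ^+ n.+1))); last first.
    by rewrite -mulr_suml; apply: ler_wpM2r; [rewrite divr_ge0// exprn_ge0|exact: start_mass].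
  rewrite [leRHS]big_mkcond /=; apply: ler_sum => v _; case: ifP => sv; last first.
    by rewrite big1// => p _; rewrite /chn /= sv.
  apply: (@le_trans _ _ (m v * chain_sum rdist m n.+1 v (2 * t + 1))).
    rewrite /chain_sum mulr_sumr [leRHS]big_mkcond; apply: ler_sum => p _.
    rewrite /chn /= sv /=; case: (dec_chain _ _ _ p); last by rewrite andbF.
    case: ifP => // _; apply: mulr_ge0 => //.
    by apply: prodr_ge0 => ? _.
  apply: ler_wpM2l => //; apply: (@chain_sum_le _ _ rdist m delta _ _ _ N) => //.
    by move=> u w; apply: hdist_ge0; exact: uhp_rep.
  move=> j u jN; apply: le_trans shellN.
  apply: le_trans (_ : _ <= lam * (shell_const (2 * t + 4) * Num.sqrt (delta + eta))) _.
    apply: (@sum_cell_mass _ (rep u) (j%:R * delta)).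
    - exact: uhp_rep.
    - by rewrite addr_ge0// ltW.
    - have : j.+1%:R * delta <= N%:R * delta by rewrite ler_pM2r// ler_nat.
      by rewrite -natr1 mulrDl mul1r; move: eta_le N2; lra.
    move=> w x /andP[h1 h2] xw; have /ler_normlP [h3 h4] := rdist_near u xw.
    by move: h2; rewrite -natr1 mulrDl mul1r => h2; rewrite ler_norml; apply/andP; split; lra.
  apply: ler_wpM2l => //; apply: ler_wpM2l; first by rewrite !mulr_ge0// expR_ge0.
  by apply: ler_wsqrtr; lra.
exists (B1 `|` (B2 `|` B3)); split.
- by apply: measurableU => //; exact: measurableU.
- apply: le_trans (measureU2 _ _ _) _ => //; first exact: measurableU.
  rewrite -addrA EFinD; apply: leeD => //.
  apply: le_trans (measureU2 _ _ _) _ => //.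
  by rewrite EFinD; exact: leeD.
move=> w /not_orP [nB1 /not_orP [nB2 nB3]].
have occW v : occupied y0 h eta n t (@bits_of R y0 h a b (Pi w)) v ->
    near_origin v /\ cbit w v != None.
  by rewrite /occupied /wbit ffunE => /andP[-> /eqP ->].
split.
- move=> v nv; rewrite /wbit ffunE => bv; apply: nB1.
  rewrite /B1 -bigcup_seq; exists v; last by rewrite /F1 /= bv.
  by rewrite /= mem_filter nv mem_enum.
- move=> u v x ou ov ox uv vx ux; rewrite ltNge; apply/negP => tuv; apply: nB2.
  have [nu bu] := occW _ ou; have [nv bv] := occW _ ov; have [_ bx] := occW _ ox.
  rewrite /B2 -bigcup_seq; exists ((u, v), x).
    by rewrite /= mem_filter mem_enum andbT /tie /= nu nv !inE negb_or uv ux vx tuv.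
  by move=> i; rewrite !inE => /or3P[] /eqP ->.
- move=> v p sv sp ap up dp; apply: nB3.
  rewrite /B3 -bigcup_seq; exists (v, p).
    suff : (v, p) \in s3 by [].
    rewrite mem_filter; apply/andP; split; first by rewrite /chn sv dp up.
    by apply: allpairs_f; [rewrite mem_enum|exact: mem_all_seqs].
  by move=> i ip; have /occW [] := allP ap i ip.
Qed.

End fixed_grid.
End bad_event.

Section good_parameters.
Context (R : realType) (d : measure_display) (W : measurableType d) (P : probability W R).
Variables (lam : R) (mu : set (R * R) -> \bar R) (Pi : W -> set (R * R)).
Hypothesis lam_ge0 : 0 <= lam.
Hypothesis muE : forall A : set (R * R), measurable A -> mu A = (lam%:E * area R A)%E.
Hypothesis ppp : poisson_point_process P mu Pi.

Lemma sqrt_small (c e : R) : 0 <= c -> 0 < e -> exists2 x : R, 0 < x <= 2^-1 & c * Num.sqrt x <= e.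
Proof.
move=> c0 e0; pose u := Num.min 2^-1 (e / (c + 1)).
have u0 : 0 < u by rewrite lt_min divr_gt0//; [rewrite invr_gt0 andbT; lra|lra].
have u1 : u <= 2^-1 by rewrite ge_min lexx.
exists (u ^+ 2); first by apply/andP; split; [rewrite exprn_gt0|nra].
rewrite sqrtr_sqr gtr0_norm//.
have : u <= e / (c + 1) by rewrite ge_min lexx orbT.
rewrite ler_pdivlMr; [|lra]; nra.
Qed.

(** The order of choices matters: [delta] and [N] depend on t alone, then [n] makes 2^N / 2^n small,
    which fixes the radius and with it the constants multiplying the square roots; [eta] is chosen
    against these, and the grid and [M] last. *)
Lemma good_likely (t eps : R) : 0 <= t -> 0 < eps ->
  exists (n : nat) (eta y0 h : R) (a b M : nat) (B : set W),
  [/\ [/\ 0 < y0, 0 < h, 0 <= eta & 2 * eta <= 1], 1 + h ^+ 2 / y0 ^+ 2 <= ch eta,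
    (forall x, inner x -> hdist (origin R) x <= radius n t ->
      exists g (c : cell_index a b), [/\ reduced g, (size g <= M)%N & gcell y0 h g c x]),
    measurable B /\ (P B <= eps%:E)%E &
    forall w, ~ B w -> good y0 h eta M n t (@bits_of R y0 h a b (Pi w))].
Proof.
move=> t0 e0.
have sc0 U : 0 <= shell_const U :> R by rewrite !mulr_ge0// expR_ge0.
have [dd /andP[dd0 dd1] hdd] : exists2 x : R, 0 < x <= 2^-1 &
    (lam * shell_const (2 * t + 4)) * Num.sqrt x <= 4^-1.
  by apply: sqrt_small; rewrite ?mulr_ge0// invr_gt0.
pose delta := dd / 2.
pose N := (Num.truncn ((2 * t + 1) / delta)).+1.
have d0 : 0 < delta by rewrite /delta; lra.
have d1 : delta <= 1 by rewrite /delta; lra.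
have q0 : 0 <= (2 * t + 1) / delta by rewrite divr_ge0//; lra.
have /andP[N1 N2] : (Num.truncn ((2 * t + 1) / delta))%:R <= (2 * t + 1) / delta
    < N%:R by exact: truncn_itv.
rewrite ler_pdivlMr// in N1; rewrite ltr_pdivrMr// in N2.
have N3 : N%:R * delta <= 2 * t + 2 by rewrite /N -natr1 mulrDl mul1r; lra.
pose sc : R := start_const lam.
have sc0' : 0 <= sc by rewrite !mulr_ge0// ?sqrtr_ge0.
have [n hn] : exists n, sc * (2 ^+ N / 2 ^+ n.+1) <= eps / 3.
  have p0 : 0 < sc * 2 ^+ N + 1 by rewrite ltr_wpDl// mulr_ge0// exprn_ge0.
  have e3 : 0 < eps / 3 / (sc * 2 ^+ N + 1) by rewrite !divr_gt0.
  have h2 : 0 <= (2^-1 : R) by rewrite invr_ge0.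
  have h1 : (2^-1 : R) < 1 by lra.
  have [n hn] := expr_lt1_small h2 h1 e3.
  exists n; rewrite exprVn ler_pdivlMr// in hn.
  have i0 : 0 < (2 ^+ n : R)^-1 by rewrite invr_gt0 exprn_gt0.
  rewrite exprS invfM.
  have : 0 <= sc * 2 ^+ N by rewrite mulr_ge0// exprn_ge0.
  rewrite !mulrA; nra.
pose tc : R := total_const lam n t.
have tc0 : 0 <= tc by rewrite !mulr_ge0// ?sqrtr_ge0.
pose c1 := lam * shell_const 1 * tc.
pose c2 := tc * tc * (lam * shell_const (2 * radius n t + 4)).
have c10 : 0 <= c1 by rewrite !mulr_ge0.
have c20 : 0 <= c2 by rewrite !mulr_ge0.
have [e1 /andP[e10 e11] he1] : exists2 x, 0 < x <= 2^-1 & c1 * Num.sqrt x <= eps / 3.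
  by apply: sqrt_small => //; lra.
have [e2 /andP[e20 e21] he2] : exists2 x, 0 < x <= 2^-1 & c2 * Num.sqrt x <= eps / 3.
  by apply: sqrt_small => //; lra.
pose eta := Num.min delta (Num.min e1 (e2 / 5)).
have eta0 : 0 < eta by rewrite !lt_min d0 e10 /=; lra.
have etad : eta <= delta by rewrite ge_min lexx.
have etae1 : eta <= e1 by rewrite !ge_min lexx orbT.
have etae2 : 5 * eta <= e2.
  have : eta <= e2 / 5 by rewrite !ge_min lexx !orbT.
  lra.
have [y0 [h [a [b [M [y00 h0 fi cov]]]]]] := window_exists (radius n t) eta0.
have eta2 : 2 * eta <= 1 by lra.
have [|B [mB PB gB]] := prob_bad lam_ge0 muE ppp a b M n y00 h0 (ltW eta0) eta2 fi t0 d0 d1 etad (ltW N2) N3.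
  have E2 : 2 * delta = dd by rewrite /delta; field.
  by rewrite E2 mulrA.
exists n, eta, y0, h, a, b, M, B; split => //; first by split => //; exact: ltW.
split => //; apply: le_trans PB _; rewrite lee_fin.
have s1 : Num.sqrt eta <= Num.sqrt e1 by apply: ler_wsqrtr.
have s2 : Num.sqrt (5 * eta) <= Num.sqrt e2 by apply: ler_wsqrtr.
have -> : eps = eps / 3 + eps / 3 + eps / 3 by field.
apply: lerD => //; apply: lerD.
  have -> : lam * (shell_const 1 * Num.sqrt eta) * total_const lam n t = c1 * Num.sqrt eta.
    by rewrite /c1 /tc; ring.
  exact: le_trans (ler_wpM2l c10 s1) he1.
have -> : tc * tc * (lam * (shell_const (2 * radius n t + 4) * Num.sqrt (5 * eta))) =
  c2 * Num.sqrt (5 * eta) by rewrite /c2; ring.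
exact: le_trans (ler_wpM2l c20 s2) he2.
Qed.

End good_parameters.

(** * The popping event as a factor of the bits *)

Section equivariance.
Variable R : realType.
Implicit Types (S : set (R * R)) (T : R * R -> \bar R) (g : word) (x y z : R * R).

Definition pull g S : set (R * R) := [set x | uhp x /\ S (gam g x)].

Lemma pull_popping_times g S T : (forall x, S x -> uhp x) -> popping_times (@hdist R) S T ->
  popping_times (@hdist R) (pull g S) (T \o gam g).
Proof.
move=> Su [p1 p2 p3]; split.
- by move=> x [_ /p1].
- move=> t x y t0 [[ux Sx] Tx] [[uy Sy] Ty] xy.
  rewrite -(hdist_gam g ux uy); apply: (p2 t) => //; move/(gam_inj ux uy); exact: xy.
- move=> x [ux Sx] /= fx; have [y [Sy yx Ty dy]] := p3 _ Sx fx.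
  have uy := Su _ Sy; exists (gam (rev g) y); split.
  + by split; [exact: gam_uhp|rewrite gamK].
  + by move=> E; apply: yx; rewrite -E gamK.
  + by rewrite /= gamK.
  + by rewrite -(hdist_gam g)// ?gamK//; exact: gam_uhp.
Qed.

Lemma inner_gam g x : inner x -> inner (gam g x).
Proof.
move=> [k [z [rk tz ->]]]; exists (lmul g k), z; split => //; first exact: reduced_lmul.
by rewrite gam_lmul//; case: tz.
Qed.

Lemma pull_inner g S : S `<=` [set x | inner x] -> pull g S `<=` [set x | inner x].
Proof.
move=> Si x [ux /Si /(inner_gam (rev g))].
by rewrite gam_revK.
Qed.

Lemma bit_image (S S' : set (R * R)) (f : R * R -> R * R) : S = f @` S' ->
  {in S' &, injective f} -> bit R S = bit R S'.
Proof.
move=> -> fi.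
have E0 : bit R (f @` S') = None <-> bit R S' = None.
  rewrite !bit_set0; split => [E|->]; last exact: image_set0.
  by rewrite -subset0 => x Sx; have : (f @` S') (f x) by [exists x]; rewrite E.
have E1 : bit R (f @` S') = Some true <-> bit R S' = Some true.
  rewrite !bit_set1; split => [[y Ey]|[x ->]]; last by exists (f x); rewrite image_set1.
  have [x Sx xy] : (f @` S') y by rewrite Ey.
  exists x; apply/seteqP; split => [x' Sx'|_ ->//].
  have : (f @` S') (f x') by exists x'.
  by rewrite Ey /= -xy => /fi; rewrite !inE; apply.
move: E0 E1; case: (bit R (f @` S')) => [[]|]; case: (bit R S') => [[]|] // [h1 h2] [h3 h4].
- by move: (h3 erefl).
- by move: (h2 erefl).
- by move: (h4 erefl).
- by move: (h2 erefl).
- by move: (h1 erefl).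
- by move: (h1 erefl).
Qed.

(** Equivariance: translating the labels by [g] amounts to pulling the configuration back, so the
    mark at [g] is the mark at the identity for [pull g S]. *)
Lemma bits_of_pull (y0 h : R) (a b : nat) g k S : (forall x, S x -> uhp x) ->
  bits_of y0 h a b S (lmul g k) = bits_of y0 h a b (pull g S) k.
Proof.
move=> Su; apply/ffunP => c; rewrite !ffunE.
apply: (@bit_image _ _ (gam g)) => [|x y]; last first.
  by rewrite !inE => -[[ux _] _] [[uy _] _]; exact: gam_inj.
have cu (z : R * R) : cell y0 h c z -> uhp z by case=> -[].
apply/seteqP; split => x.
  move=> [Sx [ux cx]]; exists (gam (rev g) x); last by rewrite gamK.
  have uz := cu _ cx; have E : gam g (gam k (gam (rev (lmul g k)) x)) = x.
    by rewrite -gam_lmul// gamK.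
  split; first by split; [exact: gam_uhp|rewrite gamK].
  split; first exact: gam_uhp.
  by rewrite -{1}E gam_revK ?gam_revK ?gam_uhp.
move=> [z [[uz Sz] [_ cz]] <-]; split => //; split; first exact: gam_uhp.
have uz' := cu _ cz.
have -> : gam g z = gam (lmul g k) (gam (rev k) z) by rewrite gam_lmul// gamK.
by rewrite gam_revK.
Qed.

End equivariance.

(** * No points on the geodesics bounding the tiles *)

Section boundary.
Context (R : realType) (d : measure_display) (W : measurableType d) (P : probability W R).
Variables (lam : R) (mu : set (R * R) -> \bar R) (Pi : W -> set (R * R)).
Hypothesis muE : forall A : set (R * R), measurable A -> mu A = (lam%:E * area R A)%E.
Hypothesis ppp : poisson_point_process P mu Pi.
Hypothesis Pi_uhp : forall w, Pi w `<=` [set x | uhp x].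

Local Notation leb := (@lebesgue_measure R).
Local Notation leb2 := (leb \x leb)%E.

Definition sides : set (R * R) :=
  [set z | z.1 = 0] `|` ([set z | z.1 = 1] `|` [set z | uhp z /\ dsq z = 4^-1]).

Let m1 : measurable_fun setT (fst : R * R -> R) := measurable_fst.

Lemma measurable_sides : measurable sides.
Proof.
have l1 (c : R) : measurable [set z : R * R | z.1 = c].
  by apply: (measurable_preimage m1 (measurable_set1 c)).
apply: measurableU; first exact: l1.
apply: measurableU; first exact: l1.
apply: measurableI; first exact: measurable_uhp.
exact: (measurable_preimage (@measurable_dsq R) (measurable_set1 _)).
Qed.

Lemma lebesgue_sides : leb2 sides = 0%E.
Proof.
have mS := measurable_sides.
have E c : leb2 [set z : R * R | z.1 = c] = 0%E.
  have -> : [set z : R * R | z.1 = c] = [set c] `*` setT by apply/seteqP; split => z //= [].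
  rewrite product_measure1E//.
  by rewrite [X in (X * _)%E](lebesgue_measure_set1 c) mul0e.
have E' : leb2 [set z : R * R | uhp z /\ dsq z = 4^-1] = 0%E.
  rewrite /= /product_measure1 integral0_eq// => x _ /=.
  apply: (@subset_measure0 _ _ _ leb _ [set Num.sqrt (4^-1 - (x - 2^-1) ^+ 2)]) => //.
  - apply: measurable_xsection; apply: measurableI; first exact: measurable_uhp.
    exact: (measurable_preimage (@measurable_dsq R) (measurable_set1 _)).
  - move=> y; rewrite /xsection /= inE => -[/= y0]; rewrite /dsq /= => E2.
    by rewrite -E2 addrAC subrr add0r sqrtr_sqr ger0_norm// ltW.
  - exact: lebesgue_measure_set1.
have l1 (c : R) : measurable [set z : R * R | z.1 = c].
  by apply: (measurable_preimage m1 (measurable_set1 c)).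
have m3 : measurable [set z : R * R | uhp z /\ dsq z = 4^-1].
  apply: measurableI; first exact: measurable_uhp.
  exact: (measurable_preimage (@measurable_dsq R) (measurable_set1 _)).
have U0 (A B : set (R * R)) : measurable A -> measurable B -> leb2 A = 0%E -> leb2 B = 0%E ->
    leb2 (A `|` B) = 0%E by move=> mA mB A0 B0; rewrite measureU0.
apply: (U0); [exact: l1|exact: measurableU|exact: E|].
by apply: (U0); [exact: l1|exact: m3|exact: E|exact: E'].
Qed.

Lemma area_sides : area R sides = 0%E.
Proof.
rewrite /= /weighted; apply: null_set_integral => //.
- by apply: measurableI; [exact: measurable_sides|exact: measurable_uhp].
- exact: measurable_area_density.
- apply: (@subset_measure0 _ _ _ leb2 _ sides) => //.
  + by apply: measurableI; [exact: measurable_sides|exact: measurable_uhp].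
  + exact: measurable_sides.
  + exact: lebesgue_sides.
Qed.

Lemma not_inner_sides x : uhp x -> ~ inner x -> exists g, sides (gam g x).
Proof.
move=> ux ix; have [M HM] := @cover_box R x.2 `|x.1| ux.
have [g _ ct] := HM x (lexx _) (lexx _); exists g.
apply: contra_notP ix => ns.
have tx : triangle (gam g x).
  case: ct => z0 h1 h2 h3; split => //; rewrite lt_neqAle ?h1 ?h2 ?h3 andbT;
    apply/eqP => E; apply: ns.
  - by left.
  - by right; left.
  - by right; right.
rewrite -(gam_revK g ux); apply: inner_gam.
by exists [::], (gam g x).
Qed.

(** A point outside all open tiles is carried to a side by some word. There are countably many
    words, and the preimages of the sides are null by invariance of the area. *)
Lemma inner_ae : {ae P, forall w, Pi w `<=` [set x | inner x]}.
Proof.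
pose Z (g : word) : set (R * R) := gam g @^-1` sides.
have mZ g : measurable (Z g) by exact: (measurable_preimage (measurable_gam g) measurable_sides).
have muZ g : mu (Z g) = (0 : R)%:E.
  by rewrite muE// /Z area_gam ?area_sides ?mule0//; exact: measurable_sides.
pose B (n : nat) : set W := [set w | bit R (Pi w `&` Z (odflt [::] (unpickle n))) != None].
have mB n : measurable (B n).
  exact: (measurable_cell_bit ppp (predC (pred1 None)) (mZ _)).
have Bae : {ae P, forall w, forall n, ~ B n w}.
  apply: ae_foralln => n; exists (B n); split => //; last by move=> w /= /contrapT.
  by apply/eqP; rewrite -measure_le0; exact: (prob_occupied ppp (mZ _) (muZ _)).
apply: filterS Bae => w nB x Px; apply: contrapT => ix.
have [g gx] := not_inner_sides (Pi_uhp Px) ix.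
apply: (nB (pickle g)); rewrite /B pickleK /=.
apply/eqP => /bit_set0 E.
by have : (Pi w `&` Z g) x by []; rewrite E.
Qed.

End boundary.

Lemma bit_mass_ge0 (R : realType) (m : R) (b : option bool) : 0 <= m -> 0 <= bit_mass m b.
Proof.
move=> m0; have e0 := expR_gt0 (- m); case: b => [[]|] /=; [by rewrite mulr_ge0// ltW| |exact: ltW].
have : (1 + m) * expR (- m) <= 1.
  by rewrite -[leRHS](expR0 R) -(subrr m) expRD ler_pM2r// expR_ge1Dx.
lra.
Qed.

Lemma bit_mass_sum1 (R : realType) (m : R) : \sum_b bit_mass m b = 1.
Proof.
rewrite (bigD1 None)//= (bigD1 (Some true))//= (bigD1 (Some false))//= big1; last by case=> [[]|].
by ring.
Qed.

(** * The mark as a function of labels, and its probability *)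

Section factor_event.
Context (R : realType) (d : measure_display) (W : measurableType d) (P : probability W R).
Variables (lam : R) (mu : set (R * R) -> \bar R) (Pi : W -> set (R * R)) (T : W -> R * R -> \bar R).
Hypothesis lam_ge0 : 0 <= lam.
Hypothesis muE : forall A : set (R * R), measurable A -> mu A = (lam%:E * area R A)%E.
Hypothesis ppp : poisson_point_process P mu Pi.
Hypothesis Pi_uhp : forall w, Pi w `<=` [set x | uhp x].
Hypothesis popping : {ae P, forall w, popping_times (@hdist R) (Pi w) (T w)}.

Section fixed_window.
Variables (y0 h eta : R) (a b M n N : nat) (t : R).
Hypotheses (y0_gt0 : 0 < y0) (h_gt0 : 0 < h) (eta_ge0 : 0 <= eta) (eta_le : 2 * eta <= 1).
Hypothesis fine_grid : 1 + h ^+ 2 / y0 ^+ 2 <= ch eta.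
Hypothesis t_ge0 : 0 <= t.
Hypothesis cover : forall x, inner x -> hdist (origin R) x <= radius n t ->
  exists g (c : cell_index a b), [/\ reduced g, (size g <= M)%N & gcell y0 h g c x].

Local Notation Al := {ffun cell_index a b -> option bool}.
Local Notation Om := {ffun seq_sub (ball3 N) -> Al}.
Implicit Types (xi : word -> Al) (x : Om).
Local Notation bits_of := (@bits_of R y0 h a b).
Local Notation good := (good y0 h eta M n t).

Definition has_active xi S T := [/\ S `<=` [set x : R * R | inner x], popping_times (@hdist R) S T,
  forall g, reduced g -> (size g <= M)%N -> bits_of S g = xi g &
  exists z, [/\ S z, kset z & (t%:E < T z)%E]].

(** Neither [S] nor [T] refers to the process, so this is a function of the labels outright;
    compatibility with [xi] is asked only for words up to [M], which makes it local. *)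
Definition active_mark xi : bool := `[< good xi /\ exists S T, has_active xi S T >].

Lemma active_mark_local xi xi' : (forall g, reduced g -> (size g <= M)%N -> xi g = xi' g) ->
  active_mark xi = active_mark xi'.
Proof.
move=> xixi'.
have sub xi1 xi2 : (forall g, reduced g -> (size g <= M)%N -> xi1 g = xi2 g) ->
    active_mark xi1 -> active_mark xi2.
  move=> E /asboolP [[g1 g2 g3] [S [T' [Si pT SE act]]]]; apply/asboolP.
  have wE (v : window a b M) : wbit xi2 v = wbit xi1 v.
    by rewrite /wbit; have [rg sg] := window_reduced v; rewrite E.
  have oE (v : window a b M) : occupied y0 h eta n t xi2 v = occupied y0 h eta n t xi1 v.
    by rewrite /occupied wE.
  split.
    split=> [v nv|u v w|v p sv sp ap].
    - by rewrite wE; exact: g1.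
    - by rewrite !oE; exact: g2.
    - apply: (g3 v p) => //; apply/allP => u /(allP ap).
      by rewrite oE.
  by exists S, T'; split => // g rg sg; rewrite SE// E.
by apply/idP/idP; apply: sub => // g rg sg; rewrite xixi'.
Qed.

Definition bits_mass (al : Al) : R := \prod_c bit_mass (lam * fine (area R (cell y0 h c))) (al c).

Lemma bits_mass_ge0 al : 0 <= bits_mass al.
Proof. by apply: prodr_ge0 => c _; apply: bit_mass_ge0; rewrite mulr_ge0// fine_ge0. Qed.

Lemma bits_mass_sum1 : \sum_al bits_mass al = 1.
Proof.
rewrite -(bigA_distr_bigA (fun c => bit_mass (lam * fine (area R (cell y0 h c))))) big1// => c _.
exact: bit_mass_sum1.
Qed.

Local Notation mass := (@product_mass R Al bits_mass (seq_sub (ball3 N))).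

Definition cylinder x : set W :=
  [set w | forall v : window a b N, bit R (Pi w `&` gcell y0 h (val v.1) v.2) = x v.1 v.2].

Lemma measurable_cylinder x : measurable (cylinder x).
Proof.
have -> : cylinder x = \big[setI/setT]_(v : window a b N)
    [set w | bit R (Pi w `&` gcell y0 h (val v.1) v.2) == x v.1 v.2].
  rewrite -bigcap_seq; apply/seteqP; split => w hw v.
    by move=> _ /=; rewrite hw.
  by apply/eqP/hw; rewrite /= mem_index_enum.
apply: bigsetI_measurable => v _.
exact: (measurable_cell_bit ppp (pred1 (x v.1 v.2)) (measurable_gcell _ _ _ _)).
Qed.

Lemma prob_cylinder x : P (cylinder x) = (mass x)%:E.
Proof.
rewrite (prob_bits_eq ppp (m := @cell_mass R lam y0 h a b N)); last 3 first.
- by move=> v; exact: measurable_gcell.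
- exact: gv_disjoint.
- by move=> v; rewrite (cell_massE muE y0_gt0 h_gt0 eta_ge0 eta_le fine_grid).
rewrite /product_mass /bits_mass pair_bigA /=; congr (_%:E); apply: eq_bigr => v _.
by rewrite /cell_mass area_gcell.
Qed.

Lemma cylinder_ext x w g : cylinder x w -> g \in ball3 N ->
  ext [ffun=> None] x g = bits_of (Pi w) g.
Proof.
move=> xw gN; rewrite ext_mem; apply/ffunP => c; rewrite [RHS]ffunE.
by have := xw (SeqSub gN, c).
Qed.

Variable k : nat.
Hypothesis far : disp_const R + 4 * (k.+1 + 6)%:R * ln (golden R) <= 2 * (t - 1).
Hypothesis t_ge1 : 1 <= t.
Hypothesis N_big : (k.+1 + 6 + M < N)%N.

Local Notation mark := (mark [ffun=> None] active_mark).

(** A labelling of positive mass is realised by some [w] outside the null events. Two marks at [g]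
    and [g'] become by [stable] two centres of [Pi w] active at t - 1, each in its translate of
    [kset]. Distinct ones would be more than 2 (t - 1) apart, contradicting the displacement bound;
    equal ones force [g = g'] by disjointness of tiles. *)
Lemma exclusive_mark s : exclusive bits_mass [ffun=> None] N active_mark (edge_ball (k.+1 + 5) s).
Proof.
move=> x mx.
have [w [xw [pw iw]]] : exists w, cylinder x w /\ (popping_times (@hdist R) (Pi w) (T w) /\
    Pi w `<=` [set x | inner x]).
  apply: contrapT => no.
  have : {ae P, forall w, ~ cylinder x w}.
    apply: filterS2 popping (inner_ae muE ppp Pi_uhp) => w pw iw xw; apply: no.
    by exists w.
  move=> /negligibleP; rewrite (_ : ~` _ = cylinder x); last first.
    by apply/seteqP; split => w /=; [move/contrapT|move=> ? ?].
  move=> /(_ (measurable_cylinder x)) E0.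
  have := prob_cylinder x; rewrite [LHS]E0 => -[m0].
  by rewrite -m0 eqxx in mx.
have small g : g \in edge_ball (k.+1 + 5) s -> reduced g /\ (size g <= k.+1 + 6)%N.
  rewrite -mem_edge_ball mem_cat => /orP[|/mapP[h' + ->]]; rewrite mem_ball3 => /andP[rg sg].
    by split => //; apply: leq_trans sg _; rewrite leq_add2l.
  split; first exact: reduced_lmul1.
  by apply: leq_trans (size_lmul1 _ _) _; rewrite (addnS k.+1 5) ltnS.
have act g : g \in edge_ball (k.+1 + 5) s -> mark x g ->
    exists z, [/\ kset z, Pi w (gam g z) & ((t - 1)%:E < T w (gam g z))%E].
  move=> /small [rg sg] /asboolP [gd [S [T' [Si pT SE [z [Sz kz Tz]]]]]].
  have Su y : Pi w y -> uhp y by exact: Pi_uhp.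
  have SS' g' : reduced g' -> (size g' <= M)%N -> bits_of S g' = bits_of (pull g (Pi w)) g'.
    move=> rg' sg'; rewrite SE// (cylinder_ext xw) ?bits_of_pull// mem_ball3 reduced_lmul//=.
    apply: leq_trans (size_lmul _ _) _; apply: leq_trans (ltnW N_big).
    exact: leq_add.
  have gS : good (bits_of S).
    have /asboolP [] // : active_mark (bits_of S).
    rewrite (active_mark_local SE); apply/asboolP; split => //.
    by exists S, T'; split => //; exists z.
  have [z' [[uz' Pz'] kz' Tz']] := stable y0_gt0 h_gt0 eta_ge0 eta_le fine_grid t_ge0 cover
    Si (@pull_inner R g _ iw) pT (pull_popping_times g Su pw) SS' gS Sz kz Tz.
  by exists z'.
move=> g g' gL g'L /(act g gL) [z [kz Pz Tz]] /(act g' g'L) [z' [kz' Pz' Tz']].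
have [rg sg] := small _ gL; have [rg' sg'] := small _ g'L.
have [E|ne] := pselect (gam g z = gam g' z').
  exact: tiles_disjoint rg rg' (kset_triangle kz) (kset_triangle kz') E.
have [_ p2 _] := pw.
have t10 : 0 <= t - 1 by rewrite subr_ge0.
have := p2 (t - 1) _ _ t10 (conj Pz Tz) (conj Pz' Tz') ne.
have := hdist_gam_kset g g' kz kz'.
have lg : 0 <= ln (golden R) by apply: ln_ge0; have := golden_gt1 R; lra.
have : 2 * (size g + size g')%:R * ln (golden R) <= 4 * (k.+1 + 6)%:R * ln (golden R).
  have -> : 4 * (k.+1 + 6)%:R = 2 * ((k.+1 + 6) + (k.+1 + 6))%:R :> R by rewrite [in RHS]natrD; ring.
  by apply: ler_wpM2r => //; rewrite ler_pM2l// ler_nat leq_add.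
move=> h1 h2 h3; have := lt_le_trans h3 (le_trans h2 (le_trans (lerD (lexx _) h1) far)).
by rewrite ltxx.
Qed.

Lemma prob_active_mark : exists E, [/\ measurable E,
  (P E <= ((4 ^+ k.+1)^-1 * (1 + 2 * k.+1%:R))%:E)%E &
  forall w, active_mark (bits_of (Pi w)) -> E w].
Proof.
pose E : set W := \big[setU/set0]_(x : Om | mark x [::]) cylinder x.
exists E; split.
- by apply: bigsetU_measurable => x _; exact: measurable_cylinder.
- have := exclusive_density bits_mass_ge0 bits_mass_sum1 active_mark_local N_big exclusive_mark.
  rewrite -lee_fin; apply: le_trans.
  rewrite /E /mark_density -sumEFin -big_filter -[leRHS]big_filter.
  apply: le_trans (measure_big_setU_le _ _ measurable_cylinder) _.
  by apply: lee_sum => x _; have := lexx (P (cylinder x)); rewrite {2}prob_cylinder.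
- move=> w aw; pose x : Om := [ffun g => bits_of (Pi w) (val g)].
  have xw : cylinder x w by move=> v; rewrite /x !ffunE.
  rewrite /E -bigcup_seq_cond; exists x => //=.
  rewrite mem_index_enum /=. rewrite /mark -(active_mark_local (xi := bits_of (Pi w)))// => g rg sg.
  rewrite (cylinder_ext xw)// mem_ball3 rg /=; apply: leq_trans sg _.
  by apply: leq_trans (ltnW N_big); rewrite leq_addl.
Qed.

End fixed_window.

(** The density bound depends neither on the grid nor on the window, so the discretisation may be
    refined with exceptional probability 1 / (m + 1). Intersecting the resulting events over m
    removes this error. *)
Theorem kset_active_bound (k : nat) (t : R) : 1 <= t ->
  disp_const R + 4 * (k.+1 + 6)%:R * ln (golden R) <= 2 * (t - 1) ->
  exists E, [/\ measurable E, (P E <= ((4 ^+ k.+1)^-1 * (1 + 2 * k.+1%:R))%:E)%E &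
    forall w x, Pi w x -> kset x -> (t%:E < T w x)%E -> E w].
Proof.
move=> t1 far; have t0 : 0 <= t by lra.
set c := (4 ^+ k.+1)^-1 * _.
have approx (m : nat) : exists E, [/\ measurable E, (P E <= (c + m.+1%:R^-1)%:E)%E &
    forall w x, Pi w x -> kset x -> (t%:E < T w x)%E -> E w].
  have e0 : 0 < m.+1%:R^-1 :> R by rewrite invr_gt0.
  have [n [eta [y0 [h [a [b [M [B [[y00 h0 eta0 eta2] fi cov [mB PB] gB]]]]]]]]] :=
    good_likely lam_ge0 muE ppp t0 e0.
  have [E [mE PE EP]] := prob_active_mark y00 h0 eta0 eta2 fi t0 cov far t1 (ltnSn _).
  have [N1 [mN1 N10 N1P]] := popping.
  have [N2 [mN2 N20 N2P]] := inner_ae muE ppp Pi_uhp.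
  have mEB : measurable (E `|` B) by exact: measurableU.
  have mN : measurable (N1 `|` N2) by exact: measurableU.
  have PN : P (N1 `|` N2) = 0%E by rewrite measureU0.
  exists ((E `|` B) `|` (N1 `|` N2)); split.
  - exact: measurableU.
  - rewrite measureU0//.
    apply: le_trans (measureU2 _ _ _) _ => //; rewrite EFinD; exact: leeD.
  - move=> w x Px kx Tx; apply: contrapT => /not_orP [/not_orP [nE nB] /not_orP [nN1 nN2]].
    have pw : popping_times (@hdist R) (Pi w) (T w) by apply: contrapT => ?; apply: nN1; exact: N1P.
    have iw : Pi w `<=` [set x | inner x] by apply: contrapT => ?; apply: nN2; exact: N2P.
    apply: nE; apply: EP; apply/asboolP; split; first exact: gB.
    by exists (Pi w), (T w); split => //; exists x.
have [E EP] := choice approx.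
exists (\bigcap_m E m); split.
- by apply: bigcapT_measurable => m; have [] := EP m.
- apply/lee_addgt0Pr => e e0.
  have [m hm] : exists m : nat, m.+1%:R^-1 <= e.
    exists (Num.truncn e^-1); rewrite -[e]invrK lef_pV2 ?posrE ?invr_gt0//.
    by rewrite invrK; apply/ltW/truncnS_gt.
  have [mE PE _] := EP m.
  apply: (@le_trans _ _ (P (E m))).
    apply: le_measure; rewrite ?inE//; last by move=> w; apply.
    by apply: bigcapT_measurable => m'; have [] := EP m'.
  by apply: le_trans PE _; rewrite -EFinD lee_fin lerD2l.
- by move=> w x Px kx Tx m _; have [_ _ EW] := EP m; exact: EW Px kx Tx.
Qed.

End factor_event.

(** * Escape from balls *)

Lemma counting_image (R : realType) (U V : choiceType) (f : U -> V) (S : set U) :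
  {in S &, injective f} -> counting (f @` S) = counting S :> \bar R.
Proof.
move=> fi; have fS : (f @` S #= S)%card by exact: inj_card_eq.
rewrite /counting; case: asboolP => [[n Sn]|nf]; case: asboolP => fS' //.
- congr (_%:R%:E); rewrite (card_fset_set Sn).
  by rewrite (card_fset_set (card_eq_trans (card_esym fS) Sn)).
- by case: fS'; exists n; apply: card_eq_trans Sn; exact: card_esym.
- by case: nf; exact: finite_image.
Qed.

(** * Transport by affine isometries *)

Section affine_process.
Context (R : realType) (d : measure_display) (W : measurableType d) (P : probability W R).
Variables (lam : R) (mu : set (R * R) -> \bar R) (Pi : W -> set (R * R)) (T : W -> R * R -> \bar R).
Hypothesis lam_ge0 : 0 <= lam.
Hypothesis muE : forall A : set (R * R), measurable A -> mu A = (lam%:E * area R A)%E.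
Hypothesis ppp : poisson_point_process P mu Pi.
Hypothesis Pi_uhp : forall w, Pi w `<=` [set x | uhp x].
Hypothesis popping : {ae P, forall w, popping_times (@hdist R) (Pi w) (T w)}.
Variables (a b : R).
Hypothesis a_gt0 : 0 < a.

Local Notation f := (affine a b).
Let f' : R * R -> R * R := affine a^-1 (- (b / a)).

Let fK : cancel f f'.
Proof.
have a0 : a != 0 by rewrite gt_eqF.
by case=> x y; rewrite /f' /affine /=; congr (_, _); field.
Qed.

Let f'K : cancel f' f.
Proof.
have a0 : a != 0 by rewrite gt_eqF.
by case=> x y; rewrite /f' /affine /=; congr (_, _); field.
Qed.

Let Pi' w := f @^-1` Pi w.

Let count_affine (A : set (R * R)) w : point_count R Pi' A w = point_count R Pi (f' @^-1` A) w.
Proof.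
rewrite /point_count -(@counting_image _ _ _ f); last by move=> x y _ _; exact: can_inj fK _ _.
congr counting; apply/seteqP; split => x.
  by move=> [z [Pz Az] <-]; split => //=; rewrite fK.
by move=> [Px Ax]; exists (f' x); rewrite ?f'K//; split => //=; rewrite /Pi' /= f'K.
Qed.

Let measurable_f' (A : set (R * R)) : measurable A -> measurable (f' @^-1` A).
Proof. exact: (measurable_preimage (measurable_affine _ _)). Qed.

Let ppp' : poisson_point_process P mu Pi'.
Proof.
have [p1 p2 p3 p4] := ppp.
have mu' A : measurable A -> mu (f' @^-1` A) = mu A.
  move=> mA; rewrite !muE//; last exact: measurable_f'.
  by rewrite area_affine// invr_gt0.
have cE (A : set (R * R)) : point_count R Pi' A = point_count R Pi (f' @^-1` A).
  by apply/funext => w; exact: count_affine.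
split=> [A mA|A m mA|A mA|n A mA dA].
- by rewrite cE; apply: p1; exact: measurable_f'.
- rewrite cE => Am; apply: p2; first exact: measurable_f'.
  by rewrite mu'.
- rewrite cE => Am; apply: p3; first exact: measurable_f'.
  by rewrite mu'.
- have -> : (fun i => point_count R Pi' (A i)) = (fun i => point_count R Pi (f' @^-1` A i)).
    by apply/funext => i; exact: cE.
  apply: p4 => [i|i j ij]; first exact: measurable_f'.
  by rewrite -preimage_setI dA ?preimage_set0.
Qed.

(** The pull-back of the process by the isometry is a process of the same intensity, to which the
    bound on [kset] itself applies. *)
Lemma affine_kset_active_bound (k : nat) (t : R) : 1 <= t ->
  disp_const R + 4 * (k.+1 + 6)%:R * ln (golden R) <= 2 * (t - 1) ->
  exists E, [/\ measurable E, (P E <= ((4 ^+ k.+1)^-1 * (1 + 2 * k.+1%:R))%:E)%E &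
    forall w z, Pi w (f z) -> kset z -> (t%:E < T w (f z))%E -> E w].
Proof.
move=> t1 far.
have Pi'_uhp w : Pi' w `<=` [set x | uhp x] by move=> x /Pi_uhp; exact: uhp_affineE.
have popping' : {ae P, forall w, popping_times (@hdist R) (Pi' w) (T w \o f)}.
  apply: filterS popping => w [p1 p2 p3]; split.
  - by move=> x /p1.
  - move=> s x y s0 [Px Tx] [Py Ty] xy; rewrite -(hdist_affine b x y a_gt0).
    by apply: (p2 s) => // /(can_inj fK); exact: xy.
  - move=> x Px Tx; have [y [Py yx Ty dy]] := p3 _ Px Tx.
    exists (f' y); split; rewrite /Pi' /= ?f'K//.
      by move=> E; apply: yx; rewrite -E f'K.
    by rewrite -(hdist_affine b x (f' y) a_gt0) f'K.
have [E [mE PE EP]] := kset_active_bound lam_ge0 muE ppp' Pi'_uhp popping' t1 far.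
by exists E; split => // w z Pz kz Tz; exact: EP Pz kz Tz.
Qed.

End affine_process.

(** * Covering a ball by affine copies of [kset] *)

Section ball_cover.
Variable R : realType.
Implicit Types (x z : R * R) (r : R).

Lemma ball_slope r x : 0 <= r -> uhp x -> hdist (0, 1) x <= r -> `|x.1| <= 2 * ch r * x.2.
Proof.
move=> r0 ux hx; have [b1 [b2 _]] := ball_box r0 ux hx.
have u1 : uhp (0 : R, 1) by rewrite /uhp /=.
move: hx; rewrite hdist_le// /chdist /= => hc.
have x0 : 0 < x.2 := ux.
have x20 : x.2 != 0 by rewrite gt_eqF.
have E : 1 + ((0 - x.1) ^+ 2 + (1 - x.2) ^+ 2) / (2 * 1 * x.2) =
   (x.1 ^+ 2 + x.2 ^+ 2 + 1) / (2 * x.2) by field.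
rewrite E ler_pdivrMr in hc; last by rewrite mulr_gt0.
have c1 := ch_ge1 r.
rewrite -div1r ler_pdivrMr in b1; last lra.
move: c1 hc b1 b2; move: (ch r) => c c1 hc b1 b2.
have s1 := sqr_ge0 x.2.
have : `|x.1| ^+ 2 <= (2 * c * x.2) ^+ 2.
  rewrite real_normK ?num_real//; nra.
by rewrite (@ler_pXn2r _ 2)// ?nnegrE//; nra.
Qed.

Lemma dyadic_scale (m : nat) (y : R) : 1 <= y -> y < 2 ^+ m ->
  exists2 j, (j < m)%N & 2 ^+ j <= y < 2 ^+ j.+1.
Proof.
move=> y1; elim: m => [|m IH] ym; first by move: ym; rewrite expr0; lra.
have [ym'|ym'] := ltP y (2 ^+ m).
  by have [j jm hj] := IH ym'; exists j => //; exact: ltnW.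
by exists m => //; rewrite ym' ym.
Qed.

(* A copy of [kset] scaled by [a] has heights in [[a, 2 * a[] and width [a / 2], so that
   half-integer multiples of [a] as shifts tile the strip. *)
Definition box_scale r (j : nat) : R := 2 ^+ j / (2 * ch r).
Definition box_shift r (j i : nat) : R := box_scale r j * (i%:R / 2 - 4 * ch r - 4^-1).

Lemma box_scale_gt0 r j : 0 < box_scale r j.
Proof. by rewrite divr_gt0 ?exprn_gt0//; have := ch_ge1 r; lra. Qed.

Lemma ball_cover r (m q : nat) x : 0 <= r -> 4 * ch r ^+ 2 < 2 ^+ m -> 16 * ch r < q%:R ->
  uhp x -> hdist (0, 1) x <= r ->
  exists (j i : nat) z, [/\ (j < m)%N, (i < q)%N, kset z & x = affine (box_scale r j) (box_shift r j i) z].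
Proof.
move=> r0 mh qh ux hx; have [b1 [b2 _]] := ball_box r0 ux hx.
have sl := ball_slope r0 ux hx; have c1 := ch_ge1 r.
have [||j jm /andP[j1 j2]] := @dyadic_scale m (x.2 * (2 * ch r)).
- by rewrite -ler_pdivrMr ?div1r//; lra.
- apply: le_lt_trans mh; rewrite expr2; nra.
have al0 := box_scale_gt0 r j.
have a1 : box_scale r j <= x.2 by rewrite /box_scale ler_pdivrMr//; lra.
have a2 : x.2 < 2 * box_scale r j.
  by rewrite /box_scale mulrA -exprS ltr_pdivlMr//; lra.
set al := box_scale r j in al0 a1 a2 *.
pose u := 2 * (x.1 / al + 4 * ch r).
have /ler_normlP [s1 s2] : `|x.1 / al| <= 4 * ch r.
  rewrite normrM normfV (gtr0_norm al0) ler_pdivrMr//; apply: le_trans sl _.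
  nra.
have u0 : 0 <= u by rewrite /u; lra.
have /andP[i1 i2] : (Num.truncn u)%:R <= u < (Num.truncn u).+1%:R by exact: truncn_itv.
set i := Num.truncn u in i1 i2.
have iq : (i < q)%N.
  by rewrite -(ltr_nat R); apply: le_lt_trans qh; apply: le_trans i1 _; rewrite /u; lra.
exists j, i, (x.1 / al - i%:R / 2 + 4 * ch r + 4^-1, x.2 / al); split => //.
  rewrite -natr1 in i2; rewrite /u in i1 i2; split => /=; try lra.
    by rewrite ler_pdivlMr// mul1r.
  by rewrite ltr_pdivrMr.
have al1 : al != 0 by rewrite gt_eqF.
rewrite {1}[x]surjective_pairing /affine /box_shift -/al /=; congr (_, _); field => //.
Qed.

Lemma ch_le_expR r : 0 <= r -> ch r <= expR r.
Proof.
move=> r0; have : expR (- r) <= expR r by rewrite ler_expR; lra.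
rewrite /ch; lra.
Qed.

(** About 4 r dyadic heights and 16 cosh r columns; the crude bound e^(1/2) <= 2 turns the
    truncation of 4 r into a power of two exceeding e^(2 r). *)
Lemma box_count r : 0 <= r -> exists m q : nat, [/\ 4 * ch r ^+ 2 < 2 ^+ m, 16 * ch r < q%:R &
  (m * q)%:R <= (4 * r + 3) * (17 * expR r)].
Proof.
move=> r0; have c1 := ch_ge1 r; have ce := ch_le_expR r0.
have e1 : 1 <= expR r by apply: le_trans ce.
have r4 : 0 <= 4 * r by lra.
have c16 : 0 <= 16 * ch r by lra.
have /andP[m1 m2] : (Num.truncn (4 * r))%:R <= 4 * r < (Num.truncn (4 * r)).+1%:R by exact: truncn_itv.
have /andP[q1 q2] : (Num.truncn (16 * ch r))%:R <= 16 * ch r < (Num.truncn (16 * ch r)).+1%:R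
  by exact: truncn_itv.
move: (Num.truncn _) m1 m2 => m m1 m2; move: (Num.truncn _) q1 q2 => q q1 q2.
exists m.+3, q.+1; split => //.
  have half : expR 2^-1 <= 2 :> R.
    have := expR_ge1Dx (- 2^-1 : R); rewrite expRN => h.
    have e0 := expR_gt0 (2^-1 : R).
    have : (1 + - 2^-1) * expR 2^-1 <= 1 :> R by rewrite -ler_pdivlMr// div1r.
    lra.
  have : expR (2 * r) < 2 ^+ m.+1.
    apply: (@lt_le_trans _ _ (expR 2^-1 ^+ m.+1)).
      by rewrite -expRM_natl ltr_expR; lra.
    by rewrite lerXn2r ?nnegrE ?expR_ge0//.
  have c2 : ch r ^+ 2 <= expR (2 * r).
    by rewrite (expRM_natl 2) lerXn2r// nnegrE ?expR_ge0//; lra.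
  have -> : (2 ^+ m.+3 : R) = 4 * 2 ^+ m.+1 by rewrite !exprS; ring.
  by move=> e2; rewrite ltr_pM2l//; apply: le_lt_trans c2 e2.
rewrite -addn3 -addn1 natrM !natrD; apply: ler_pM; lra.
Qed.

End ball_cover.

Section escape.
Context (R : realType) (d : measure_display) (W : measurableType d) (P : probability W R).
Variables (lam : R) (mu : set (R * R) -> \bar R) (Pi : W -> set (R * R)) (T : W -> R * R -> \bar R).
Hypothesis lam_ge0 : 0 <= lam.
Hypothesis muE : forall A : set (R * R), measurable A -> mu A = (lam%:E * area R A)%E.
Hypothesis ppp : poisson_point_process P mu Pi.
Hypothesis Pi_uhp : forall w, Pi w `<=` [set x | uhp x].
Hypothesis popping : {ae P, forall w, popping_times (@hdist R) (Pi w) (T w)}.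

Lemma ball_active_bound (k : nat) (r t : R) : 0 <= r -> 1 <= t ->
  disp_const R + 4 * (k.+1 + 6)%:R * ln (golden R) <= 2 * (t - 1) ->
  exists E, [/\ measurable E,
    (P E <= ((4 * r + 3) * (17 * expR r) * ((4 ^+ k.+1)^-1 * (1 + 2 * k.+1%:R)))%:E)%E &
    forall w x, Pi w x -> hdist (0, 1) x <= r -> (t%:E < T w x)%E -> E w].
Proof.
move=> r0 t1 far; have [m [q [mh qh mq]]] := box_count r0.
have [E EP] := choice (fun ji : nat * nat => affine_kset_active_bound lam_ge0 muE ppp Pi_uhp popping
  (box_shift r ji.1 ji.2) (box_scale_gt0 r ji.1) t1 far).
pose s := [seq (j, i) | j <- iota 0 m, i <- iota 0 q].
have mE ji : measurable (E ji) by have [] := EP ji.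
exists (\big[setU/set0]_(ji <- s) E ji); split.
- exact: bigsetU_measurable.
- apply: le_trans (measure_big_setU_le _ _ mE) _.
  apply: (@le_trans _ _ (\sum_(ji <- s) ((4 ^+ k.+1)^-1 * (1 + 2 * k.+1%:R))%:E)%E).
    by apply: lee_sum => ji _; have [] := EP ji.
  rewrite sumEFin lee_fin big_const_seq count_predT iter_addr_0 -[leLHS]mulr_natl.
  apply: ler_wpM2r; first by rewrite mulr_ge0// ?invr_ge0 ?exprn_ge0// addr_ge0// mulr_ge0.
  by rewrite size_allpairs !size_iota.
- move=> w x Px hx Tx.
  have [j [i [z [jm iq kz xE]]]] := ball_cover r0 mh qh (Pi_uhp Px) hx.
  rewrite -bigcup_seq; exists (j, i).
    by apply: allpairs_f; rewrite mem_iota.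
  have [_ _ EW] := EP (j, i); rewrite xE in Px Tx; exact: EW Px kz Tx.
Qed.

Definition speed : R := ln 2 / ln (golden R).

Lemma ln_golden_gt0 : 0 < ln (golden R).
Proof. by apply: ln_gt0; exact: golden_gt1. Qed.

(** The O(n e^(theta n)) boxes each contribute O(n e^(- speed n)). Half of the gap between [speed]
    and [theta] absorbs the two linear factors, and the other half is the rate of decay. *)
Lemma ball_active_decay (theta : R) : 0 <= theta -> theta < speed ->
  exists A rho (n0 : nat), [/\ 0 <= A, 0 < rho, rho < 1 & forall n, (n0 <= n)%N ->
    exists E, [/\ measurable E, (P E <= (A * rho ^+ n)%:E)%E &
    forall w x, Pi w x -> hdist (0, 1) x <= theta * n%:R -> (n%:R%:E < T w x)%E -> E w]].
Proof.
move=> th0 thc; have L0 := ln_golden_gt0; have D0 := disp_const_ge0 R.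
set L := ln (golden R) in L0 *; set D := disp_const R in D0 *.
pose dl := speed - theta; have dl0 : 0 < dl by rewrite subr_gt0.
(* With this constant s = n / (2 L) - cst solves D + 4 (s + 6) L = 2 (n - 1), so the integer part of
   s is an admissible radius in the tree. *)
pose cst := (2 + D + 24 * L) / (4 * L).
have cst0 : 0 <= cst by rewrite divr_ge0//; lra.
pose s (n : nat) : R := n%:R / (2 * L) - cst.
have ln20 : 0 < ln 2 :> R by apply: ln_gt0; lra.
pose B := 2 * ln 2 * (1 + cst).
pose A := (4 * theta + 3) * (17 * expR B) * (1 + L^-1) * (8 / dl ^+ 2) * expR (dl / 2).
pose n0 := (Num.truncn (2 * L * (1 + cst))).+1.
have A0 : 0 <= A.
  have l1 : 0 <= 1 + L^-1 by rewrite addr_ge0// invr_ge0 ltW.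
  have t1 : 0 <= 4 * theta + 3 by lra.
  by rewrite !mulr_ge0 ?expR_ge0 ?invr_ge0 ?sqr_ge0.
exists A, (expR (- (dl / 2))), n0; split => //.
- exact: expR_gt0.
- by rewrite expR_lt1; lra.
move=> n n0n.
have ns : 1 <= s n.
  rewrite /s lerBrDr ler_pdivlMr; last lra.
  rewrite mulrC; apply/ltW; apply: lt_le_trans (truncnS_gt _) _.
  by rewrite ler_nat.
have s0 : 0 <= s n by lra.
have /andP[k1 k2] : (Num.truncn (s n))%:R <= s n < (Num.truncn (s n)).+1%:R by exact: truncn_itv.
have k0 : (0 < Num.truncn (s n))%N by rewrite -ltnS -(ltr_nat R); exact: le_lt_trans ns k2.
move: (Num.truncn _) k0 k1 k2 => [//|k] _ k1 k2.
have nE : 2 * n%:R = 4 * L * s n + (2 + D + 24 * L).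
  by rewrite /s /cst; field; rewrite gt_eqF.
have Lk : L * k.+1%:R <= L * s n by rewrite ler_pM2l.
have far : D + 4 * (k.+1 + 6)%:R * L <= 2 * (n%:R - 1).
  by rewrite natrD; lra.
have n1 : 1 <= n%:R :> R by have : L <= L * s n by [rewrite ler_peMr// ltW]; lra.
have r0 : 0 <= theta * n%:R by rewrite mulr_ge0.
have [E [mE PE EW]] := ball_active_bound r0 n1 far.
exists E; split => //; apply: le_trans PE _; rewrite lee_fin.
have e4 : (4 ^+ k.+1)^-1 <= expR (B - speed * n%:R).
  have -> : (4 ^+ k.+1)^-1 = expR (- (2 * ln 2 * k.+1%:R)) :> R.
    have {1}-> : 4 = expR (2 * ln 2) :> R by rewrite (expRM_natl 2) lnK ?posrE// -natrX.
    by rewrite -expRM_natr -expRN.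
  rewrite ler_expR.
  have -> : speed * n%:R = 2 * ln 2 * (s n + cst) by rewrite /speed /s -/L; field; rewrite gt_eqF.
  have : ln 2 * (s n - 1) <= ln 2 * k.+1%:R :> R.
    by rewrite ler_pM2l//; move: k2; rewrite -(natr1 k.+1); lra.
  by rewrite /B; lra.
have n00 : 0 <= n%:R :> R by [].
have p1 : 4 * (theta * n%:R) + 3 <= (4 * theta + 3) * (n%:R + 1) by nra.
have li : 0 < L^-1 by rewrite invr_gt0.
have p2 : 1 + 2 * k.+1%:R <= (1 + L^-1) * (n%:R + 1).
  have : s n <= n%:R / (2 * L) by rewrite /s; lra.
  have -> : n%:R / (2 * L) = L^-1 * n%:R / 2 by field; rewrite gt_eqF.
  nra.
(* This is x^2 / 2 <= e^x for x = dl (n + 1) / 2. *)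
have p3 : (n%:R + 1) ^+ 2 <= 8 / dl ^+ 2 * expR (dl / 2 * (n%:R + 1)).
  have x0 : 0 <= dl / 2 * (n%:R + 1) by rewrite mulr_ge0// ?addr_ge0// divr_ge0// ltW.
  have := expR_ge1Dxn 1 x0; rewrite (_ : 2`! = 2)%N// exprMn.
  rewrite -ler_pdivrMl ?divr_gt0 ?exprn_gt0// => h.
  have -> : (8 / dl ^+ 2)^-1 * (n%:R + 1) ^+ 2 = (dl / 2) ^+ 2 * (n%:R + 1) ^+ 2 / 2.
    by field; rewrite gt_eqF.
  lra.
set X := expR (theta * n%:R).
have E1 : X * expR (B - speed * n%:R) = expR B * expR (- (dl * n%:R)).
  by rewrite -!expRD; congr expR; rewrite /dl; ring.
have E2 : expR (dl / 2 * (n%:R + 1)) * expR (- (dl * n%:R)) = expR (dl / 2) * expR (- (dl / 2)) ^+ n.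
  by rewrite -expRM_natr -!expRD; congr expR; field.
have X0 : 0 <= X by exact: expR_ge0.
have k00 : 0 <= 1 + 2 * k.+1%:R :> R by rewrite addr_ge0// mulr_ge0.
apply: (@le_trans _ _ ((4 * theta + 3) * (n%:R + 1) * (17 * X) *
   (expR (B - speed * n%:R) * ((1 + L^-1) * (n%:R + 1))))).
  have q0 : 0 <= 4 * (theta * n%:R) + 3 by lra.
  have i0 : 0 <= (4 ^+ k.+1)^-1 :> R by rewrite invr_ge0 exprn_ge0.
  apply: ler_pM.
  - by rewrite !mulr_ge0.
  - exact: mulr_ge0.
  - by apply: ler_wpM2r => //; rewrite mulr_ge0.
  - exact: ler_pM.
have -> : (4 * theta + 3) * (n%:R + 1) * (17 * X) *
   (expR (B - speed * n%:R) * ((1 + L^-1) * (n%:R + 1))) =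
   (4 * theta + 3) * 17 * (1 + L^-1) * (X * expR (B - speed * n%:R)) * (n%:R + 1) ^+ 2 by ring.
rewrite E1.
have -> : A * expR (- (dl / 2)) ^+ n = (4 * theta + 3) * 17 * (1 + L^-1) *
    (expR B * expR (- (dl * n%:R))) * (8 / dl ^+ 2 * expR (dl / 2 * (n%:R + 1))).
  rewrite /A; have -> : forall u v w x y z : R, u * (17 * v) * w * x * y * z =
     u * 17 * w * v * x * (y * z) by move=> *; ring.
  by rewrite -E2; ring.
have t1 : 0 <= 4 * theta + 3 by lra.
have l1 : 0 <= 1 + L^-1 by lra.
by apply: ler_wpM2l => //; rewrite !mulr_ge0 ?expR_ge0.
Qed.

(** Borel-Cantelli along integer times. The events are indexed from [n0] on, so that the geometric
    bound holds for all of them. *)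
Lemma eventually_far (theta : R) : 0 <= theta -> theta < speed ->
  {ae P, forall w, exists n0 : nat, forall n, (n0 <= n)%N ->
    forall x, Pi w x -> (n%:R%:E < T w x)%E -> theta * n%:R < hdist (0, 1) x}.
Proof.
move=> th0 thc; have [A [rho [n0 [A0 rho0 rho1 decay]]]] := ball_active_decay th0 thc.
have dec n : exists E, [/\ measurable E, (P E <= (A * rho ^+ n)%:E)%E &
    forall w x, Pi w x -> hdist (0, 1) x <= theta * (n0 + n)%:R -> ((n0 + n)%:R%:E < T w x)%E -> E w].
  have [E [mE PE EW]] := decay _ (leq_addr n n0); exists E; split => //.
  apply: le_trans PE _; rewrite lee_fin; apply: ler_wpM2l => //; rewrite exprD.
  by rewrite ler_piMl ?exprn_ge0 ?exprn_ile1// ltW.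
have [E EP] := choice dec.
have mE n : measurable (E n) by have [] := EP n.
exists (lim_sup_set E); split.
- by apply: bigcapT_measurable => n; apply: bigcup_measurable.
- apply: lim_sup_set_cvg0 => //; apply: (@le_lt_trans _ _ (A / (1 - rho))%:E); last exact: ltry.
  apply: lime_le; first by apply: is_cvg_nneseries => n _ _; exact: measure_ge0.
  apply: nearW => n.
  apply: (@le_trans _ _ (\sum_(0 <= i < n) (A * rho ^+ i)%:E)%E).
    by apply: lee_sum => i _; have [] := EP i.
  rewrite sumEFin lee_fin; apply: geometric_le_lim => //.
  by rewrite gtr0_norm.
- move=> w /=; apply: contra_notP => nE.
  have [m hm] : exists m, forall j, (m <= j)%N -> ~ E j w.
    apply: contrapT => no; apply: nE => m _; apply: contrapT => nj; apply: no.
    by exists m => j mj Ej; apply: nj; exists j.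
  exists (n0 + m)%N => n nm x Px Tx; rewrite ltNge; apply/negP => hx.
  have e : (n0 + (n - n0))%N = n by rewrite subnKC//; apply: leq_trans nm; exact: leq_addr.
  have [_ _ EW] := EP (n - n0)%N; rewrite e in EW.
  by apply: (hm (n - n0)%N) (EW _ _ Px hx Tx); rewrite leq_subRL//; apply: leq_trans nm; exact: leq_addr.
Qed.

End escape.

(** * Return to curvature k and conclusion *)

Section curvature.
Context (R : realType) (k : R) (d : measure_display) (W : measurableType d) (P : probability W R).
Variables (Pi : W -> set (R * R)) (T : W -> R * R -> \bar R).
Hypothesis k_lt0 : k < 0.
Hypothesis process : poisson_balloon_process P (@upper_half_plane R) (hyp_dist k) (hyp_area k) Pi T.

Local Notation kappa := (Num.sqrt (- k)).
Let kappa_gt0 : 0 < kappa.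
Proof. by rewrite sqrtr_gt0 oppr_gt0. Qed.

Lemma popping_times_rescale (S : set (R * R)) (T0 : R * R -> \bar R) :
  popping_times (hyp_dist k) S T0 ->
  popping_times (@hdist R) S (fun x => kappa%:E * T0 x)%E.
Proof.
have kap0 : kappa != 0 by rewrite gt_eqF.
have sc x y : hdist x y = kappa * hyp_dist k x y by rewrite hyp_distE mulrC divfK.
move=> [p1 p2 p3]; split.
- by move=> x Sx; rewrite mule_gt0 ?lte_fin// p1.
- move=> t x y t0 [Sx Tx] [Sy Ty] xy.
  have act z : (t%:E < kappa%:E * T0 z)%E -> ((kappa^-1 * t)%:E < T0 z)%E.
    by rewrite EFinM lte_pdivrMl.
  have t0' : 0 <= kappa^-1 * t by rewrite mulr_ge0// invr_ge0 ltW.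
  have := p2 _ x y t0' (conj Sx (act _ Tx)) (conj Sy (act _ Ty)) xy.
  rewrite -(ltr_pM2l kappa_gt0) -sc (_ : kappa * _ = 2 * t)//.
  by field.
- move=> x Sx Tx; have Tx' : (T0 x < +oo)%E.
    by move: Tx; case: (T0 x) => [r|//|//]; rewrite ?ltry// gt0_muley ?lte_fin.
  have [y [Sy yx Ty dy]] := p3 _ Sx Tx'; exists y; split => //; first by rewrite Ty.
  by rewrite sc EFinM dy muleCA.
Qed.

Lemma speed_gt1 : 1 < speed R.
Proof.
rewrite /speed ltr_pdivlMr ?mul1r ?ln_golden_gt0//.
have g1 := golden_gt1 R; have g2 := golden_lt2 R.
by rewrite ltr_ln ?posrE//; lra.
Qed.

(** Distances and times are scaled by the same factor, so the speed does not depend on [k]. The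
    countably many rates [th m], increasing to [speed], make the null event independent of [theta]
    and of [o]; the passage from integer to real times and the change of base point cost a bounded
    amount, absorbed by the slack [th m - theta]. *)
Lemma dist_to_active_ae : {ae P, forall w, forall (o : R * R) (theta : R),
  @upper_half_plane R o -> theta < speed R ->
  exists s0 : R, forall t, s0 <= t ->
    ((theta * t)%:E <= dist_to_set (hyp_dist k) o (active (Pi w) (T w) t))%E}.
Proof.
have [Pi_uhp ppp popping] := process.
have lam0 : 0 <= (- k)^-1 by rewrite invr_ge0 oppr_ge0 ltW.
have popping' : {ae P, forall w, popping_times (@hdist R) (Pi w) (fun x => kappa%:E * T w x)%E}.
  by apply: filterS popping => w; exact: popping_times_rescale.
pose th (m : nat) : R := Num.max 0 (speed R - m.+1%:R^-1).
have th0 m : 0 <= th m by rewrite le_max lexx.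
have thc m : th m < speed R.
  have := speed_gt1; have : 0 < m.+1%:R^-1 :> R by rewrite invr_gt0.
  by rewrite /th gt_max; move: (m.+1%:R^-1) => u u0 c1; apply/andP; split; lra.
have far := ae_foralln (fun m => eventually_far lam0 (fun A => @hyp_areaE R k A k_lt0) ppp Pi_uhp popping' (th0 m) (thc m)).
apply: filterS far => w far o theta uo thetac.
have [m thm] : exists m, theta < th m.
  exists (Num.truncn (speed R - theta)^-1); rewrite lt_max; apply/orP; right.
  have c0 : 0 < speed R - theta by lra.
  have : (Num.truncn (speed R - theta)^-1).+1%:R^-1 < speed R - theta.
    rewrite -[ltRHS]invrK ltf_pV2 ?posrE ?invr_gt0//.
    exact: truncnS_gt.
  by move: (_.+1%:R^-1) => u; lra.
have [n0 hn0] := far m.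
have u1 : uhp (0 : R, 1) by rewrite /uhp /=.
pose C := th m + hdist (0, 1) o.
have C0 : 0 <= C by rewrite addr_ge0// hdist_ge0.
(* The first threshold brings the rescaled integer time above [n0]; the second makes the slack
   exceed [C], the cost of rounding the time and moving the base point. *)
exists (Num.max ((n0%:R + 1) / kappa) (C / (kappa * (th m - theta)))) => t.
rewrite ge_max => /andP[t1 t2].
rewrite ler_pdivrMr// in t1; rewrite ler_pdivrMr in t2; last by rewrite mulr_gt0//; lra.
apply: le_ereal_inf_tmp => _ [x [Px Tx] <-]; rewrite lee_fin hyp_distE ler_pdivlMr//.
have kt0 : 0 <= t * kappa by apply: le_trans t1; rewrite addr_ge0.
have /andP[n1 n2] : (Num.truncn (t * kappa))%:R <= t * kappa < (Num.truncn (t * kappa)).+1%:R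
  by exact: truncn_itv.
set n := Num.truncn _ in n1 n2.
have n0n : (n0 <= n)%N by rewrite -ltnS -(ltr_nat R); lra.
have Tn : (n%:R%:E < kappa%:E * T w x)%E.
  apply: (@le_lt_trans _ _ (kappa * t)%:E); first by rewrite lee_fin mulrC.
  by rewrite EFinM lte_pmul2l ?lte_fin.
have ux := Pi_uhp _ _ Px.
have h1 := hn0 n n0n x Px Tn.
have h2 := hdist_triangle uo u1 ux.
have h3 : th m * (t * kappa - 1) <= th m * n%:R.
  by apply: ler_wpM2l => //; rewrite -natr1 in n2; lra.
move: t2 h1 h2 h3; rewrite /C; lra.
Qed.

End curvature.

Theorem theorem2 (R : realType) (k : R) (d : measure_display)
    (W : measurableType d) (P : probability W R)
    (Pi : W -> set (R * R)) (T : W -> R * R -> \bar R) :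
  k < 0 ->
  poisson_balloon_process P (@upper_half_plane R) (hyp_dist k) (hyp_area k)
    Pi T ->
  {ae P, forall w, forall x : R * R, @upper_half_plane R x ->
    bounded_set [set t : R | 0 <= t /\ covered (hyp_dist k) (Pi w) (T w) t x]}
  /\
  forall o : R * R, @upper_half_plane R o ->
    {ae P, forall w,
      ((ln 2 / ln ((1 + Num.sqrt 5) / 2))%:E
       <= limf_einf
            (fun t : R =>
               dist_to_set (hyp_dist k) o (active (Pi w) (T w) t) * (t^-1)%:E)
            (+oo%R : set_system R))%E}.
Proof.
move=> k0 process; have far := dist_to_active_ae k0 process; split.
  apply: filterS far => w far x ux.
  have c1 := speed_gt1 R.
  (* A rate strictly between 1 and [speed]: balloons have radius t, whereas active centres are
     eventually at least this rate times t away. *)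
  have [|s0 hs0] := far x ((1 + speed R) / 2) ux; first lra.
  pose s := Num.max s0 1.
  exists s; split; first exact: num_real.
  move=> M sM t [t0 xt] /=; rewrite ger0_norm// leNgt; apply/negP => Mt.
  have : s < t by exact: lt_trans Mt.
  rewrite gt_max => /andP[st t1].
  have := le_trans (hs0 t (ltW st)) xt; rewrite lee_fin; nra.
move=> o uo; apply: filterS far => w far.
rewrite limf_einfE; apply/lee_subgt0Pr => e e0.
have [|s0 hs0] := far o (speed R - e) uo; first lra.
pose s := Num.max s0 1.
apply: (@le_trans _ _ (ereal_inf [set (dist_to_set (hyp_dist k) o (active (Pi w) (T w) t) * (t^-1)%:E)%E
   | t in [set t | s < t]])); last first.
  apply: ereal_sup_ubound; exists [set t | s < t] => //.
  by exists s; split => //; exact: num_real.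
apply: le_ereal_inf_tmp => _ [t st <-]; move: st; rewrite /= gt_max => /andP[st t1].
have t0 : 0 < t by lra.
rewrite -EFinB lee_pdivlMr//.
by apply: le_trans (hs0 t (ltW st)).
Qed.
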